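(* Let $g:[0,1]\to\mathbb{R}$ be a $C^1$-function satisfying $g^-(t) \leq g(t) < g^+(t)$ for $0 \leq t \leq 1$. Then, for every $t \in (0,1)$, $$P\left( \min_{u \in [t,1]} \left\{ H_{\mu}^{g^- \to g^+}(u) - g(u) \right\} = 0 \right) = 0 .$$
   Context: $g^-,g^+:[0,1]\to\mathbb{R}$ are $C^2$ with $\min_{0\le t\le1}(g^+(t)-g^-(t))>0$ and $g^-(0)=0$; $b:=g^+(1)$. $\eta^\pm(\varepsilon)>0$ for $\varepsilon>0$ and $\eta^\pm(\varepsilon)\downarrow0$ as $\varepsilon\downarrow0$. $C([0,1],\mathbb{R})$ carries the sup metric. $K(f,g):=\{w\in C([0,1],\mathbb{R}): f(u)\le w(u)\le g(u),\ 0\le u\le 1\}$. For a path-valued random variable $Y$ and Borel $\Lambda$ with $P(Y\in\Lambda)>0$, $Y\vert_\Lambda$ denotes $Y$ conditioned on $\{Y\in\Lambda\}$. $\mu:\mathbb{R}\to\mathbb{R}$ is $C^1$; $X=\{X(t)\}_{t\ge0}$ is the one-dimensional time-homogeneous diffusion satisfying $dX(t)=\mu(X(t))dt+dW(t)$, $X(0)=0$, $W$ a standard Brownian motion; $X_{[0,1]}^{0\to b}$ is the $X$-bridge from $0$ to $b$ on $[0,1]$, and $W_{[0,1]}^{0\to b}$ the Brownian bridge from $0$ to $b$ on $[0,1]$. $N_{[0,1]}(w):=\int_0^1\{\mu'(w(u))+\mu^2(w(u))\}du$. The Brownian house-moving $H^{g^-\to g^+}$ is the continuous Markov process on $[0,1]$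 which is the weak limit (known to exist) of $W_{[0,1]}^{0\to b}\vert_{K(g^--\eta^-(\varepsilon),g^++\eta^+(\varepsilon))}$ as $\varepsilon\downarrow0$. The diffusion house-moving $H_\mu^{g^-\to g^+}$ is the continuous Markov process on $[0,1]$ which is the weak limit of $X_{[0,1]}^{0\to b}\vert_{K(g^--\eta^-(\varepsilon),g^++\eta^+(\varepsilon))}$ as $\varepsilon\downarrow0$; equivalently $E[F(H_\mu^{g^-\to g^+})]=E[e^{-\frac12N_{[0,1]}(H^{g^-\to g^+})}F(H^{g^-\to g^+})]/E[e^{-\frac12N_{[0,1]}(H^{g^-\to g^+})}]$ for bounded continuous $F$ on $C([0,1],\mathbb{R})$. *)

(* Defs.v *)
From HB Require Import structures.
From mathcomp Require Import all_boot all_order all_algebra.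
From mathcomp Require Import all_classical all_reals all_analysis.

Set Implicit Arguments.
Unset Strict Implicit.
Unset Printing Implicit Defensive.
Import Order.TTheory GRing.Theory Num.Theory.
Import numFieldNormedType.Exports.

Local Open Scope classical_set_scope.
Local Open Scope ring_scope.

Definition unit_interval (R : realType) : set R := `[0, 1].
Arguments unit_interval R : clear implicits.

(* The derivatives are relative to [0, 1], hence one-sided at 0 and 1. *)
Fixpoint Ck01 (R : realType) (k : nat) (f : R -> R) : Prop :=
  match k with
  | 0%N => {within unit_interval R, continuous f}
  | k'.+1 => exists f' : R -> R,
      (forall t, unit_interval R t ->
        (f s - f t) / (s - t)
          @[s --> within (unit_interval R) t^'] --> f' t) /\
      Ck01 k' f'
  end.

Definition C1_line (R : realType) (f : R -> R) : Prop :=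
  (forall x, derivable f x 1) /\ continuous (derive1 f).

(* C([0,1], R).  Its points are functions on the subtype of [0, 1]; it carries
   the uniformity (and the pseudometric) of uniform convergence, pulled back
   from arrow_uniform_type, i.e. the topology of the sup metric. *)
Definition C01 (R : realType) : Type := continuousType (unit_interval R) R.

Definition C01_fun (R : realType) (w : C01 R) :
  arrow_uniform_type (unit_interval R) R := w.

HB.instance Definition _ (R : realType) := Choice.on (C01 R).
HB.instance Definition _ (R : realType) :=
  isPointed.Build (C01 R) (mkcts (@cst_continuous (unit_interval R) R 0)).
HB.instance Definition _ (R : realType) :=
  Uniform.copy (C01 R) (initial_topology (@C01_fun R)).
HB.instance Definition _ (R : realType) :=
  PseudoMetric.copy (C01 R) (initial_topology (@C01_fun R)).

(* C([0,1], R) with its Borel sigma-algebra. *)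
Definition borelC01 (R : realType) := g_sigma_algebraType (@open (C01 R)).

(* The restriction of f to [0, 1] as a path; the constant path 0 when f is not
   continuous on [0, 1]. *)
Definition path01 (R : realType) (f : R -> R) : borelC01 R :=
  xget point [set w : C01 R | forall u : unit_interval R, w u = f (\val u)].

(* K(f, g) *)
Definition tube (R : realType) (f g : R -> R) : set (borelC01 R) :=
  [set w : C01 R | forall u : unit_interval R, f (\val u) <= w u <= g (\val u)].

(* E[F(Y) | Y \in L] for Y of law nu, i.e. the expectation of F under the law of
   Y conditioned on {Y \in L}; it is 0 if nu L = 0. *)
Definition cond_expectation (R : realType) (nu : probability (borelC01 R) R)
    (L : set (borelC01 R)) (F : C01 R -> R) : R :=
  (\int[nu]_(w in L) F w) / fine (nu L).

(* Processes indexed by [0, +oo[ are functions on R whose values at negative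
   times are irrelevant. *)
Record standard_brownian_motion (R : realType) (d : measure_display)
    (Omega : measurableType d) (P : probability Omega R)
    (W : R -> Omega -> R) : Prop := {
  bm_measurable : forall t, 0 <= t -> measurable_fun setT (W t);
  bm_start : {ae P, forall om, W 0 om = 0};
  bm_continuous : forall om, {within `[0, +oo[, continuous (W ^~ om)};
  (* The increments over disjoint intervals are independent, and the increment
     over [s, t] is N(0, t - s); the second parameter of normal_prob is the
     standard deviation. *)
  bm_increments : forall (n : nat) (s : nat -> R) (B : nat -> set R),
    0 <= s 0%N -> (forall i, (i < n)%N -> s i < s i.+1) ->
    (forall i, (i < n)%N -> measurable (B i)) ->
    P [set om | forall i, (i < n)%N -> B i (W (s i.+1) om - W (s i) om)] =
    (\big[*%E/1]_(i < n)
       normal_prob 0%R (Num.sqrt (s i.+1 - s i)%R) (B i))%E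
}.

(* dX(t) = mu(X(t)) dt + dW(t), X(0) = 0; the noise being additive, the equation
   in integral form involves no stochastic integral. *)
Record diffusion (R : realType) (mu : R -> R) (d : measure_display)
    (Omega : measurableType d) (P : probability Omega R)
    (W X : R -> Omega -> R) : Prop := {
  sde_measurable : forall t, 0 <= t -> measurable_fun setT (X t);
  sde_continuous : forall om, {within `[0, +oo[, continuous (X ^~ om)};
  sde_start : {ae P, forall om, X 0 om = 0};
  sde_equation : {ae P, forall om, forall t, 0 <= t ->
    X t om = \int[lebesgue_measure]_(s in `[0, t]) mu (X s om) + W t om}
}.

(* nu is the law of the bridge of X to b on [0, 1]: the conditional law of the
   path of X on [0, 1] given X(1) = b, taken from a regular conditional
   distribution which is weakly continuous at b.  Without that continuity the
   conditional law would be determined only for almost every b. *)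
Definition bridge_law (R : realType) (d : measure_display)
    (Omega : measurableType d) (P : probability Omega R) (X : R -> Omega -> R)
    (b : R) (nu : probability (borelC01 R) R) : Prop :=
  exists kappa : R.-pker R ~> borelC01 R,
    [/\ forall (A : set (borelC01 R)) (B : set R), measurable A -> measurable B ->
          P [set om | A (path01 (X ^~ om)) /\ B (X 1 om)] =
          (\int[P]_(om in X 1%R @^-1` B) kappa (X 1%R om) A)%E,
        forall F : C01 R -> R, continuous F -> bounded_fun F ->
          \int[kappa y]_w F w @[y --> b] --> \int[kappa b]_w F w
      & forall A, measurable A -> nu A = kappa b A].

(* H is the weak limit, as eps decreases to 0, of paths of law nu conditioned on
   lying between gm - etam eps and gp + etap eps. *)
Definition house_moving (R : realType) (nu : probability (borelC01 R) R)
    (gm gp etam etap : R -> R) (d : measure_display) (Omega : measurableType d)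
    (P : probability Omega R) (H : {RV P >-> borelC01 R}) : Prop :=
  forall F : C01 R -> R, continuous F -> bounded_fun F ->
    cond_expectation nu
      (tube (fun u => gm u - etam eps) (fun u => gp u + etap eps)) F
      @[eps --> 0^'+] --> \int[P]_om F (H om).

(* Main.v *)
Require Import Defs.
From HB Require Import structures.
From mathcomp Require Import all_boot all_order all_algebra.
From mathcomp Require Import all_classical all_reals all_analysis.
From mathcomp Require Import measurable_realfun ring lra zify.
(** Let [H] be the house-moving and suppose that [H - g] has minimum [0] on [[t, 1]].
As [H 1 = gp 1 > g 1] almost surely, the minimum is attained at some [u < 1], and
by continuity [H] stays below [gp - 2 kappa] in a window around [u].  There are
countably many windows (mesh [1 / q], position [j / q], margin [kappa]), so it is
enough to show that each of them contributes a null event.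

Fix a window, with an interval [J] in its middle, and compare two events for a path
[w]: [touching e], where [w] comes within [e] of [g] on [J] without going below
[g - e], and [near_miss e], where [g + e <= w] on [J] but [w] comes within [516 e] of
[g].  The core of the proof is the inequality
  [P (touching e) <= C * P (near_miss e)] with [C] independent of [e].
It concludes the proof ([touching_null]): as [e] tends to [0], the near misses
decrease to the impossible event that [inf_J (w - g)] is both positive and zero.

The inequality holds because a small upward bump, supported in the window and of
height between [4 e] and [512 e] on [J], turns a touching path into a near miss.
Raising a path keeps it above [gm], and the margin [kappa] keeps it below [gp], so
that the bump respects the conditioning whatever the width of the tube; and by the
Cameron-Martin formula the law of a path is changed by a bounded density as long as
the slope of the bump is bounded.  The difficulty is that the bumped path must come
back exactly to the original one at the end of the window.  On the level of the
driving noise this means a slope [eta] on a first block of times, and on a second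
block a slope that depends on the path, to which the formula does not apply.  One
therefore averages over the slope: for fixed noise [d], the slopes [a] in [[-1, 1]]
for which [d] bent by [(0, a)] is touching are mapped to slopes [b] for which [d]
bent by [(eta, b)] is a near miss.  Both sets of slopes are intervals because paths
are increasing functions of the slope, and [a |-> b] contracts at most by a factor
[4]; so the Lebesgue measures of the two sets are comparable, and Tonelli's theorem
turns this into a comparison of probabilities ([bend_lift], [sweep],
[corridor_rise]).

The argument is carried out for the Euler scheme of the equation with truncated
drift, where the noise is a finite family of independent Gaussian variables.  Since
the noise is additive, the scheme converges along each path ([euler_error]), and the
inequality passes to the diffusion ([diffusion_rise]).  It passes to the bridge by
conditioning on [|X 1 - b| <= rho] for small [rho], an event of positive probability
([diffusion_hit], [bridge_le], [bridge_rise]), and from there, intersected with the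
tubes, to the house-moving ([house_moving_le]).  Weak convergence only controls
continuous functionals, so each of the last two steps enlarges the events by a small
uniform distance; the bump is four times as high as [e] in order to absorb these
losses. *)

Set Implicit Arguments.
Unset Strict Implicit.
Unset Printing Implicit Defensive.
Import Order.TTheory GRing.Theory Num.Theory.
Import numFieldNormedType.Exports.
Local Open Scope classical_set_scope.
Local Open Scope ring_scope.

(** * Monotonicity of the Euler scheme *)

Fixpoint euler (R : realType) (mu : R -> R) (D : R) (d : nat -> R) (k : nat) : R :=
  if k is k'.+1 then euler mu D d k' + D * mu (euler mu D d k') + d k' else 0.

Definition block (R : realType) (i l : nat) (c : R) (k : nat) : R :=
  if (i <= k < i + l)%N then c else 0.

Definition addseq (R : realType) (u v : nat -> R) : nat -> R := fun k => u k + v k.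

Lemma step_bounds (R : realType) (mu : R -> R) (L D : R) (x y : R) :
  (forall x y, `|mu x - mu y| <= L * `|x - y|) -> 0 <= D ->
  x <= y ->
  (1 - L * D) * (y - x) <= (y + D * mu y) - (x + D * mu x)
    <= (1 + L * D) * (y - x).
Proof.
move=> muL D0 xy; have := muL y x; rewrite (ger0_norm (_ : 0 <= y - x)) ?subr_ge0//.
rewrite ler_norml => /andP[lo up].
have : D * (- (L * (y - x))) <= D * (mu y - mu x) <= D * (L * (y - x)).
  by rewrite !ler_wpM2l.
nra.
Qed.

Lemma step_mono (R : realType) (mu : R -> R) (L D : R) (x y : R) :
  (forall x y, `|mu x - mu y| <= L * `|x - y|) -> 0 <= D -> 0 <= L -> L * D < 1 ->
  x <= y -> x + D * mu x <= y + D * mu y.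
Proof.
move=> muL D0 L0 LD_le4 xy; have /andP[+ _] := step_bounds muL D0 xy.
have : 0 <= (1 - L * D) * (y - x) by apply: mulr_ge0; lra.
lra.
Qed.

Lemma euler_mono (R : realType) (mu : R -> R) (L D : R) (d d' : nat -> R) k :
  (forall x y, `|mu x - mu y| <= L * `|x - y|) -> 0 <= D -> 0 <= L -> L * D < 1 ->
  (forall i, (i < k)%N -> d i <= d' i) ->
  euler mu D d k <= euler mu D d' k.
Proof.
move=> muL D0 L0 LD_le4; elim: k => //= k IH dd'; rewrite lerD ?dd'// (step_mono muL)// IH// => i ik.
by rewrite dd'// ltnW.
Qed.

(** Two schemes whose increments differ by a constant slope [c >= 0] on [l]
steps drift apart linearly, up to the factors by which one step of a scheme with
[L]-Lipschitz drift can contract or expand distances. *)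
Lemma euler_rise (R : realType) (mu : R -> R) (L D : R) (d d' : nat -> R) (i l : nat) (c : R) :
  (forall x y, `|mu x - mu y| <= L * `|x - y|) -> 0 <= D -> 0 <= L -> L * D < 1 ->
  0 <= c ->
  euler mu D d i <= euler mu D d' i ->
  (forall k, (i <= k < i + l)%N -> d' k = d k + D * c) ->
  [/\ (euler mu D d' i - euler mu D d i + c * D * l%:R) * (1 - L * D) ^+ l <=
      euler mu D d' (i + l) - euler mu D d (i + l) &
      euler mu D d' (i + l) - euler mu D d (i + l) <=
      (euler mu D d' i - euler mu D d i + c * D * l%:R) * (1 + L * D) ^+ l].
Proof.
move=> muL D0 L0 LD_le4 c0 xy; elim: l => [|l IH] dd'.
  by rewrite addn0 !mulr0 !expr0 !mulr1 addr0.
have [|lo up] := IH; first by move=> k /andP[ik kl]; apply: dd'; rewrite ik; lia.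
rewrite addnS /= dd'; last by lia.
move: lo up; set x := euler mu D d (i + l); set y := euler mu D d' (i + l).
set x0 := euler mu D d i; set y0 := euler mu D d' i => lo up.
have p0 : 0 <= (1 - L * D) ^+ l by apply: exprn_ge0; lra.
have p1 : (1 - L * D) ^+ l <= 1 by apply: exprn_ile1; nra.
have q1 : 1 <= (1 + L * D) ^+ l by apply: exprn_ege1; nra.
have cDl : 0 <= c * D * l%:R by rewrite !mulr_ge0.
have cD : 0 <= c * D by rewrite !mulr_ge0.
have xley : x <= y.
  by rewrite -subr_ge0; apply: le_trans lo; rewrite mulr_ge0// addr_ge0// subr_ge0.
have /andP[lo1 up1] := step_bounds muL D0 xley.
rewrite !exprS -[l.+1%:R]natr1; set p := (1 - L * D) ^+ l in p0 p1 lo *.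
set q := (1 + L * D) ^+ l in q1 up *.
have ld0 : 0 <= L * D by rewrite mulr_ge0.
set a := c * D * l%:R in cDl lo up.
have -> : c * D * (l%:R + 1) = a + c * D by rewrite /a; ring.
split.
  have : (1 - L * D) * ((y0 - x0 + a) * p) <= (1 - L * D) * (y - x).
    by apply: ler_wpM2l => //; lra.
  have : c * D * ((1 - L * D) * p) <= c * D by rewrite ler_piMr// mulr_ile1; lra.
  lra.
have : (1 + L * D) * (y - x) <= (1 + L * D) * ((y0 - x0 + a) * q) by apply: ler_wpM2l => //; lra.
have : c * D <= c * D * ((1 + L * D) * q) by rewrite ler_peMr// mulr_ege1; lra.
lra.
Qed.


Lemma euler_ext (R : realType) (mu : R -> R) (D : R) d d' i k : (i <= k)%N ->
  euler mu D d i = euler mu D d' i ->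
  (forall j, (i <= j < k)%N -> d j = d' j) ->
  euler mu D d k = euler mu D d' k.
Proof.
move=> /subnK <-; elim: (k - i)%N => [|n IH] //= e dd'.
rewrite IH//; first by congr (_ + _); apply: dd'; lia.
by move=> j jn; apply: dd'; lia.
Qed.

Lemma one_sub_pow (R : realType) (a : R) n : 0 <= a <= 1 -> 1 - n%:R * a <= (1 - a) ^+ n.
Proof.
move=> /andP[a0 a1]; elim: n => [|n IH]; first by rewrite mul0r subr0 expr0.
rewrite exprS -natr1; have n0 : 0 <= n%:R :> R by [].
have : (1 - a) * (1 - n%:R * a) <= (1 - a) * (1 - a) ^+ n by apply: ler_wpM2l => //; lra.
nra.
Qed.

Lemma one_add_pow (R : realType) (a : R) n : 0 <= a -> n%:R * a <= 1/2 -> (1 + a) ^+ n <= 2.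
Proof.
move=> a0 na; case: n na => [|n] na; first by rewrite expr0; lra.
have a1 : a <= 1/2 by apply: le_trans na; rewrite ler_peMl// ler1n.
have : 1 - n.+1%:R * a <= (1 - a) ^+ n.+1 by apply: one_sub_pow; lra.
have : (1 + a) ^+ n.+1 * (1 - a) ^+ n.+1 <= 1.
  by rewrite -exprMn exprn_ile1//; nra.
have : 0 <= (1 + a) ^+ n.+1 by apply: exprn_ge0; lra.
nra.
Qed.

(** * Bending the noise on two adjacent blocks *)

Lemma lipschitz_continuous (R : realType) (f : R -> R) (K : R) :
  (forall x y, x <= y -> `|f y - f x| <= K * (y - x)) -> continuous f.
Proof.
move=> fK x; apply/cvgrPdist_le => e e0.
have K0 : 0 < `|K| + 1 by rewrite ltr_wpDl.
have de : 0 < e / (`|K| + 1) by rewrite divr_gt0.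
near=> y.
have yx : `|x - y| <= e / (`|K| + 1).
  by near: y; apply: filterS (nbhsx_ballx x _ de) => z /= /ltW.
have : `|f x - f y| <= (`|K| + 1) * `|x - y|.
  have KK : K <= `|K| + 1 by rewrite (le_trans (ler_norm _))// lerDl.
  case: (leP x y) => xy.
    rewrite distrC (le_trans (fK _ _ xy))// (distrC x).
    by rewrite (ger0_norm (_ : 0 <= y - x)) ?subr_ge0// ler_wpM2r// subr_ge0.
  rewrite (le_trans (fK _ _ (ltW xy)))//.
  rewrite (ger0_norm (_ : 0 <= x - y)) ?subr_ge0 ?(ltW xy)//.
  by rewrite ler_wpM2r// subr_ge0 ltW.
move=> /le_trans; apply; apply: le_trans (_ : (`|K| + 1) * (e / (`|K| + 1)) <= _).
  by rewrite ler_wpM2l// ltW.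
by rewrite mulrC divfK// gt_eqF.
Unshelve. all: by end_near. Qed.

Lemma sub_block i j l k : (j <= l)%N -> (i <= k < i + j)%N -> (i <= k < i + l)%N.
Proof. by move=> jl /andP[-> /leq_trans]; apply; rewrite leq_add2l. Qed.

Lemma last_block m j l : (j < l)%N -> (m <= m + (l - j.+1) < m + l)%N.
Proof. lia. Qed.

(** The second and third cases overlap at [i + l]: the constructions on the two
blocks are glued at that index. *)
Lemma split_blocks i l k : [\/ (k <= i)%N || (i + l + l <= k)%N,
  exists2 j, (j <= l)%N & k = (i + j)%N |
  exists2 j, (j <= l)%N & k = (i + l + j)%N].
Proof.
have [ki|ik] := leqP k i; first by constructor 1.
have [kl|lk] := leqP k (i + l); first by constructor 2; exists (k - i)%N; lia.
have [kl|lk2] := leqP k (i + l + l); first by constructor 3; exists (k - (i + l))%N; lia.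
by constructor 1; lia.
Qed.

Lemma inner_out i l k : (0 < l)%N -> (2 * i + l <= 2 * k)%N ->
  (2 * k <= 2 * i + 3 * l)%N -> ~ ((k <= i)%N || (i + l + l <= k)%N).
Proof. lia. Qed.

Lemma inner_lo i l k j : (2 * i + l <= 2 * k)%N -> k = (i + j)%N -> (l <= 2 * j)%N.
Proof. lia. Qed.

Lemma inner_hi i l k j : (2 * k <= 2 * i + 3 * l)%N -> k = (i + l + j)%N ->
  (l <= 2 * (l - j))%N.
Proof. lia. Qed.

(** The scheme driven by [bend D i l a b d] has its velocity raised by [a] on
the [l] steps that follow [i] and by [b] on the next [l] steps. *)
Definition bend (R : realType) (D : R) (i l : nat) (a b : R) (d : nat -> R) : nat -> R :=
  addseq d (fun k => D * (block i l a k + block (i + l) l b k)).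

Lemma bend_off_before (R : realType) (D : R) i l a b d k : (k < i)%N ->
  @bend R D i l a b d k = d k.
Proof.
move=> ki; rewrite /bend /addseq /block.
have -> : (i <= k)%N = false by lia.
have -> : (i + l <= k)%N = false by lia.
by rewrite addr0 mulr0 addr0.
Qed.

Lemma bend_on_first (R : realType) (D : R) i l a b d k : (i <= k < i + l)%N ->
  @bend R D i l a b d k = d k + D * a.
Proof.
move=> ki; rewrite /bend /addseq /block ki.
have -> : (i + l <= k)%N = false by lia.
by rewrite addr0.
Qed.

Lemma bend_on_second (R : realType) (D : R) i l a b d k : (i + l <= k < i + l + l)%N ->
  @bend R D i l a b d k = d k + D * b.
Proof.
move=> ki; rewrite /bend /addseq /block ki.
have -> : (k < i + l)%N = false by lia.
by rewrite andbF add0r.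
Qed.

Lemma bend_off_after (R : realType) (D : R) i l a b d k : (i + l + l <= k)%N ->
  @bend R D i l a b d k = d k.
Proof.
move=> ki; rewrite /bend /addseq /block.
have -> : (k < i + l)%N = false by lia.
have -> : (k < i + l + l)%N = false by lia.
by rewrite !andbF addr0 mulr0 addr0.
Qed.

Lemma bend_before (R : realType) (mu : R -> R) (D : R) i l a b d k : (k <= i)%N ->
  euler mu D (bend D i l a b d) k = euler mu D d k.
Proof. by move=> ki; apply: (@euler_ext _ _ _ _ _ 0%N) => // j jk; rewrite bend_off_before//; lia. Qed.

(** The total duration of a block is so small that the distance between two
schemes varies at most by a factor [2] along it ([pow_lo], [pow_hi]). *)
Section Bend.
Context (R : realType) (mu : R -> R) (L D : R) (i l : nat).
Hypothesis (muL : forall x y, `|mu x - mu y| <= L * `|x - y|).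
Hypothesis (D0 : 0 < D) (L0 : 0 <= L) (l0 : (0 < l)%N).
Hypothesis (LDl : 4 * (L * D * l%:R) <= 1).

Let LD_le4 : L * D <= 1/4.
Proof.
have : 1 <= l%:R :> R by rewrite ler1n.
have : 0 <= L * D by rewrite mulr_ge0// ltW.
by move: LDl; set u := L * D => *; nra.
Qed.

Lemma pow_lo j : (j <= l)%N -> 1/2 <= (1 - L * D) ^+ j.
Proof.
move=> jl; have u0 : 0 <= L * D by rewrite mulr_ge0// ltW.
apply: le_trans (one_sub_pow _ _); last by rewrite u0 /=; have := LD_le4; move: (L * D) => *; lra.
have : j%:R * (L * D) <= l%:R * (L * D) by rewrite ler_wpM2r// ler_nat.
by move: LDl; rewrite (mulrC _ l%:R); move: (l%:R * _) (j%:R * _) => *; lra.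
Qed.

Lemma pow_hi j : (j <= l)%N -> (1 + L * D) ^+ j <= 2.
Proof.
move=> jl; have u0 : 0 <= L * D by rewrite mulr_ge0// ltW.
apply: one_add_pow => //.
have : j%:R * (L * D) <= l%:R * (L * D) by rewrite ler_wpM2r// ler_nat.
by move: LDl; rewrite (mulrC _ l%:R); move: (l%:R * _) (j%:R * _) => *; lra.
Qed.

Let LD_lt1 : L * D < 1.
Proof. by have := LD_le4; move: (L * D) => *; lra. Qed.

Local Notation x a b d k := (euler mu D (bend D i l a b d) k).
Local Notation tau := (D * l%:R).

Lemma bend_mono (a b b' : R) d k : b <= b' -> x a b d k <= x a b' d k.
Proof.
move=> bb; apply: (euler_mono muL (ltW D0) L0 LD_lt1) => j jk.
rewrite /bend /addseq lerD2l ler_wpM2l// ?(ltW D0)// lerD2l /block.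
by case: ifP.
Qed.

(** Steering the end point: it is a strictly increasing and Lipschitz function of
the second slope, with both bounds of the order of the duration of the block. *)
Lemma bend_end (a b b' : R) d : b <= b' ->
  (b' - b) * tau / 2 <= x a b' d (i + l + l) - x a b d (i + l + l) <= 2 * ((b' - b) * tau).
Proof.
move=> bb.
have e : x a b d (i + l) = x a b' d (i + l).
  apply: (@euler_ext _ _ _ _ _ 0%N) => // j jk.
  have [ji|ij] := ltnP j i; first by rewrite !bend_off_before.
  have jil : (i <= j < i + l)%N by rewrite ij (leq_trans jk).
  by rewrite !bend_on_first.
have bb0 : 0 <= b' - b by rewrite subr_ge0.
have [||lo hi] := @euler_rise _ mu L D (bend D i l a b d) (bend D i l a b' d) (i + l) l
  (b' - b) muL (ltW D0) L0 LD_lt1 bb0; first by rewrite e.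
  by move=> k kk; rewrite !bend_on_second//; ring.
move: lo hi; rewrite e subrr add0r mulrA => lo hi.
have t0 : 0 <= (b' - b) * D * l%:R by rewrite !mulr_ge0// ltW.
have := pow_lo (leqnn l); have := pow_hi (leqnn l).
move: lo hi; move: ((1 - L * D) ^+ _) ((1 + L * D) ^+ _) => p q lo hi q1 p1.
apply/andP; split; first by apply: le_trans lo; nra.
by apply: le_trans hi _; nra.
Qed.

(** The bump.  With slope [eta] on the first block the path rises; by the
intermediate value theorem a smaller slope [b] on the second block brings it back
where the path bent by [(0, a)] ends.  Going backwards from this common end shows
that the bumped path is above the other one all along, and that in the middle half of
the two blocks it is so by a definite multiple of [eta] times the duration. *)
Lemma bend_lift (eta a : R) d : 0 < eta -> exists b : R,
  [/\ a - 8 * eta <= b <= a,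
      forall k, (k <= i)%N || (i + l + l <= k)%N ->
        x eta b d k = x 0 a d k,
      forall k, x 0 a d k <= x eta b d k <= x 0 a d k + 4 * eta * tau &
      forall k, (2 * i + l <= 2 * k)%N -> (2 * k <= 2 * i + 3 * l)%N ->
        x 0 a d k + eta * tau / 32 <= x eta b d k].
Proof.
move=> eta0; have Dge0 := ltW D0; have eta_ge0 := ltW eta0.
have l1 : 1 <= l%:R :> R by rewrite ler1n.
have tau0 : 0 < tau by rewrite mulr_gt0 ?ltr0n.
have LD_ge0 : 0 <= L * D by rewrite mulr_ge0.
have eqi b : x eta b d i = x 0 a d i by rewrite !bend_before.
(* The first block only depends on the slope eta. *)
have rise1 b j : (j <= l)%N ->
  eta * D * j%:R / 2 <= x eta b d (i + j) - x 0 a d (i + j) <= 2 * (eta * D * j%:R).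
  move=> jl; have [||lo hi] := @euler_rise _ mu L D (bend D i l 0 a d)
     (bend D i l eta b d) i j eta muL Dge0 L0 LD_lt1 eta_ge0.
  - by rewrite eqi.
  - by move=> k /(sub_block jl) kij; rewrite !bend_on_first// mulr0 addr0.
  move: lo hi; rewrite eqi subrr add0r => lo hi.
  have t0 : 0 <= eta * D * j%:R by rewrite !mulr_ge0.
  have := pow_lo jl; have := pow_hi jl.
  move: lo hi; move: ((1 - L * D) ^+ _) ((1 + L * D) ^+ _) => p q lo hi q1 p1.
  apply/andP; split; first by apply: le_trans lo; nra.
  by apply: le_trans hi _; nra.
have dec b j : b <= a -> x eta b d (i + l + j) <= x eta a d (i + l + j).
  by move=> ba; apply: bend_mono.
have up2 j : (j <= l)%N ->
  0 <= x eta a d (i + l + j) - x 0 a d (i + l + j) <= 4 * eta * tau.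
  move=> jl; have /andP[r0 r1] := rise1 a l (leqnn l).
  have [||lo hi] := @euler_rise _ mu L D (bend D i l 0 a d)
     (bend D i l eta a d) (i + l) j 0 muL Dge0 L0 LD_lt1 (lexx _).
  - by rewrite -subr_ge0; apply: le_trans r0; rewrite !mulr_ge0// invr_ge0.
  - by move=> k /(sub_block jl) kij; rewrite !bend_on_second// mulr0 addr0.
  move: lo hi; rewrite !mul0r addr0 => lo hi; apply/andP; split.
    apply: le_trans lo; rewrite mulr_ge0 ?exprn_ge0// ?subr_ge0 ?(ltW LD_lt1)//.
    by rewrite -subr_ge0; apply: le_trans r0; rewrite !mulr_ge0// invr_ge0.
  apply: le_trans hi _; have := pow_hi jl.
  have e : eta * D * l%:R = eta * tau by rewrite mulrA.
  have : 0 <= x eta a d (i + l) - x 0 a d (i + l).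
    by apply: le_trans r0; rewrite !mulr_ge0// invr_ge0.
  have : 1 <= (1 + L * D) ^+ j by apply: exprn_ege1; rewrite lerDl.
  rewrite -(mulrA 4); move: r1; rewrite e; move: (x eta a d _ - _) ((1 + L * D) ^+ j) (eta * tau) => u q v.
  by move=> *; nra.
have [b bI xb] : exists2 b, b \in `[a - 8 * eta, a]%R &
    x eta b d (i + l + l) = x 0 a d (i + l + l).
  apply: IVT; first by rewrite gerBl mulr_ge0.
    apply: continuous_subspaceT; apply: (@lipschitz_continuous _ _ (2 * tau)).
    move=> u v uv; have /andP[lo hi] := bend_end eta d uv.
    rewrite ger0_norm; first by rewrite (_ : 2 * tau * (v - u) = 2 * ((v - u) * tau))//; ring.
    by apply: le_trans lo; rewrite !mulr_ge0 ?invr_ge0 ?subr_ge0// ltW.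
  have aa : a - 8 * eta <= a by rewrite gerBl mulr_ge0.
  have /andP[lo _] := bend_end eta d aa.
  have /andP[u0 u1] := up2 l (leqnn l).
  rewrite ge_min le_max; apply/andP; split; apply/orP; [left|right].
    move: lo u1; rewrite (_ : (a - (a - 8 * eta)) * tau / 2 = 4 * eta * tau); last by field.
    by move: (4 * eta * tau) => ? ? ?; lra.
  by rewrite -subr_ge0.
have /andP[b1 b2] : a - 8 * eta <= b <= a by move: bI; rewrite in_itv.
exists b.
have after k : (i + l + l <= k)%N -> x eta b d k = x 0 a d k.
  move=> kl; apply: (@euler_ext _ _ _ _ _ (i + l + l)) => // j /andP[jl _].
  by rewrite !bend_off_after.
have before k : (k <= i)%N -> x eta b d k = x 0 a d k by move=> ki; rewrite !bend_before.
(* The second block is followed backwards from the common end point: there the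
   slope b is smaller than a, so the bumped path was higher before. *)
have step j : (i + l <= j < i + l + l)%N ->
    x eta b d j.+1 - x 0 a d j.+1 =
    (x eta b d j + D * mu (x eta b d j)) - (x 0 a d j + D * mu (x 0 a d j))
      - D * (a - b).
  by move=> jl /=; rewrite !bend_on_second//; ring.
have ab : 0 <= D * (a - b) by rewrite mulr_ge0// subr_ge0.
have back j : (j <= l)%N ->
  D * (a - b) * j%:R / 2 <= x eta b d (i + l + (l - j)) - x 0 a d (i + l + (l - j)).
  move=> jl; suff : D * (a - b) * j%:R * (1 - L * D) ^+ j <=
      x eta b d (i + l + (l - j)) - x 0 a d (i + l + (l - j)).
    apply: le_trans; have := pow_lo jl; have : 0 <= D * (a - b) * j%:R by rewrite mulr_ge0.
    by move: (_ * j%:R) ((1 - L * D) ^+ j) => *; nra.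
  elim: j jl => [_|j IH jl]; first by rewrite subn0 xb subrr mulr0 mul0r.
  have := IH (ltnW jl).
  have := step _ (last_block (i + l) jl); rewrite -addnS -subSn// subSS => ->.
  set u := x eta b d _; set v := x 0 a d _.
  have p0 : 0 <= (1 - L * D) ^+ j by apply: exprn_ge0; rewrite subr_ge0 ltW.
  have p1 : (1 - L * D) ^+ j <= 1 by apply: exprn_ile1; rewrite ?subr_ge0 ?(ltW LD_lt1)// gerBl.
  rewrite exprS -natr1; have j0 : 0 <= j%:R :> R by [].
  have q0 : 0 < 1 - L * D by rewrite subr_gt0.
  move: p0 p1; move: ((1 - L * D) ^+ j) => p p0 p1 IHj.
  have wjp : 0 <= D * (a - b) * j%:R * p by apply: mulr_ge0 => //; apply: mulr_ge0.
  move: (D * (a - b)) ab wjp IHj => w w0 wjp IHj.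
  have [uv|/ltW vu] := leP u v.
    have /andP[lo _] := step_bounds muL Dge0 uv.
    have : 0 <= (1 - L * D) * (v - u) by rewrite mulr_ge0 ?subr_ge0// ltW.
    move: lo IHj; move: (_ + D * mu u) (_ + D * mu v) => fu fv lo IHj q1.
    have w_eq0 : w = 0 by apply/eqP; rewrite eq_le w0 andbT; lra.
    have : (1 - L * D) * (v - u) <= 0 by lra.
    by rewrite w_eq0 !mul0r subr_ge0 pmulr_rle0// subr_le0.
  have /andP[_ hi] := step_bounds muL Dge0 vu.
  move: hi IHj; move: (_ + D * mu u) (_ + D * mu v) => fu fv hi IHj.
  have h1 : (1 - L * D) * (w * (j%:R * p + 1)) <= (1 - L * D) * ((1 + L * D) * (u - v)).
    by apply: ler_wpM2l; [exact: ltW|lra].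
  have h2 : (1 - L * D) * (1 + L * D) * (u - v) <= u - v.
    by rewrite ler_piMl ?subr_ge0//; move: (L * D) LD_ge0 => *; nra.
  apply: le_trans h2; rewrite -(mulrA (1 - L * D)); apply: le_trans h1.
  rewrite (_ : w * (j%:R + 1) * ((1 - L * D) * p) = (1 - L * D) * (w * (j%:R * p + p))); last by ring.
  by rewrite ler_wpM2l ?(ltW q0)// ler_wpM2l// lerD2l.
(* The height reached after the first block has to be compensated by the second
   one, which bounds a - b from below. *)
have xab_l : x eta a d (i + l) - x 0 a d (i + l) <= 4 * ((a - b) * tau).
  have [||lo _] := @euler_rise _ mu L D (bend D i l 0 a d)
     (bend D i l eta a d) (i + l) l 0 muL Dge0 L0 LD_lt1 (lexx _).
  - rewrite -subr_ge0; have /andP[r0 _] := rise1 a l (leqnn l).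
    by apply: le_trans r0; rewrite !mulr_ge0// invr_ge0.
  - by move=> k kij; rewrite !bend_on_second// mulr0 addr0.
  have /andP[_ hi] := bend_end eta d b2.
  move: lo hi; rewrite !mul0r addr0 xb => lo hi.
  have := pow_lo (leqnn l).
  have : 0 <= x eta a d (i + l) - x 0 a d (i + l).
    have /andP[r0 _] := rise1 a l (leqnn l).
    by apply: le_trans r0; rewrite !mulr_ge0// invr_ge0.
  move: lo hi; move: ((1 - L * D) ^+ _) (x eta a d (i + l) - _) ((a - b) * tau) => p u v.
  by move: (_ - x 0 a d _) => *; nra.
have jD j : (j <= l)%N -> D * j%:R <= tau by move=> jl; rewrite ler_wpM2l// ler_nat.
have block1 j : (j <= l)%N -> 0 <= x eta b d (i + j) - x 0 a d (i + j) <= 2 * (eta * tau).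
  move=> jl; have /andP[lo hi] := rise1 b j jl.
  have : 0 <= eta * D * j%:R by rewrite !mulr_ge0.
  have := ler_wpM2l eta_ge0 (jD j jl); rewrite mulrA.
  by move: lo hi; move: (x _ _ _ _ - _) => *; lra.
have block2 j : (j <= l)%N -> 0 <= x eta b d (i + l + j) - x 0 a d (i + l + j) <= 4 * (eta * tau).
  move=> jl; apply/andP; split.
    have := back (l - j)%N (leq_subr _ _); rewrite subKn//; apply: le_trans.
    by rewrite !mulr_ge0// ?invr_ge0// subr_ge0.
  rewrite (mulrA 4); have /andP[_] := up2 j jl; apply: le_trans.
  by rewrite lerD2r dec.
have split_k := split_blocks i l.
split.
- by rewrite b1 b2.
- by move=> k /orP[/before|/after].
- move=> k; rewrite -(mulrA 4) -lerBlDl -(subr_ge0 (x 0 a d k)).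
  have et : 0 <= eta * tau by rewrite mulr_ge0 ?ltW.
  have [kk|[j jl ->]|[j jl ->]] := split_k k.
  + have -> : x eta b d k = x 0 a d k by case/orP: kk => [/before|/after].
    by rewrite subrr lexx mulr_ge0.
  + have /andP[-> hi] /= := block1 j jl; apply: le_trans hi _.
    by rewrite ler_wpM2r// ler_nat.
  + exact: block2.
- move=> k k1 k2; rewrite -lerBrDl.
  have [kk|[j jl kE]|[j jl kE]] := split_k k; first exact: (False_ind _ (inner_out l0 k1 k2 kk)).
    have /andP[lo _] := rise1 b j jl; rewrite kE; apply: le_trans lo.
    have lj : l%:R <= 2 * j%:R :> R by rewrite -natrM ler_nat; apply: inner_lo k1 kE.
    have : 0 <= eta * D by rewrite mulr_ge0.
    by rewrite mulrA; move: (eta * D) => *; nra.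
  have := back (l - j)%N (leq_subr _ _); rewrite subKn// kE; apply: le_trans.
  have lj : l%:R <= 2 * (l - j)%:R :> R by rewrite -natrM ler_nat; apply: inner_hi k2 kE.
  have /andP[lo _] := rise1 a l (leqnn l).
  have abl : eta <= 8 * (a - b).
    rewrite -(ler_pM2r tau0); move: lo xab_l; rewrite -(mulrA eta) -(mulrA 8).
    by move: (x _ _ _ _ - _) => *; lra.
  have : eta * D <= 8 * (D * (a - b)) by rewrite mulrCA mulrC ler_wpM2l.
  have : 0 <= eta * D by rewrite mulr_ge0.
  rewrite (mulrA eta); move: ab; move: (eta * D) (D * (a - b)) => u w w0 u0 uw.
  have h1 : u * l%:R <= 8 * w * l%:R by rewrite ler_wpM2r.
  have h2 : w * l%:R <= w * (2 * (l - j)%:R) by rewrite ler_wpM2l.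
  lra.
Qed.

Lemma bend_dist (b b' : R) d k : (k <= i + l + l)%N -> b <= b' ->
  0 <= x 0 b' d k - x 0 b d k <= 2 * ((b' - b) * tau).
Proof.
move=> kN bb; have bb0 : 0 <= b' - b by rewrite subr_ge0.
rewrite subr_ge0 bend_mono//=.
have e m : (m <= i + l)%N -> x 0 b d m = x 0 b' d m.
  move=> ml; apply: (@euler_ext _ _ _ _ _ 0%N) => // j jk.
  have [ji|ij] := ltnP j i; first by rewrite !bend_off_before.
  have jil : (i <= j < i + l)%N by rewrite ij (leq_trans jk).
  by rewrite !bend_on_first.
have [kl|lk] := leqP k (i + l).
  by rewrite e// subrr !mulr_ge0// ltW.
have [j jl ->] : exists2 j, (j <= l)%N & k = (i + l + j)%N.
  by exists (k - (i + l))%N; rewrite ?subnKC ?(ltnW lk)// leq_subLR.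
have [||_ hi] := @euler_rise _ mu L D (bend D i l 0 b d) (bend D i l 0 b' d) (i + l) j
  (b' - b) muL (ltW D0) L0 LD_lt1 bb0; first by rewrite e.
  by move=> m /(sub_block jl) mm; rewrite !bend_on_second//; ring.
move: hi; rewrite (e _ (leqnn _)) subrr add0r => /le_trans; apply.
have j0 : 0 <= j%:R :> R by [].
have jle : j%:R <= l%:R :> R by rewrite ler_nat.
apply: (@le_trans _ _ ((b' - b) * D * j%:R * 2)).
  by rewrite ler_wpM2l ?pow_hi// !mulr_ge0// ltW.
by rewrite (mulrC _ 2) ler_wpM2l// mulrA ler_wpM2l// mulr_ge0// ltW.
Qed.

(** One block of constant slope steers the scheme to any prescribed end point
[y], and moves it at most proportionally to the distance to [y]. *)
Lemma bend_hit (y : R) d : exists b : R,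
  [/\ x 0 b d (i + l + l) = y, `|b| * tau <= 2 * `|y - x 0 0 d (i + l + l)| &
    forall k, (k <= i + l + l)%N ->
      `|x 0 b d k - x 0 0 d k| <= 4 * `|y - x 0 0 d (i + l + l)|].
Proof.
have tau0 : 0 < tau by rewrite mulr_gt0 ?ltr0n.
set e := y - x 0 0 d (i + l + l); pose A := 2 * `|e| / tau.
have A0 : 0 <= A by rewrite !mulr_ge0// invr_ge0 ltW.
have At : A * tau = 2 * `|e| by rewrite divfK ?gt_eqF.
have [b bI xb] : exists2 b, b \in `[- A, A]%R & x 0 b d (i + l + l) = y.
  apply: IVT; first by lra.
    apply: continuous_subspaceT; apply: (@lipschitz_continuous _ _ (2 * tau)).
    move=> u v uv; have /andP[lo hi] := bend_dist d (leqnn _) uv.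
    by rewrite ger0_norm// (le_trans hi)// (mulrC (v - u)) !mulrA.
  have /andP[lo _] := bend_end 0 d A0.
  have NA0 : - A <= 0 by lra.
  have /andP[lo' _] := bend_end 0 d NA0.
  rewrite ge_min le_max; apply/andP; split; apply/orP; [left|right].
    move: lo'; rewrite opprK add0r At -lerBDl => lo'.
    have := ler_norm (- e); rewrite normrN /e; lra.
  move: lo; rewrite subr0 At => lo; have := ler_norm e; rewrite /e; lra.
have /andP[b1 b2] : - A <= b <= A by move: bI; rewrite in_itv.
exists b; have bt : `|b| * tau <= 2 * `|e|.
  by rewrite -At ler_wpM2r ?(ltW tau0)// ler_norml b1 b2.
split=> // k kN; apply: (@le_trans _ _ (2 * (`|b| * tau))); last by lra.
have [b0|/ltW b0] := leP 0 b.
  have /andP[lo hi] := bend_dist d kN b0.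
  by rewrite !ger0_norm//; move: hi; rewrite subr0.
have /andP[lo hi] := bend_dist d kN b0.
rewrite distrC (ler0_norm b0) ger0_norm//; by move: hi; rewrite sub0r.
Qed.

End Bend.

(** * The Cameron-Martin formula for discrete white noise *)

(** If [Y] has law [c * nu] under the measure of density [phi] with respect to
[mu], then integrals of functions of [Y] transform accordingly; as usual the
indicator functions and monotone convergence suffice. *)
Section WeightedLaw.
Import HBNNSimple.
Context d1 d2 (T1 : measurableType d1) (T2 : measurableType d2) (R : realType).
Context (mu : {measure set T1 -> \bar R}) (nu : {measure set T2 -> \bar R}).
Context (phi : T1 -> R) (Y : T1 -> T2) (c : R).
Local Open Scope ereal_scope.
Hypothesis phi0 : forall x, (0 <= phi x)%R.
Hypothesis mphi : measurable_fun [set: T1] phi.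
Hypothesis mY : measurable_fun [set: T1] Y.
Hypothesis law : forall B, measurable B ->
  \int[mu]_(x in Y @^-1` B) (phi x)%:E = c%:E * nu B.

Let mpre B : measurable B -> measurable (Y @^-1` B).
Proof. by move=> mB; rewrite -[X in measurable X]setTI; exact: mY. Qed.

Let indicE (k : R) B : (0 <= k)%R -> measurable B ->
  \int[mu]_x ((phi x)%:E * (k * \1_B (Y x))%:E) = c%:E * \int[nu]_y (k * \1_B y)%:E.
Proof.
move=> k0 mB.
have -> : \int[nu]_y (k * \1_B y)%:E = k%:E * nu B.
  under eq_integral do rewrite EFinM.
  rewrite ge0_integralZl ?lee_fin//.
    by rewrite integral_indic// setIT.
  by apply/measurable_EFinP; exact: measurable_indic.
transitivity (\int[mu]_x (k%:E * ((EFin \o phi) \_ (Y @^-1` B)) x)).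
  apply: eq_integral => x _; rewrite patchE indicE EFinM muleCA.
  have -> : (x \in Y @^-1` B) = (Y x \in B) by apply/idP/idP; rewrite !inE.
  by case: (Y x \in B); rewrite ?mule1 ?mule0.
rewrite ge0_integralZl ?lee_fin//.
- by rewrite -integral_mkcond law// muleCA.
- apply/(measurable_restrictT _ (mpre mB)); apply: measurable_funTS.
  exact/measurable_EFinP.
- by move=> x _; apply: erestrict_ge0 => y _ /=; rewrite lee_fin.
Qed.

Lemma weighted_law (f : T2 -> \bar R) :
  (forall y, 0 <= f y) -> measurable_fun [set: T2] f ->
  \int[mu]_x ((phi x)%:E * f (Y x)) = c%:E * \int[nu]_y f y.
Proof.
move=> f0 mf; pose f_ := nnsfun_approx measurableT mf.
have f_f y : (f_ n y)%:E @[n --> \oo] --> f y by apply: cvg_nnsfun_approx.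
have lim_f y : f y = limn (fun n => (f_ n y)%:E) by apply/esym/cvg_lim.
have lim_phi_f x : (phi x)%:E * f (Y x) = limn (fun n => (phi x)%:E * (f_ n (Y x))%:E).
  by apply/esym/cvg_lim => //; apply: cvgeZl.
have f_nd y m n : (m <= n)%N -> (f_ m y)%:E <= (f_ n y)%:E.
  by move=> mn; rewrite lee_fin; exact/lefP/nd_nnsfun_approx.
under eq_integral do rewrite lim_phi_f.
under [in RHS]eq_integral do rewrite lim_f.
have mfY n : measurable_fun [set: T1] (fun x => (f_ n (Y x))%:E).
  by apply/measurable_EFinP; exact: measurableT_comp.
rewrite monotone_convergence//=; first last.
- by move=> x _ m n mn; apply: lee_wpmul2l; rewrite ?lee_fin// -lee_fin f_nd.
- by move=> n x _; apply: mule_ge0; rewrite lee_fin.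
- by move=> n; apply: emeasurable_funM => //; exact/measurable_EFinP.
rewrite monotone_convergence//=; first last.
- by move=> y _ m n /f_nd.
- by move=> n y _; rewrite lee_fin.
- by move=> n; exact/measurable_EFinP.
have f_int n : \int[mu]_x ((phi x)%:E * (f_ n (Y x))%:E) = c%:E * \int[nu]_y (f_ n y)%:E.
  have f_E y : (f_ n y)%:E = \sum_(k \in range (f_ n)) (k * \1_(f_ n @^-1` [set k]) y)%:E.
    by rewrite fsumEFin// -fimfunE.
  have mf_k k : measurable (f_ n @^-1` [set k]) by exact: measurable_funPTI.
  have ind_ge0 k y : 0 <= (k * \1_(f_ n @^-1` [set k]) y)%:E.
    by rewrite EFinM nnfun_muleindic_ge0.
  have phi_f_E x : (phi x)%:E * (f_ n (Y x))%:E =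
      \sum_(k \in range (f_ n)) (phi x)%:E * (k * \1_(f_ n @^-1` [set k]) (Y x))%:E.
    by rewrite f_E ge0_mule_fsumr.
  under eq_integral do rewrite phi_f_E.
  under [in RHS]eq_integral do rewrite f_E.
  have m1 k : measurable_fun [set: T2] (fun y => (k * \1_(f_ n @^-1` [set k]) y)%:E).
    by apply/measurable_EFinP/measurable_funM => //; exact: measurable_indic.
  rewrite !ge0_integral_fsum//.
  - rewrite ge0_mule_fsumr; last first.
      by move=> k; apply: integral_ge0.
    apply: eq_fsbigr => k /set_mem[y _ <-]; apply: indicE => //.
  - move=> k; apply: emeasurable_funM; first exact/measurable_EFinP.
    exact: (measurableT_comp (m1 k)).
  - by move=> k x _; apply: mule_ge0; first rewrite lee_fin.
under eq_fun do rewrite f_int.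
apply/cvg_lim => //; apply: cvgeZl => //; apply: ereal_nondecreasing_is_cvgn.
move=> m n mn; apply: ge0_le_integral => //; try exact/measurable_EFinP.
- by move=> y _; rewrite lee_fin.
- by move=> y _; exact: f_nd.
Qed.
End WeightedLaw.

Lemma lebesgue_measure_shift (R : realType) (v : R) (A : set R) : measurable A ->
  lebesgue_measure ((fun x : R => x + v) @^-1` A) = lebesgue_measure A.
Proof.
move=> mA; pose f : R -> measurableTypeR R := fun x => x + v.
have mf : measurable_fun setT f by exact: measurable_funD.
suff : lebesgue_measure A = pushforward lebesgue_measure f A by move=> ->.
apply: (@lebesgue_measure_unique R (pushforward lebesgue_measure f)) => // X [[a b] _ <-].
transitivity (lebesgue_measure ((fun x : R => x + v) @^-1` `]a, b])) => //=.
rewrite (_ : _ @^-1` _ = `]a - v, b - v]%classic); last first.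
  by apply/seteqP; split => x /=; rewrite !in_itv /= ltrBlDr lerBrDr.
rewrite !lebesgue_measure_itv /= !lte_fin ltrD2r; case: ifP => // _.
by rewrite -!EFinB; congr EFin; ring.
Qed.

(** The density at [x] of [N(v, s^2)] with respect to [N(0, s^2)]. *)
Definition tilt (R : realType) (s v x : R) : R :=
  expR ((v * x - v ^+ 2 / 2) / s ^+ 2).

Lemma measurable_tilt (R : realType) (s v : R) : measurable_fun setT (tilt s v).
Proof.
apply: measurableT_comp => //; apply: measurable_funM => //.
by apply: measurable_funB => //; apply: measurable_funM.
Qed.

Lemma normal_prob_shift (R : realType) (s v : R) (B : set R) : s != 0 -> measurable B ->
  normal_prob 0 s ((fun x : R => x + v) @^-1` B) =
  (\int[normal_prob 0 s]_(x in B) (tilt s v x)%:E)%E.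
Proof.
move=> s0 mB; have mshift : measurable_fun setT (fun x : R => x + v : measurableTypeR R).
  exact: measurable_funD.
pose f (y : R) : \bar R := (tilt s v y * \1_B y)%:E.
have mf : measurable_fun setT f.
  by apply/measurable_EFinP/measurable_funM; [exact: measurable_tilt|exact: measurable_indic].
have f0 y : (0 <= f y)%E by rewrite lee_fin mulr_ge0// expR_ge0.
transitivity (\int[normal_prob 0 s]_x f x)%E; last first.
  rewrite [RHS]integral_mkcond; apply: eq_integral => x _.
  by rewrite patchE /f indicE; case: (x \in B); rewrite ?mulr1 ?mulr0.
rewrite -[RHS]mul1e -(@weighted_law _ _ _ _ _ lebesgue_measure _ (normal_pdf 0 s) id 1)//; first last.
- by move=> C mC; rewrite mul1e.
- exact: measurable_normal_pdf.
- by move=> x; exact: normal_pdf_ge0.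
pose g (y : R) : \bar R := ((normal_pdf 0 s y)%:E * f y)%E.
have gE x : g (x + v) = ((normal_pdf 0 s x)%:E * (\1_B (x + v))%:E)%E.
  rewrite /g /f -!EFinM mulrA; congr (_ * _)%:E.
  rewrite /normal_pdf (negbTE s0) -mulrA; congr (_ * _).
  by rewrite /normal_fun /tilt -expRD; congr expR; rewrite !subr0; field.
rewrite -/g; pose gv (x : R) := g (x + v).
transitivity (\int[lebesgue_measure]_x gv x)%E.
  rewrite /normal_prob integral_mkcond; apply: eq_integral => x _; rewrite /gv gE patchE indicE.
  have -> : (x \in (fun x : R => x + v) @^-1` B) = (x + v \in B) by apply/idP/idP; rewrite !inE.
  by case: (_ \in B); rewrite ?mule1 ?mule0.
rewrite -[RHS]mul1e -(@weighted_law _ _ _ _ R lebesgue_measure lebesgue_measure (fun=> 1) (fun x : R => x + v) 1)//.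
- by apply: eq_integral => x _; rewrite mul1e.
- move=> C mC; rewrite mul1e integral_cst.
    by rewrite mul1e; exact: lebesgue_measure_shift.
  by rewrite -[X in measurable X]setTI; exact: mshift.
- by move=> y; rewrite mule_ge0// lee_fin normal_pdf_ge0.
- apply: emeasurable_funM => //; apply/measurable_EFinP; exact: measurable_normal_pdf.
Qed.

Section Density.
Context d (T : measurableType d) (R : realType) (mu : {measure set T -> \bar R}).
Context (phi : T -> R).

Definition density (phi0 : forall x, 0 <= phi x) (mphi : measurable_fun setT phi)
  (E : set T) : \bar R := (\int[mu]_(x in E) (phi x)%:E)%E.

Context (phi0 : forall x, 0 <= phi x) (mphi : measurable_fun setT phi).
Local Open Scope ereal_scope.

Let density_set0 : density phi0 mphi set0 = 0.
Proof. by rewrite /density integral_set0. Qed.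

Let density_ge0 E : 0 <= density phi0 mphi E.
Proof. by apply: integral_ge0 => x _; rewrite lee_fin. Qed.

Let density_additive : semi_sigma_additive (density phi0 mphi).
Proof.
move=> A mA tA mUA; rewrite /density ge0_integral_bigcup//.
- by apply: is_cvg_ereal_nneg_natsum_cond => n _ _; apply: integral_ge0 => x _; rewrite lee_fin.
- exact/measurable_EFinP/measurable_funTS.
- by move=> x _; rewrite lee_fin.
Qed.

HB.instance Definition _ := isMeasure.Build _ _ _ (density phi0 mphi)
  density_set0 density_ge0 density_additive.
End Density.

Definition box (R : realType) (N : nat) (B : nat -> set R) : set (nat -> R) :=
  [set d | forall i, (i < N)%N -> B i (d i)].

Definition boxes (R : realType) (N : nat) : set (set (nat -> R)) :=
  [set E | exists2 B, (forall i, measurable (B i)) & E = box N B].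

(** Sequences of which only the first [N] terms are observable: the generating
boxes constrain no other coordinate.  Hence no dependent type is needed to speak of
the first [N] increments of a process. *)
Definition increments (R : realType) (N : nat) := g_sigma_algebraType (@boxes R N).

Lemma boxI (R : realType) N (B C : nat -> set R) :
  box N B `&` box N C = box N (fun i => B i `&` C i).
Proof.
apply/seteqP; split => [x [xB xC] i iN|x xBC].
  by split; [exact: xB|exact: xC].
by split => i /xBC[].
Qed.

Lemma box_setT (R : realType) N : box N (fun=> setT) = [set: nat -> R].
Proof. by apply/seteqP; split. Qed.

Lemma measurable_box (R : realType) N (B : nat -> set R) :
  (forall i, measurable (B i)) -> measurable (box N B : set (increments R N)).
Proof. by move=> mB; apply: sub_sigma_algebra; exists B. Qed.

Lemma measurable_coord (R : realType) N i : (i < N)%N ->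
  measurable_fun [set: increments R N] (fun x : increments R N => x i).
Proof.
move=> iN _ B mB; rewrite setTI.
rewrite (_ : _ @^-1` _ = box N (fun j => if j == i then B else setT)).
  by apply: measurable_box => j; case: ifP.
apply/seteqP; split => [x xB j _|x]; first by case: eqP => [->|].
by move=> /(_ i iN); rewrite eqxx.
Qed.

Lemma measurable_incrementsP d (T : measurableType d) (R : realType) N
    (f : T -> increments R N) :
  (forall i, (i < N)%N -> measurable_fun [set: T] (fun x => f x i)) ->
  measurable_fun [set: T] f.
Proof.
move=> mf; refine (@measurability _ _ _ _ _ _ (@boxes R N : set (set (increments R N))) _ _) => //.
move=> _ [_ [B mB ->]] <-.
rewrite setTI (_ : _ @^-1` _ = \bigcap_(i in `I_N) ((fun x => f x i) @^-1` B i)).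
  apply: bigcap_measurableType => i iN.
  by rewrite -[X in measurable X]setTI; exact: mf.
by apply/seteqP; split => x fx i; apply: fx.
Qed.

Definition white_noise (R : realType) N (s : R) (Q : probability (increments R N) R) :=
  forall B : nat -> set R, (forall i, measurable (B i)) ->
    Q (box N B) = (\prod_(i < N) normal_prob 0 s (B i))%E.

Section CameronMartin.
Context (R : realType) (N : nat) (s : R) (Q : probability (increments R N) R).
Hypothesis s0 : s != 0.
Hypothesis noise : white_noise s Q.
Context (v : nat -> R).

Definition tilts (k : nat) (x : increments R N) : R := \prod_(0 <= i < k) tilt s (v i) (x i).

Lemma tilts_ge0 k x : 0 <= tilts k x.
Proof. by apply: prodr_ge0 => i _; exact: expR_ge0. Qed.

Lemma measurable_tilts k : (k <= N)%N -> measurable_fun setT (tilts k).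
Proof.
move=> kN; apply: measurable_prod => i; rewrite mem_index_iota => /andP[_ ik].
apply: (measurableT_comp (measurable_tilt _ _)).
by apply: measurable_coord; exact: leq_trans kN.
Qed.

Let np (B : set R) : R := fine (normal_prob 0 s B).

Let npE B : measurable B -> normal_prob 0 s B = (np B)%:E.
Proof. by move=> mB; rewrite /np fineK// fin_num_measure. Qed.

Let factor (B : nat -> set R) (k i : nat) : R :=
  if (i < k)%N then np ((fun x => x + v i) @^-1` B i) else np (B i).

Let integral_tilts_box k (B : nat -> set R) : (k <= N)%N ->
  (forall i, measurable (B i)) ->
  (\int[Q]_(x in box N B) (tilts k x)%:E = (\prod_(i < N) factor B k i)%:E)%E.
Proof.
elim: k B => [|k IH] B kN mB.
  rewrite /tilts; under eq_integral do rewrite big_geq//.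
  rewrite integral_cst; last exact: measurable_box.
  rewrite mul1e; transitivity (\prod_(i < N) normal_prob 0 s (B i))%E; first exact: noise.
  by rewrite -prodEFin; apply: eq_bigr => i _; rewrite /factor /=; rewrite npE; last exact: mB.
pose B' C i := if i == k then C else B i.
have mB' C : measurable C -> forall i, measurable (B' C i).
  by move=> mC i; rewrite /B'; case: ifP.
pose phi (x : increments R N) := tilts k x * \1_(box N (B' setT)) x.
pose c : R := \prod_(i < N | i != k :> nat) factor B k i.
have boxB' C (x : nat -> R) : box N (B' C) x <-> box N (B' setT) x /\ C (x k).
  split=> [xB|[xB Cx] i iN].
    split=> [i iN|]; last by have := xB k kN; rewrite /B' eqxx.
    by have := xB i iN; rewrite /B'; case: eqP.
  by have := xB i iN; rewrite /B'; case: eqP => [->|].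
have law C : measurable C ->
  (\int[Q]_(x in (fun x : increments R N => x k) @^-1` C) (phi x)%:E = c%:E * normal_prob 0 s C)%E.
  move=> mC; transitivity (\int[Q]_(x in box N (B' C)) (tilts k x)%:E)%E.
    rewrite integral_mkcond [RHS]integral_mkcond; apply: eq_integral => x _.
    rewrite !patchE /phi indicE.
    have [/set_mem/boxB'[xB xC]|/negP xNB] := boolP (x \in box N (B' C)).
      by rewrite mem_set// mem_set// mulr1.
    case: ifPn => // /set_mem xC; rewrite memNset ?mulr0// => xB.
    by apply: xNB; rewrite inE; apply/boxB'.
  rewrite IH ?(ltnW kN)//; last exact: mB'.
  rewrite (bigD1 (Ordinal kN)) //= {1}/factor ltnn {1}/B' eqxx npE// -EFinM mulrC.
  congr (_ * _)%:E; apply: eq_bigr => i /negbTE ik; rewrite /factor /B'.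
  by rewrite -[nat_of_ord i == k]/(i == Ordinal kN) ik.
have mphi : measurable_fun setT phi.
  apply: measurable_funM; first exact: (measurable_tilts (ltnW kN)).
  by apply: measurable_indic; apply: measurable_box; exact: mB'.
have phi0 x : 0 <= phi x by rewrite mulr_ge0// tilts_ge0.
pose f (y : R) : \bar R := (tilt s (v k) y * \1_(B k) y)%:E.
have mf : measurable_fun setT f.
  by apply/measurable_EFinP/measurable_funM; [exact: measurable_tilt|exact: measurable_indic].
have f0 y : (0 <= f y)%E by rewrite lee_fin mulr_ge0// expR_ge0.
have := @weighted_law _ _ _ _ R Q (normal_prob 0 s) phi (fun x => x k) c phi0 mphi
  (measurable_coord kN) law f f0 mf.
have f_int : (\int[normal_prob 0 s]_y f y = (np ((fun x => x + v k)%R @^-1` B k))%:E)%E.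
  rewrite -npE; last first.
    by rewrite -[X in measurable X]setTI; apply: measurable_funD.
  rewrite normal_prob_shift// [RHS]integral_mkcond; apply: eq_integral => y _.
  by rewrite patchE /f indicE; case: ifP; rewrite ?mulr1 ?mulr0.
rewrite f_int -EFinM => e; rewrite (bigD1 (Ordinal kN)) //= {1}/factor ltnSn mulrC.
rewrite (_ : \prod_(i < N | i != Ordinal kN) _ = c); last first.
  apply: eq_bigr => i ik; rewrite /factor ltnS leq_eqVlt.
  by rewrite -[nat_of_ord i == k]/(i == Ordinal kN) (negbTE ik).
rewrite -e [LHS]integral_mkcond; apply: eq_integral => x _; rewrite patchE /f /phi !indicE.
have [/set_mem xB|/negP xNB] := boolP (x \in box N B).
  rewrite /tilts big_nat_recr//= !mem_set ?mulr1//; first exact: xB.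
  by move=> i iN; rewrite /B'; case: eqP => // _; exact: xB.
rewrite -EFinM; have [/set_mem xk|] := boolP (x k \in B k); last by rewrite !mulr0.
rewrite memNset ?mulr0 ?mul0r// => xB; apply: xNB; rewrite inE => i iN.
by have := xB i iN; rewrite /B'; case: eqP => [->|].
Qed.

(** The Cameron-Martin formula.  Both sides are measures of [E] and they agree
on the boxes, which are stable by intersection. *)
Lemma white_noise_shift (E : set (increments R N)) : measurable E ->
  Q [set x | E (addseq x v)] = (\int[Q]_(x in E) (tilts N x)%:E)%E.
Proof.
move=> mE; pose shift (x : increments R N) : increments R N := addseq x v.
have mshift : measurable_fun setT shift.
  by apply: measurable_incrementsP => i iN; apply: measurable_funD => //; exact: measurable_coord.
change (pushforward Q shift E = density Q (@tilts_ge0 N) (measurable_tilts (leqnn N)) E).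
refine (@measure_unique _ R (increments R N) (@boxes R N : set (set (increments R N)))
  (fun=> setT) _ _ _ _ (measure_function_pushforward__canonical__measure_function_Measure Q mshift)
  _ _ _ E mE) => //.
- by move=> _ _ [B mB ->] [C mC ->]; rewrite boxI; eexists; last reflexivity; move=> i; exact: measurableI.
- by move=> _; exists (fun=> setT) => //; rewrite box_setT.
- by rewrite bigcup_const.
- move=> _ [B mB ->].
  transitivity (\prod_(i < N) normal_prob 0 s ((fun x => x + v i)%R @^-1` B i))%E.
    apply: (noise (B := fun i => (fun x => x + v i)%R @^-1` B i)) => i.
    by rewrite -[X in measurable X]setTI; apply: measurable_funD.
  transitivity (\prod_(i < N) factor B N i)%:E; last exact/esym/integral_tilts_box.
  rewrite -prodEFin; apply: eq_bigr => i _; rewrite /factor ltn_ord npE//.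
  by rewrite -[X in measurable X]setTI; apply: measurable_funD.
- by move=> k; change (Q setT < +oo)%E; rewrite probability_setT ltry.
Qed.

End CameronMartin.

(** * Averaging over one-parameter families of shifts *)

(** To bound the length of [I] it is enough to look at pairs of its points that
are almost its end points. *)
Lemma lebesgue_interval_expand (R : realType) (I J : set R) (c : R) :
  is_interval I -> has_inf I -> has_sup I -> measurable J -> 0 <= c ->
  (forall x y, I x -> I y -> x < y ->
    exists x' y', [/\ x' <= y', y - x <= c * (y' - x') & `[x', y'] `<=` J]) ->
  (lebesgue_measure I <= c%:E * lebesgue_measure J)%E.
Proof.
move=> itvI infI supI mJ c0 IJ.
apply: (@le_trans _ _ (sup I - inf I)%:E).
  apply: (@le_trans _ _ (lebesgue_measure `[inf I, sup I])).
    apply: le_measure; rewrite ?inE//; first exact: is_interval_measurable.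
    by move=> x Ix /=; rewrite in_itv /= ge_inf ?ub_le_sup//; [case: supI|case: infI].
  rewrite lebesgue_measure_itv /= lte_fin; case: ifPn => [_|]; first by rewrite EFinB.
  case: infI => -[x Ix] lbI; rewrite lee_fin subr_ge0 => _.
  by apply: (@le_trans _ _ x); [exact: ge_inf|apply: ub_le_sup => //; case: supI].
apply/lee_addgt0Pr => e e0.
have e20 : 0 < e / 2 by rewrite divr_gt0.
have [x Ix xinf] := inf_adherent e20 infI.
have [y Iy ysup] := sup_adherent e20 supI.
have [xy|yx] := ltP x y; last first.
  apply: (@le_trans _ _ e%:E); first by rewrite lee_fin; lra.
  by rewrite leeDr// mule_ge0.
have [x' [y' [xy' yx xyJ]]] := IJ _ _ Ix Iy xy.
apply: (@le_trans _ _ (c%:E * lebesgue_measure `[x', y'] + e%:E)%E).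
  rewrite lebesgue_measure_itv /= lte_fin; case: ltP => [_|y'x'].
    by rewrite -EFinB -EFinM -EFinD lee_fin; lra.
  have e' : x' = y' by apply/eqP; rewrite eq_le xy' y'x'.
  by rewrite mule0 add0e lee_fin; move: yx; rewrite e' subrr mulr0; lra.
rewrite leeD2r// lee_wpmul2l ?lee_fin//.
by apply: le_measure; rewrite ?inE.
Qed.

(** The averaging argument.  [Q] of the section of [S] at each parameter [y] is at
least [q] when [|y| <= a], that of [S'] is at most [q'] and vanishes when [|y| > a'];
for each fixed [x] the sets of parameters have comparable lengths.  Exchanging the
order of integration compares [q] with [q']. *)
Lemma sweep d (T : measurableType d) (R : realType) (Q : probability T R)
  (S S' : set (T * R)) (a a' c : R) (q q' : \bar R) :
  measurable S -> measurable S' -> 0 <= a -> 0 <= a' -> 0 <= c -> (0 <= q)%E -> (0 <= q')%E ->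
  (forall y, `|y| <= a -> (q <= Q [set x | S (x, y)])%E) ->
  (forall y, `|y| <= a' -> (Q [set x | S' (x, y)] <= q')%E) ->
  (forall x y, S' (x, y) -> `|y| <= a') ->
  (forall x, (lebesgue_measure [set y | S (x, y)] <=
              c%:E * lebesgue_measure [set y | S' (x, y)])%E) ->
  ((2 * a)%:E * q <= (c * (2 * a'))%:E * q')%E.
Proof.
move=> mS mS' a0 a0' c0 q0 q0' Sq Sq' S'a SS'.
have lebE (b : R) : 0 <= b -> lebesgue_measure (`[- b, b] : set R) = (2 * b)%:E.
  move=> b0; rewrite lebesgue_measure_itv /= lte_fin; case: ltP => bb.
    by rewrite -EFinD; congr EFin; lra.
  by congr EFin; lra.
have xE (U : set (T * R)) x : xsection U x = [set y | U (x, y)].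
  by apply/seteqP; split => y; rewrite /xsection /= inE.
have yE (U : set (T * R)) y : ysection U y = [set x | U (x, y)].
  by apply/seteqP; split => x; rewrite /ysection /= inE.
have tonelli (U : set (T * R)) : measurable U ->
  (\int[Q]_x lebesgue_measure [set y : R | U (x, y)] =
   \int[lebesgue_measure]_y Q [set x | U (x, y)])%E.
  move=> mU; have := indic_fubini_tonelli Q lebesgue_measure mU.
  rewrite indic_fubini_tonelli_FE// indic_fubini_tonelli_GE//.
  under eq_integral do rewrite /= xE.
  by under [in RHS]eq_integral do rewrite /= yE.
have mx (U : set (T * R)) : measurable U ->
    measurable_fun setT (fun x => lebesgue_measure [set y : R | U (x, y)]).
  move=> mU; have := measurable_fun_xsection lebesgue_measure mU.
  by apply: eq_measurable_fun => x _; rewrite /= xE.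
have my (U : set (T * R)) : measurable U ->
    measurable_fun (setT : set R) (fun y : R => Q [set x | U (x, y)]).
  move=> mU; have := measurable_fun_ysection Q mU.
  by apply: eq_measurable_fun => x _; rewrite /= yE.
have itvP (b y : R) : (y \in `[- b, b]) = (`|y| <= b) by rewrite in_itv /= ler_norml.
apply: (@le_trans _ _ (\int[Q]_x lebesgue_measure [set y : R | S (x, y)])%E).
  rewrite tonelli// -lebE// muleC -integral_cst//.
  apply: (@le_trans _ _ (\int[lebesgue_measure]_(y in `[(- a)%R, a]) Q [set x | S (x, y)])%E).
    apply: ge0_le_integral => //; last by move=> y /=; rewrite itvP => /Sq.
    exact: (measurable_funTS (my _ mS)).
  apply: ge0_subset_integral => //; exact: my.
apply: (@le_trans _ _ (c%:E * \int[Q]_x lebesgue_measure [set y : R | S' (x, y)])%E).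
  rewrite -ge0_integralZl//; last exact: mx.
  apply: ge0_le_integral => //; first exact: mx.
  by apply: emeasurable_funM => //; exact: mx.
rewrite EFinM -muleA lee_wpmul2l ?lee_fin// tonelli// -lebE// muleC -integral_cst//.
rewrite [leRHS]integral_mkcond; apply: ge0_le_integral => //.
- exact: my.
- by apply/(measurable_restrictT _ _).1.
- move=> y _; rewrite patchE; case: ifPn => [/set_mem/= |]; first by rewrite itvP => /Sq'.
  move=> /negP yN; rewrite (_ : [set x | S' (x, y)] = set0) ?measure0//.
  apply/seteqP; split => // x /= /S'a yb; apply: yN; rewrite inE /=.
  by rewrite itvP.
Qed.

(** * The cost of bending the noise *)

Definition block_sum (R : realType) (i l : nat) (x : nat -> R) : R :=
  \sum_(i <= k < i + l) x k.

Lemma sum_block (R : realType) N i l (c : R) x : (i + l <= N)%N ->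
  \sum_(0 <= k < N) block i l c k * x k = c * block_sum i l x.
Proof.
move=> ilN; rewrite /block_sum mulr_sumr [RHS](big_nat_widen _ _ N)// [RHS](big_nat_widenl _ 0)//.
rewrite [RHS]big_mkcond; apply: eq_bigr => k _; rewrite /block andTb andbC.
by case: ifP => _; rewrite ?mul0r.
Qed.

Lemma block_sum_bend (R : realType) (D : R) i l (a b : R) x :
  block_sum i l (bend D i l a b x) = block_sum i l x + D * a * l%:R.
Proof.
rewrite /block_sum; under eq_big_nat => k kil do rewrite bend_on_first//.
by rewrite big_split /= sumr_const_nat addKn mulr_natr.
Qed.

Lemma block_sum_bend' (R : realType) (D : R) i l (a b : R) x :
  block_sum (i + l) l (bend D i l a b x) = block_sum (i + l) l x + D * b * l%:R.
Proof.
rewrite /block_sum; under eq_big_nat => k kil do rewrite bend_on_second//.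
by rewrite big_split /= sumr_const_nat addKn mulr_natr.
Qed.

(** Thus a lower bound on a probability after bending is an upper bound after
bending back. *)
Lemma bendK (R : realType) (D : R) i l (a b : R) x :
  bend D i l a b (bend D i l (- a) (- b) x) = x.
Proof.
apply/funext => k; rewrite /bend /addseq /block.
by case: ifP => _; case: ifP => _; ring.
Qed.

(** The shift being constant on each block, its Cameron-Martin density only
involves the sums of the increments over the two blocks, and the quadratic term
lowers it. *)
Lemma tilts_le (R : realType) (D : R) N i l (a b S : R) (x : increments R N) : 0 < D ->
  (i + l + l <= N)%N -> `|block_sum i l x| <= S -> `|block_sum (i + l) l x| <= S ->
  tilts (Num.sqrt D) (fun k => D * (block i l a k + block (i + l) l b k)) N x
    <= expR ((`|a| + `|b|) * S).
Proof.
move=> D0 ilN S1 S2.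
rewrite /tilts -(expR_sum (index_iota 0 N) xpredT) ler_expR.
apply: (@le_trans _ _ (\sum_(0 <= k < N) (block i l a k * x k + block (i + l) l b k * x k))).
  apply: ler_sum => k _; rewrite sqr_sqrtr ?(ltW D0)//.
  move: (block i l a k) (block _ _ b k) => u w.
  rewrite (_ : _ / D = (u + w) * x k - D * (u + w) ^+ 2 / 2); last first.
    by field; rewrite gt_eqF.
  have : 0 <= D * (u + w) ^+ 2 / 2 by apply: divr_ge0 => //; apply: mulr_ge0; [exact: ltW|exact: sqr_ge0].
  by rewrite mulrDl gerBl.
rewrite big_split /= !sum_block//; last by rewrite (leq_trans _ ilN)// leq_addr.
rewrite mulrDl lerD//.
  by rewrite (le_trans (ler_norm _))// normrM ler_wpM2l.
by rewrite (le_trans (ler_norm _))// normrM ler_wpM2l.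
Qed.

Definition tube_seq (R : realType) (N : nat) (M : R) (x : nat -> R) : Prop :=
  forall k, (k <= N)%N -> `|x k| <= M.

(** The sum of the increments over a block is the displacement of the scheme
minus the accumulated drift, so it is bounded when the scheme stays in a tube. *)
Lemma block_sum_le (R : realType) (mu : R -> R) (B D M : R) N i l d : 0 <= D ->
  D * l%:R <= 1 -> (forall x, `|mu x| <= B) -> (i + l <= N)%N ->
  tube_seq N M (euler mu D d) -> `|block_sum i l d| <= 2 * M + B.
Proof.
move=> D0 Dl muB ilN xM.
have B0 : 0 <= B by apply: le_trans (muB 0).
rewrite /block_sum (_ : \sum_(i <= k < i + l) d k = (euler mu D d (i + l) - euler mu D d i) -
    D * \sum_(i <= k < i + l) mu (euler mu D d k)); last first.
  rewrite -(telescope_sumr _ (leq_addr l i)) mulr_sumr -sumrB.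
  by apply: eq_bigr => k _ /=; ring.
have x1 := xM _ ilN; have x2 := xM i (leq_trans (leq_addr _ _) ilN).
apply: le_trans (ler_normB _ _) _; apply: lerD.
  by apply: le_trans (ler_normB _ _) _; lra.
rewrite normrM (ger0_norm D0).
apply: (@le_trans _ _ (D * (B * l%:R))).
  apply: ler_wpM2l => //; apply: le_trans (ler_norm_sum _ _ _) _.
  apply: le_trans (ler_sum _ (fun k _ => muB _)) _.
  by rewrite sumr_const_nat addKn mulr_natr.
by rewrite mulrCA ler_piMr.
Qed.

Lemma measurable_bend (R : realType) (D : R) N i l (a b : R) :
  measurable_fun setT (bend D i l a b : increments R N -> increments R N).
Proof.
apply: measurable_incrementsP => k kN; apply: measurable_funD => //.
exact: measurable_coord.
Qed.

(** On events which confine the scheme to a tube, the Cameron-Martin density is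
bounded independently of the number of steps; hence bending the noise changes
their probability by a bounded factor, in both directions. *)
Section NoiseShift.
Context (R : realType) (mu : R -> R) (B D M : R) (N i l : nat).
Context (Q : probability (increments R N) R).
Hypothesis muB : forall x, `|mu x| <= B.
Hypothesis D0 : 0 < D.
Hypothesis Dl : D * l%:R <= 1.
Hypothesis ilN : (i + l + l <= N)%N.
Hypothesis noise : white_noise (Num.sqrt D) Q.

Let sqrtD0 : Num.sqrt D != 0.
Proof. by rewrite gt_eqF// sqrtr_gt0. Qed.

Let ilN1 : (i + l <= N)%N.
Proof. exact: leq_trans (leq_addr _ _) ilN. Qed.

Let shift_le (a b S : R) (E : set (increments R N)) : measurable E ->
  (forall x, E x -> `|block_sum i l x| <= S /\ `|block_sum (i + l) l x| <= S) ->
  (Q [set x | E (bend D i l a b x)] <= (expR ((`|a| + `|b|) * S))%:E * Q E)%E.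
Proof.
move=> mE ES; rewrite /bend (white_noise_shift sqrtD0 noise)// -integral_cst//.
apply: ge0_le_integral => //.
- by move=> x _; rewrite lee_fin tilts_ge0.
- by apply/measurable_EFinP/measurable_funTS; exact: (measurable_tilts _ _ (leqnn N)).
- by move=> x /ES[S1 S2]; rewrite lee_fin; exact: tilts_le.
Qed.

Lemma noise_bend_le (a b : R) (E : set (increments R N)) : measurable E ->
  (forall x, E x -> tube_seq N M (euler mu D x)) ->
  (Q [set x | E (bend D i l a b x)] <=
   (expR ((`|a| + `|b|) * (2 * M + B)))%:E * Q E)%E.
Proof.
move=> mE EM; apply: shift_le => // x /EM xM; split.
  by apply: (block_sum_le (ltW D0) Dl muB ilN1 xM).
by apply: (block_sum_le (ltW D0) Dl muB ilN xM).
Qed.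

Lemma noise_bend_ge (a b : R) (E : set (increments R N)) : measurable E ->
  (forall x, E x -> tube_seq N M (euler mu D x)) ->
  (Q E <= (expR ((`|a| + `|b|) * (2 * M + B + `|a| + `|b|)))%:E *
          Q [set x | E (bend D i l a b x)])%E.
Proof.
move=> mE EM; rewrite -[X in (X <= _)%E](_ : Q [set x | E (bend D i l a b (bend D i l (- a) (- b) x))] = _).
  2: by congr (Q _); apply/seteqP; split => x /=; rewrite bendK.
rewrite -(normrN a) -(normrN b).
have mE' : measurable [set x : increments R N | E (bend D i l a b x)].
  by rewrite -[X in measurable X]setTI; exact: (measurable_bend D i l a b).
apply: (@shift_le _ _ _ [set x : increments R N | E (bend D i l a b x)]) => // x /EM xM.
have Dl0 : 0 <= D * l%:R by rewrite mulr_ge0// ltW.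
have bnd (c : R) : `|D * c * l%:R| <= `|c|.
  by rewrite mulrAC normrM (ger0_norm Dl0) ler_piMl.
have := block_sum_le (ltW D0) Dl muB ilN1 xM.
have := block_sum_le (ltW D0) Dl muB ilN xM.
rewrite block_sum_bend block_sum_bend' !normrN.
have := bnd a; have := bnd b; have := normr_ge0 a; have := normr_ge0 b.
move: (D * a * _) (D * b * _) (block_sum i l x) (block_sum (i + l) l x) => u w y z.
by rewrite !ler_norml => a0 b0 /andP[w1 w2] /andP[u1 u2] /andP[z1 z2] /andP[y1 y2]; split; apply/andP; split; lra.
Qed.

End NoiseShift.

(** * Comparison of events for the Euler scheme *)

(** Events of this form contain every path that lies between two of their paths
([corridor_convex]), which makes the sets of admissible slopes intervals. *)
Definition corridor (R : realType) (N : nat) (lo hi p : nat -> R) (K : set nat)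
    (x : nat -> R) : Prop :=
  (forall k, (k <= N)%N -> lo k <= x k <= hi k) /\
  exists k, [/\ (k <= N)%N, K k & x k < p k].

Lemma corridor_convex (R : realType) N (lo hi p : nat -> R) K x y z :
  corridor N lo hi p K x -> corridor N lo hi p K z ->
  (forall k, x k <= y k <= z k) -> corridor N lo hi p K y.
Proof.
move=> [xlo _] [zhi [j [jN Kj zj]]] xyz; split.
  move=> k kN; have /andP[xy yz] := xyz k.
  have /andP[lx _] := xlo _ kN; have /andP[_ zh] := zhi _ kN.
  by rewrite (le_trans lx)// (le_trans yz).
by exists j; split=> //; have /andP[_ yz] := xyz j; exact: le_lt_trans zj.
Qed.

Section CorridorMeasurable.
Context (R : realType) (mu : R -> R) (D : R) (N : nat).
Hypothesis mmu : measurable_fun setT mu.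

Lemma measurable_euler k : (k <= N)%N ->
  measurable_fun setT (fun x : increments R N => euler mu D x k).
Proof.
elim: k => [|k IH] kN /=; first exact: measurable_cst.
apply: measurable_funD; last exact: measurable_coord.
apply: measurable_funD; first exact: IH (ltnW kN).
by apply: measurable_funM => //; apply: (measurableT_comp mmu); exact: IH (ltnW kN).
Qed.

Lemma measurable_corridor lo hi p K :
  measurable [set x : increments R N | corridor N lo hi p K (euler mu D x)].
Proof.
have mpre (A : set R) k : (k <= N)%N -> measurable A ->
    measurable [set x : increments R N | A (euler mu D x k)].
  move=> kN mA; rewrite -[X in measurable X]setTI.
  exact: (measurable_euler kN).
rewrite (_ : [set x | _] =
   (\bigcap_(k in `I_N.+1) [set x : increments R N | lo k <= euler mu D x k <= hi k]) `&`
   (\bigcup_(k in `I_N.+1 `&` K) [set x : increments R N | euler mu D x k < p k])).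
  apply: measurableI.
    apply: bigcap_measurableType => k kN.
    rewrite (_ : [set x | _] = [set x : increments R N | `[lo k, hi k]%classic (euler mu D x k)]).
      exact: mpre.
    by apply/seteqP; split => x /=; rewrite in_itv.
  apply: bigcup_measurable => k [kN _].
  rewrite (_ : [set x | _] = [set x : increments R N | `]-oo, p k[%classic (euler mu D x k)]).
    exact: mpre.
  by apply/seteqP; split => x /=; rewrite in_itv.
apply/seteqP; split=> [x [xlh [k [kN Kk xp]]]|x [xlh [k [kN Kk] xp]]].
  by split; [move=> j jN; exact: xlh|exists k].
by split; [move=> j jN; exact: xlh|exists k].
Qed.

Lemma measurable_tube_seq (m : R) :
  measurable [set x : increments R N | tube_seq N m (euler mu D x)].
Proof.
rewrite (_ : [set x | _] = [set x : increments R N |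
    corridor N (fun=> - m) (fun=> m) (fun=> m + 1) setT (euler mu D x)]).
  exact: measurable_corridor.
apply/seteqP; split=> [x xm|x [xm _] k kN]; last by rewrite ler_norml xm.
split; first by move=> k kN; rewrite -ler_norml xm.
by exists 0%N; split=> //; have := xm 0%N (leq0n _); rewrite ler_norml => /andP[_]; lra.
Qed.

Lemma measurable_tube_seq_end (m y rho : R) :
  measurable [set x : increments R N | tube_seq N m (euler mu D x) /\ `|euler mu D x N - y| <= rho].
Proof.
rewrite (_ : [set x | _] = [set x : increments R N | tube_seq N m (euler mu D x)] `&`
    (fun x : increments R N => euler mu D x N) @^-1` `[y - rho, y + rho]).
  apply: measurableI; first exact: measurable_tube_seq.
  by rewrite -[X in measurable X]setTI; apply: measurable_euler.
have yP u : (y - rho <= u <= y + rho) = (`|u - y| <= rho).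
  by rewrite ler_norml; apply/andP/andP => -[h1 h2]; split; lra.
by apply/seteqP; split=> x []; rewrite /= ?in_itv /= ?yP.
Qed.

End CorridorMeasurable.

Lemma lip_measurable (R : realType) (mu : R -> R) (L : R) :
  (forall x y, `|mu x - mu y| <= L * `|x - y|) -> measurable_fun setT mu.
Proof.
move=> muL; apply: continuous_measurable_fun.
apply: (@lipschitz_continuous _ _ L) => x y xy.
by have := muL y x; rewrite (ger0_norm (_ : 0 <= y - x)) ?subr_ge0.
Qed.

Section Discrete.
Context (R : realType) (mu : R -> R) (L B D M : R) (N i l : nat).
Context (Q : probability (increments R N) R).
Hypothesis muL : forall x y, `|mu x - mu y| <= L * `|x - y|.
Hypothesis muB : forall x, `|mu x| <= B.
Hypothesis D0 : 0 < D.
Hypothesis M0 : 0 <= M.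
Hypothesis L0 : 0 <= L.
Hypothesis l0 : (0 < l)%N.
Hypothesis LDl : 4 * (L * D * l%:R) <= 1.
Hypothesis Dl : D * l%:R <= 1.
Hypothesis ilN : (i + l + l <= N)%N.
Hypothesis noise : white_noise (Num.sqrt D) Q.

Local Notation tau := (D * l%:R).
Local Notation Ev lo hi p K := [set x : increments R N | corridor N lo hi p K (euler mu D x)].

Let C1 := expR (18 * (2 * M + B + 18)).

(** The hypothesis on [corridor] says that the first event becomes the second one
when a path is raised as in [bend_lift].  The first event, bent by [(0, a)] with
[|a| <= 1], and the second one, bent by [(eta, b)] with [|b| <= 9], are compared by
[sweep]; bending costs a factor [expR (18 * (2 * M + B + 18))] on each side.  The bound
does not depend on [eta] nor on the number of steps. *)
Lemma corridor_rise (eta : R) (lo hi p lo' hi' p' : nat -> R) (K K' : set nat) :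
  0 < eta -> eta <= 1 ->
  (forall k, (k <= N)%N -> - M <= lo k /\ hi k <= M) ->
  (forall k, (k <= N)%N -> - M <= lo' k /\ hi' k <= M) ->
  (forall x y : nat -> R, corridor N lo hi p K x ->
     (forall k, (k <= i)%N || (i + l + l <= k)%N -> y k = x k) ->
     (forall k, x k <= y k <= x k + 4 * eta * tau) ->
     (forall k, (2 * i + l <= 2 * k)%N -> (2 * k <= 2 * i + 3 * l)%N ->
        x k + eta * tau / 32 <= y k) ->
     corridor N lo' hi' p' K' y) ->
  (Q (Ev lo hi p K) <= (36 * C1 ^+ 2)%:E * Q (Ev lo' hi' p' K'))%E.
Proof.
move=> eta0 eta1 loM lo'M step.
have mmu := lip_measurable muL.
have mE := @measurable_corridor R mu D N mmu lo hi p K.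
have mE' := @measurable_corridor R mu D N mmu lo' hi' p' K'.
have tubeE (l1 h1 p1 : nat -> R) K1 x : (forall k, (k <= N)%N -> - M <= l1 k /\ h1 k <= M) ->
    corridor N l1 h1 p1 K1 x -> tube_seq N M x.
  move=> lM [xlh _] k kN; have [a b] := lM _ kN; have /andP[c e] := xlh _ kN.
  by rewrite ler_norml (le_trans a)// (le_trans e).
have B0 : 0 <= B by apply: le_trans (muB 0).
pose S : set (increments R N * R) :=
  [set z | `|z.2| <= 1 /\ Ev lo hi p K (bend D i l 0 z.2 z.1)].
pose S' : set (increments R N * R) :=
  [set z | `|z.2| <= 9 /\ Ev lo' hi' p' K' (bend D i l eta z.2 z.1)].
have mbend a : measurable_fun setT
    (fun z : increments R N * R => bend D i l a z.2 z.1 : increments R N).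
  apply: measurable_incrementsP => k kN; rewrite /bend /addseq.
  apply: measurable_funD.
    by apply: (measurableT_comp (measurable_coord kN)) => //; exact: measurable_fst.
  apply: measurable_funM => //; apply: measurable_funD => //.
  by rewrite /block; case: (_ <= k < _)%N => //; exact: measurable_snd.
have mS_gen a (b : R) (E : set (increments R N)) : measurable E ->
    measurable [set z : increments R N * R | `|z.2| <= b /\ E (bend D i l a z.2 z.1)].
  move=> mE0; apply: (@measurableI _ (increments R N * R)%type
    [set z : increments R N * R | `|z.2| <= b]
    [set z : increments R N * R | E (bend D i l a z.2 z.1)]).
    rewrite (_ : [set z | _] = snd @^-1` (`[- b, b] : set R)).
      by rewrite -[X in measurable X]setTI; apply: measurable_snd.
    by apply/seteqP; split => z /=; rewrite in_itv /= ler_norml.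
  by rewrite -[X in measurable X]setTI; apply: mbend.
have mS : measurable S by exact: mS_gen.
have mS' : measurable S' by exact: mS_gen.
have C1_gt0 : 0 < C1 by exact: expR_gt0.
have C1_le (a b : R) (e : R) : `|a| <= 9 -> `|b| <= 9 -> e <= 2 * M + B + 18 -> 0 <= e ->
    expR ((`|a| + `|b|) * e) <= C1.
  move=> a9 b9 e9 e0; rewrite ler_expR; apply: ler_pM => //.
  by move: (`|a|) (`|b|) a9 b9 => *; lra.
have MB : 0 <= 2 * M + B by rewrite addr_ge0// mulr_ge0.
have mE_bend a b (E : set (increments R N)) : measurable E ->
    measurable [set x : increments R N | E (bend D i l a b x)].
  by move=> mE0; rewrite -[X in measurable X]setTI; apply: measurable_bend.
have Q_fin (E : set (increments R N)) : measurable E -> Q E = (fine (Q E))%:E.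
  by move=> mE0; rewrite fineK// fin_num_measure.
(* The factor 36 is 4 * (2 * 9) / (2 * 1): the slopes range over [-1, 1] and
   [-9, 9], and the map between them contracts lengths at most by 4. *)
suff : ((2 * 1)%:E * ((C1^-1)%:E * Q (Ev lo hi p K)) <=
    (4 * (2 * 9))%:E * (C1%:E * Q (Ev lo' hi' p' K')))%E.
  rewrite (Q_fin _ mE) (Q_fin _ mE') -!EFinM !lee_fin => h.
  rewrite -(ler_pM2l (_ : 0 < 2 * C1^-1)); last by rewrite mulr_gt0// invr_gt0.
  move: h; rewrite mulr1 mulrA => /le_trans; apply; rewrite le_eqVlt; apply/orP; left.
  by apply/eqP; field; rewrite gt_eqF.
apply: (@sweep _ _ R Q S S' 1 9 4) => //.
- by rewrite mule_ge0// lee_fin invr_ge0 ltW.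
- by rewrite mule_ge0// lee_fin ltW.
- move=> y y1; rewrite (_ : [set x | S (x, y)] = [set x | Ev lo hi p K (bend D i l 0 y x)]); last first.
    by apply/seteqP; split => x //= [].
  have := noise_bend_ge muB D0 Dl ilN noise 0 y mE (fun x => @tubeE lo hi p K _ loM).
  rewrite (Q_fin _ (mE_bend 0 y _ mE)) (Q_fin _ mE) -!EFinM !lee_fin ler_pdivrMl//.
  move=> /le_trans; apply; rewrite ler_wpM2r//; first exact: fine_ge0.
  by apply: C1_le; rewrite ?normr0 ?addr0//; [lra|lra|rewrite addr_ge0].
- move=> y y9; rewrite (_ : [set x | S' (x, y)] = [set x | Ev lo' hi' p' K' (bend D i l eta y x)]); last first.
    by apply/seteqP; split => x //= [].
  apply: (le_trans (noise_bend_le (M := M) muB D0 Dl ilN noise eta y mE'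
    (fun x => @tubeE lo' hi' p' K' _ lo'M))).
  rewrite lee_wpmul2r// lee_fin; apply: C1_le => //; last by lra.
  by rewrite ger0_norm; lra.
- by move=> x y [].
move=> x; have [->|/set0P ne] := eqVneq [set y | S (x, y)] set0.
  by rewrite measure0 mule_ge0.
have mono a y z k : y <= z -> euler mu D (bend D i l a y x) k <= euler mu D (bend D i l a z x) k.
  by move=> yz; apply: bend_mono.
have convS' y z t : S' (x, y) -> S' (x, z) -> y <= t <= z -> S' (x, t).
  move=> [/= y1 Sy] [/= z1 Sz] /andP[yt tz]; split=> /=.
    by move: y1 z1; rewrite !ler_norml => /andP[y1 y2] /andP[z1 z2]; apply/andP; split; lra.
  by apply: (corridor_convex Sy Sz) => k; rewrite !mono.
apply: lebesgue_interval_expand => //.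
- move=> y z [/= y1 Sy] [/= z1 Sz] t /andP[yt tz]; split=> /=.
    by move: y1 z1; rewrite !ler_norml => /andP[y1 y2] /andP[z1 z2]; apply/andP; split; lra.
  by apply: (corridor_convex Sy Sz) => k; rewrite !mono.
- by split=> //; exists (-1) => y [/= + _]; rewrite ler_norml => /andP[].
- by split=> //; exists 1 => y [/= + _]; rewrite ler_norml => /andP[].
- rewrite (_ : [set y | _] = xsection S' x); first exact: measurable_xsection.
  by apply/seteqP; split => y; rewrite /xsection /= inE.
move=> y z Sy Sz yz; have t0 : 0 < tau by rewrite mulr_gt0 ?ltr0n.
(* The slopes w and w' lead to the same end point, and the end point depends
   on each of them in a bi-Lipschitz way. *)
have lift w : S (x, w) -> exists2 w', S' (x, w') &
    euler mu D (bend D i l eta w' x) (i + l + l) = euler mu D (bend D i l 0 w x) (i + l + l).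
  move=> [/= w1 Sw].
  have [w' [w'1 out_eq le_k inner]] := bend_lift i muL D0 L0 l0 LDl w x eta0.
  exists w'; last by rewrite out_eq// leqnn orbT.
  split=> /=; last exact: step Sw out_eq le_k inner.
  by move: w1 w'1; rewrite !ler_norml => /andP[a1 a2] /andP[b1 b2]; apply/andP; split; lra.
have [y' S'y ey] := lift _ Sy; have [z' S'z ez] := lift _ Sz.
have /andP[grow _] := bend_end i muL D0 L0 l0 LDl 0 x (ltW yz).
have [y'z'|/ltW z'y'] := leP y' z'.
  exists y', z'; split=> //; last first.
    by move=> w /=; rewrite in_itv /=; exact: convS'.
  have /andP[_ shrink] := bend_end i muL D0 L0 l0 LDl eta x y'z'.
  rewrite -(ler_pM2r t0) -mulrA; move: shrink grow; rewrite ey ez.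
  by move: (euler _ _ _ _ - _) ((z - y) * tau) ((z' - y') * tau) => *; lra.
have := mono eta _ _ (i + l + l) z'y'; rewrite ey ez -subr_le0 => h.
have : 0 < (z - y) * tau / 2 by rewrite divr_gt0// mulr_gt0// subr_gt0.
by rewrite ltNge (le_trans grow).
Qed.
End Discrete.

(** Every scheme in the tube of size [K1] can be steered to the end point [y] by
a slope of bounded size, and a finite grid of slopes steers it within [rho] of [y].
So the tube is covered by finitely many bent copies of the second event, each of
comparable probability; their number does not depend on the step of the scheme. *)
Lemma corridor_hit (R : realType) (mu : R -> R) (L B M K1 y rho tau : R) :
  (forall x z : R, `|mu x - mu z| <= L * `|x - z|) -> (forall x : R, `|mu x| <= B) ->
  0 <= L -> 0 < tau -> tau <= 1 -> 4 * (L * tau) <= 1 ->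
  0 <= K1 -> 0 < rho -> rho <= 1 -> K1 + 4 * (`|y| + K1) + 1 <= M ->
  exists2 C : R, 0 <= C &
  forall (D : R) (N i l : nat) (Q : probability (increments R N) R),
  0 < D -> D * l%:R = tau -> (0 < l)%N -> (i + l + l)%N = N ->
  white_noise (Num.sqrt D) Q ->
  (Q [set x : increments R N | tube_seq N K1 (euler mu D x)] <=
   C%:E * Q [set x : increments R N | tube_seq N M (euler mu D x) /\ (`|euler mu D x N - y| <= rho)%R])%E.
Proof.
move=> muL muB L0 tau0 tau1 Ltau K10 rho0 rho1 MK1.
pose A := 2 * (`|y| + K1) / tau; pose theta := rho / (2 * tau).
pose J := (Num.truncn (2 * A / theta)).+1.
have A0 : 0 <= A by rewrite divr_ge0 ?(ltW tau0)// mulr_ge0// addr_ge0.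
have theta0 : 0 < theta by rewrite divr_gt0// mulr_gt0.
have M0 : 0 <= M by apply: le_trans MK1; have := normr_ge0 y; lra.
have B0 : 0 <= B by apply: le_trans (muB 0).
pose C0 := expR ((A + theta) * (2 * M + B)).
exists (J%:R * C0); first by rewrite mulr_ge0// expR_ge0.
move=> D N i l Q D0 Dl l0 ilN noise.
have mmu := lip_measurable muL.
have LDl : 4 * (L * D * l%:R) <= 1 by rewrite -mulrA Dl.
have Dl1 : D * l%:R <= 1 by rewrite Dl.
pose Z : set (increments R N) :=
  [set x | tube_seq N M (euler mu D x) /\ `|euler mu D x N - y| <= rho].
pose b (j : nat) := - A + j%:R * theta.
have mtube m := @measurable_tube_seq R mu D N mmu m.
have mZ : measurable Z by exact: measurable_tube_seq_end.
have mZb j : measurable [set x : increments R N | Z (bend D i l 0 (b j) x)].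
  by rewrite -[X in measurable X]setTI; apply: measurable_bend.
have cover : [set x : increments R N | tube_seq N K1 (euler mu D x)] `<=`
    \big[setU/set0]_(j < J) [set x : increments R N | Z (bend D i l 0 (b j) x)].
  move=> x xK1; rewrite -(bigcup_mkord J (fun j => [set x : increments R N | Z (bend D i l 0 (b j) x)])).
  have x0 k : euler mu D (bend D i l 0 0 x) k = euler mu D x k.
    apply: (@euler_ext _ _ _ _ _ 0%N) => // j _; rewrite /bend /addseq /block.
    by case: ifP => _; case: ifP => _; rewrite addr0 mulr0 addr0.
  have [c [xc cA cx]] := bend_hit i muL D0 L0 l0 LDl y x.
  rewrite x0 ilN Dl in xc cA cx.
  have yK1 : `|y - euler mu D x N| <= `|y| + K1.
    by apply: le_trans (ler_normB _ _) _; rewrite lerD2l xK1.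
  have c_le : `|c| <= A by rewrite ler_pdivlMr//; apply: le_trans cA _; rewrite ler_wpM2l.
  have /andP[cA1 cA2] : - A <= c <= A by rewrite -ler_norml.
  pose j := Num.truncn ((c + A) / theta).
  have cA0 : 0 <= (c + A) / theta by rewrite divr_ge0 ?(ltW theta0)//; lra.
  have /andP[j1 j2] := truncn_itv cA0; rewrite -/j in j1 j2.
  have jJ : (j < J)%N.
    rewrite ltnS; apply: le_truncn; rewrite ler_pM2r ?invr_gt0//; lra.
  exists j => //=.
  have bc : b j <= c by rewrite /b; move: j1; rewrite ler_pdivlMr//; lra.
  have cb : c - b j <= theta.
    by move: j2; rewrite ltr_pdivrMr// -natr1 mulrDl mul1r /b; lra.
  have near_c k : (k <= N)%N -> `|euler mu D (bend D i l 0 (b j) x) k -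
      euler mu D (bend D i l 0 c x) k| <= rho.
    rewrite -ilN => kN.
    have /andP[d1 d2] := bend_dist muL D0 L0 l0 LDl x kN bc.
    rewrite distrC ger0_norm//; apply: le_trans d2 _; rewrite Dl.
    apply: (@le_trans _ _ (2 * (theta * tau))).
      by rewrite ler_wpM2l// ler_wpM2r// ltW.
    by rewrite /theta le_eqVlt; apply/orP; left; apply/eqP; field; rewrite gt_eqF.
  split; last by have := near_c N (leqnn N); rewrite xc.
  move=> k kN; have := near_c k kN.
  have := cx k; rewrite kN => /(_ isT); rewrite x0.
  have := xK1 k kN.
  move: (euler mu D (bend D i l 0 (b j) x) k) (euler mu D (bend D i l 0 c x) k) (euler mu D x k).
  move=> u v w; rewrite !ler_norml => /andP[w1 w2] /andP[v1 v2] /andP[u1 u2].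
  by apply/andP; split; lra.
apply: (@le_trans _ _ (\sum_(j < J) Q [set x : increments R N | Z (bend D i l 0 (b j) x)])%E).
  exact: (content_subadditive Q (fun j _ => mZb j) (mtube K1) cover).
apply: (@le_trans _ _ (\sum_(j < J) (C0%:E * Q Z))%E).
  apply: lee_sum => j _.
  have ZM x : Z x -> tube_seq N M (euler mu D x) by case.
  have ilN' : (i + l + l <= N)%N by rewrite ilN.
  apply: (le_trans (noise_bend_le muB D0 Dl1 ilN' noise 0 (b j) mZ ZM)).
  rewrite lee_wpmul2r// lee_fin ler_expR normr0 add0r ler_wpM2r//.
    by rewrite addr_ge0// mulr_ge0.
  have jA : j%:R * theta <= 2 * A + theta.
    have j1 : j%:R <= 2 * A / theta + 1.
      apply: (@le_trans _ _ J%:R); first by rewrite ler_nat ltnW.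
      rewrite /J -natr1 lerD2r truncn_le// divr_ge0 ?(ltW theta0)// mulr_ge0//.
    have := ler_wpM2r (ltW theta0) j1.
    by rewrite mulrDl mul1r divfK ?gt_eqF.
  have : 0 <= j%:R * theta by rewrite mulr_ge0// ltW.
  rewrite /b; move: (j%:R * theta) jA => u uA u0; rewrite ler_norml; apply/andP; split; lra.
by rewrite -ge0_sume_distrl ?lee_fin ?expR_ge0// sumEFin sumr_const card_ord mulr_natl.
Qed.

(** * Truncation of the drift *)

Lemma within_continuous_eps (R : realType) (A : set R) (f : R -> R) :
  {within A, continuous f} <->
  forall x, A x -> forall e, 0 < e -> exists2 r, 0 < r &
    forall y, A y -> `|x - y| < r -> `|f x - f y| < e.
Proof.
rewrite subspace_continuousP; split=> fA x Ax; last first.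
  apply/cvgrPdist_lt => e e0; have [r r0 rP] := fA x Ax e e0.
  rewrite /prop_near1 /nbhs /= /within /=; apply/nbhs_ballP.
  by exists r => // y xy Ay; exact: rP.
move=> e e0; have /cvgrPdist_lt/(_ e e0) := fA x Ax.
rewrite /prop_near1 /nbhs /= /within /= => /nbhs_ballP[r /= r0 rP].
by exists r => // y Ay xy; exact: rP.
Qed.

Lemma within_continuous_norm (R : realType) (A : set R) (f : R -> R) :
  {within A, continuous f} -> {within A, continuous (fun x => `|f x|)}.
Proof.
by move=> cf x; apply: continuous_comp; [exact: cf|exact: norm_continuous].
Qed.

Lemma uniform_continuity01 (R : realType) (f : R -> R) (a b e : R) :
  {within `[a, b], continuous f} -> 0 < e -> exists2 r, 0 < r &
    forall x y, a <= x <= b -> a <= y <= b -> `|x - y| <= r -> `|f x - f y| <= e.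
Proof.
move=> /within_continuous_eps cf e0.
have cpt := @segment_compact R a b.
have /compact_near_coveringP/(_ R 0^'+) := cpt.
move=> /(_ (fun r x => `[a, b]%classic x -> forall y, `[a, b]%classic y -> `|x - y| <= r -> `|f x - f y| <= e)).
case.
  move=> x Ix; have e20 : 0 < e / 2 by rewrite divr_gt0.
  have [r r0 rP] := cf x Ix _ e20.
  have r20 : 0 < r / 2 by rewrite divr_gt0.
  near=> x' d => /= Ix' y Iy x'y.
  have xx' : `|x - x'| < r / 2 by near: x'; exact: (nbhsx_ballx x _ r20).
  have dr : d <= r / 2 by near: d; exact: nbhs_right_le.
  have h1 : `|f x - f x'| < e / 2 by apply: rP => //; lra.
  have h2 : `|f x - f y| < e / 2.
    apply: rP => //; apply: (le_lt_trans (ler_distD x' _ _)); lra.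
  rewrite distrC in h1; apply: (le_trans (ler_distD (f x) _ _)); lra.
move=> r /= r0 rP; exists (r / 2); first by rewrite divr_gt0.
move=> x y xab yab xy.
have rr : `|0 - r / 2| < r by rewrite sub0r normrN gtr0_norm; lra.
by apply: (rP (r / 2) rr) => //=; rewrite ?in_itv//; lra.
Unshelve. all: by end_near. Qed.

(** Over a short interval the integral of a continuous function is its duration
times the value at the left end, up to the oscillation. *)
Lemma drift_increment (R : realType) (f : R -> R) (u v c m : R) : 0 <= u <= v ->
  {within `[0, v], continuous f} ->
  (forall s, u <= s <= v -> `|f s - c| <= m) ->
  `|\int[lebesgue_measure]_(s in `[0, v]) f s - \int[lebesgue_measure]_(s in `[0, u]) f s
     - (v - u) * c| <= (v - u) * m.
Proof.
move=> /andP[u0 uv] cf fcm.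
have intf : lebesgue_measure.-integrable `[0, v] (EFin \o f).
  by apply: continuous_compact_integrable => //; exact: segment_compact.
rewrite Rintegral_itvB ?bnd_simp//.
have muv : fine (lebesgue_measure (`]u, v] : set R)) = v - u.
  rewrite lebesgue_measure_itv /= lte_fin; case: ltP => // vu.
  have -> : u = v by apply/eqP; rewrite eq_le uv vu.
  by rewrite subrr.
have sub : (`]u, v] `<=` `[0, v])%classic.
  by move=> s /=; rewrite !in_itv /= => /andP[us ->]; rewrite (le_trans u0 (ltW us)).
have int_uv : lebesgue_measure.-integrable `]u, v] (EFin \o f).
  by apply: integrableS intf.
have int_c (k : R) : lebesgue_measure.-integrable (`]u, v] : set R) (EFin \o cst k).
  have int_k : lebesgue_measure.-integrable `[0, v] (EFin \o (cst k : R -> R)).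
    apply: continuous_compact_integrable; first exact: segment_compact.
    by apply: continuous_subspaceT => s; exact: cst_continuous.
  by apply: integrableS int_k.
rewrite -muv (mulrC _ c) -Rintegral_cst// -RintegralB//; last exact: (int_c c).
rewrite (mulrC _ m) -Rintegral_cst//.
have int_fc : lebesgue_measure.-integrable `]u, v] (EFin \o (fun s => f s - c)).
  by rewrite (_ : _ \o _ = (EFin \o f) \- (EFin \o cst c))%E//; exact: integrableB.
apply: (le_trans (le_normr_Rintegral _ int_fc)) => //.
apply: le_Rintegral => //; [exact: integrable_norm|exact: (int_c m)|].
by move=> s /=; rewrite in_itv /= => /andP[us sv]; apply: fcm; rewrite (ltW us).
Qed.

Definition clamp (R : realType) (M x : R) : R := Num.max (- M) (Num.min M x).

Lemma clamp_id (R : realType) (M x : R) : `|x| <= M -> clamp M x = x.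
Proof.
by rewrite ler_norml => /andP[x1 x2]; rewrite /clamp (min_idPr x2) (max_idPr x1).
Qed.

Lemma clamp_norm (R : realType) (M x : R) : 0 <= M -> `|clamp M x| <= M.
Proof.
move=> M0; have nMM : - M <= M by lra.
by rewrite ler_norml /clamp le_max lexx /= ge_max nMM ge_min lexx.
Qed.

Lemma clamp_lip (R : realType) (M x y : R) : `|clamp M x - clamp M y| <= `|x - y|.
Proof.
wlog xy : x y / x <= y.
  move=> H; have [xy|/ltW yx] := leP x y; first exact: H.
  by rewrite distrC (distrC x); exact: H.
have [cxy cyx] : clamp M x <= clamp M y /\ clamp M y - clamp M x <= y - x.
  rewrite /clamp.
  case: (leP M x) => Mx; case: (leP M y) => My; case: (leP (- M) M) => h0;
  case: (leP (- M) x) => h1; case: (leP (- M) y) => h2; split; lra.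
rewrite distrC (distrC x) (ger0_norm (_ : 0 <= clamp M y - clamp M x)) ?subr_ge0//.
by rewrite (ger0_norm (_ : 0 <= y - x)) ?subr_ge0.
Qed.

(** A [C^1] drift need not be globally Lipschitz or bounded, but it is so when
frozen outside [[-M, M]]; paths confined to that interval do not see the change. *)
Lemma truncated_drift (R : realType) (mu : R -> R) (M : R) : C1_line mu -> 0 <= M ->
  exists L B, [/\ 0 <= L, forall x y, `|mu (clamp M x) - mu (clamp M y)| <= L * `|x - y|
    & forall x, `|mu (clamp M x)| <= B].
Proof.
move=> [dmu cmu] M0.
have nMM : - M <= M by lra.
have cont_mu : {within `[- M, M], continuous mu}.
  apply: continuous_subspaceT => x; apply: differentiable_continuous.
  exact/derivable1_diffP.
have bounded (h : R -> R) : {within `[- M, M], continuous h} ->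
    exists2 B, 0 <= B & forall x, `|x| <= M -> `|h x| <= B.
  move=> /within_continuous_norm ch'.
  have [c _ hc] := EVT_max nMM ch'; exists `|h c| => // x xM.
  by apply: hc; rewrite in_itv /= -ler_norml.
have [L L0 hL] := bounded _ (continuous_subspaceT cmu).
have [B B0 hB] := bounded _ cont_mu.
have lipM x y : `|x| <= M -> `|y| <= M -> x <= y -> `|mu y - mu x| <= L * (y - x).
  move=> xM yM xy.
  have cxy : {within `[x, y], continuous mu}.
    apply: continuous_subspaceT => z; apply: differentiable_continuous.
    exact/derivable1_diffP.
  have [c cxy' ->] := MVT_segment xy (fun z _ => derivableP (dmu z)) cxy.
  rewrite normrM (ger0_norm (_ : 0 <= y - x)) ?subr_ge0// ler_wpM2r ?subr_ge0//.
  rewrite -derive1E; apply: hL; move: cxy' xM yM; rewrite in_itv /= !ler_norml.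
  by move=> /andP[? ?] /andP[? ?] /andP[? ?]; apply/andP; split; lra.
exists L, B; split=> //; last by move=> x; apply: hB; exact: clamp_norm.
move=> x y; apply: (@le_trans _ _ (L * `|clamp M x - clamp M y|)).
  have [xy|/ltW yx] := leP (clamp M x) (clamp M y).
    rewrite distrC (distrC (clamp M x)) (ger0_norm (_ : 0 <= clamp M y - clamp M x)) ?subr_ge0//.
    by apply: lipM => //; exact: clamp_norm.
  rewrite (ger0_norm (_ : 0 <= clamp M x - clamp M y)) ?subr_ge0//.
  by apply: lipM => //; exact: clamp_norm.
by rewrite ler_wpM2l// clamp_lip.
Qed.

(** * Convergence of the Euler scheme *)

Definition grid_increments (R : realType) (D : R) (W : R -> R) (k : nat) : R :=
  W (D * k.+1%:R) - W (D * k%:R).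

(** Discrete Gronwall inequality.  Because the noise is additive, the driving
terms of [X] and of its scheme cancel, and only the modulus of continuity of [X]
matters, so that the estimate is purely pathwise.  It is enough that one of the two
stays away from the truncation level on the grid: the other one then does so too, as
long as the error is small. *)
Lemma euler_error (R : realType) (mu X W : R -> R) (M L e : R) :
  continuous mu -> 1 <= M -> 0 <= L ->
  (forall x y : R, `|mu (clamp M x) - mu (clamp M y)| <= L * `|x - y|) ->
  {within `[0, +oo[, continuous X} -> X 0 = 0 ->
  (forall t : R, 0 <= t -> X t = \int[lebesgue_measure]_(s in `[0, t]) mu (X s) + W t) ->
  0 < e ->
  exists2 r, 0 < r & forall (D : R) (N : nat), 0 < D -> D <= r -> D * N%:R = 1 ->
    let x := euler (mu \o clamp M) D (grid_increments D W) in
    ((forall k, (k <= N)%N -> `|X (D * k%:R)| <= M - 1) \/ (forall k, (k <= N)%N -> `|x k| <= M - 1)) ->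
    forall k, (k <= N)%N -> `|x k - X (D * k%:R)| <= e.
Proof.
move=> cmu M1 L0 muL cX X0 eqX e0.
have cX01 v : {within `[0, v], continuous X}.
  apply: continuous_subspaceW cX => s /=; rewrite !in_itv /= => /andP[-> _] //.
have cmuX v : {within `[0, v], continuous (mu \o X)}.
  by move=> s; apply: (@continuous_comp (subspace `[0, v]) R R X mu s); [exact: cX01|exact: cmu].
pose e' := Num.min e (1/2).
have e'0 : 0 < e' by rewrite lt_min e0 /=; lra.
have e'e : e' <= e by rewrite ge_min lexx.
have e'1 : e' <= 1/2 by rewrite ge_min lexx orbT.
pose w := Num.min (1/2) (e' / ((L + 1) * expR L)).
have L1 : 0 < (L + 1) * expR L by rewrite mulr_gt0 ?expR_gt0//; lra.
have w0 : 0 < w by rewrite lt_min; apply/andP; split; [lra|exact: divr_gt0].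
have w1 : w <= 1/2 by rewrite ge_min lexx.
have we : expR L * (L * w) <= e'.
  apply: (@le_trans _ _ ((L + 1) * expR L * (e' / ((L + 1) * expR L)))); last first.
    by rewrite mulrCA mulfV ?mulr1// gt_eqF.
  rewrite mulrA (mulrC (expR L)); apply: ler_pM.
  - by rewrite mulr_ge0// expR_ge0.
  - exact: ltW.
  - by rewrite ler_wpM2r ?expR_ge0//; lra.
  - by rewrite ge_min lexx orbT.
have [r r0 rP] := uniform_continuity01 (cX01 1) w0.
exists r => // D N D0 Dr DN x stay.
have D_ge0 := ltW D0; have LD0 : 0 <= L * D by rewrite mulr_ge0.
have kD k : (k <= N)%N -> 0 <= D * k%:R <= 1.
  move=> kN; rewrite mulr_ge0//=; apply: (@le_trans _ _ (D * N%:R)); last by rewrite DN.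
  by rewrite ler_wpM2l// ler_nat.
have powle k : (k <= N)%N -> (1 + L * D) ^+ k * (D * k%:R) * (L * w) <= e'.
  move=> kN; have /andP[k0 k1] := kD k kN; apply: le_trans we.
  rewrite ler_wpM2r ?mulr_ge0 ?(ltW w0)//.
  rewrite -[leRHS]mulr1; apply: ler_pM => //; first by rewrite exprn_ge0// addr_ge0.
  apply: (@le_trans _ _ (expR (L * D) ^+ k)).
    by rewrite lerXn2r ?nnegrE ?expR_ge0 ?addr_ge0// expR_ge1Dx.
  by rewrite -expRM_natl ler_expR mulrC -mulrA ler_piMr.
have claim k : (k <= N)%N -> (forall u, 0 <= u <= D * k%:R -> `|X u| <= M) /\
    `|x k - X (D * k%:R)| <= (1 + L * D) ^+ k * (D * k%:R) * (L * w).
  elim: k => [_|k IH kN].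
    split=> [u|]; last by rewrite /= !mulr0 mul0r X0 subrr normr0.
    rewrite mulr0 => /andP[u1 u2]; have -> : u = 0 by apply/eqP; rewrite eq_le u1 u2.
    by rewrite X0 normr0; lra.
  have [IHM IHe] := IH (ltnW kN).
  have /andP[k0 k1] := kD k (ltnW kN); have /andP[k2 k3] := kD k.+1 kN.
  have DkE : D * k.+1%:R = D * k%:R + D by rewrite -natr1 mulrDr mulr1.
  have near u : D * k%:R <= u <= D * k.+1%:R -> `|X (D * k%:R) - X u| <= w.
    move=> /andP[u1 u2]; apply: rP; [lra|lra|].
    by rewrite ler_norml; apply/andP; split; lra.
  have XM u : D * k%:R <= u <= D * k.+1%:R -> `|X u| <= M.
    move=> u12; have := near u u12; case: stay => /(_ k (ltnW kN)).
      move: (X u) (X (D * k%:R)) => b c.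
      by rewrite !ler_norml => /andP[? ?] /andP[? ?]; apply/andP; split; lra.
    have := le_trans IHe (powle k (ltnW kN)).
    move: (x k) (X u) (X (D * k%:R)) => a b c.
    by rewrite !ler_norml => /andP[? ?] /andP[? ?] /andP[? ?]; apply/andP; split; lra.
  split=> [u /andP[u0 u1]|].
    have [uk|/ltW ku] := leP u (D * k%:R); first by apply: IHM; rewrite u0.
    by apply: XM; rewrite ku.
  set c := mu (clamp M (X (D * k%:R))).
  have muX s : D * k%:R <= s <= D * k.+1%:R -> `|(mu \o X) s - c| <= L * w.
    move=> s12; rewrite /= -{1}(clamp_id (XM s s12)); apply: le_trans (muL _ _) _.
    by rewrite ler_wpM2l// distrC near.
  have Dk01 : 0 <= D * k%:R <= D * k.+1%:R by rewrite k0 DkE lerDl.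
  have := drift_increment Dk01 (cmuX _) muX.
  rewrite (_ : D * k.+1%:R - D * k%:R = D); last by rewrite DkE addrAC subrr add0r.
  have := eqX _ k0; have := eqX _ k2.
  rewrite /= /grid_increments.
  have := muL (x k) (X (D * k%:R)); rewrite -/c.
  set I1 := \int[_]_(s in _) _; set I2 := \int[_]_(s in _) _.
  rewrite -/x.
  move: IHe; set q := (1 + L * D) ^+ k.
  have q1 : 1 <= q by apply: exprn_ege1; rewrite lerDl.
  rewrite exprS -/q => ek muk XkS Xk.
  have xS : x k.+1 = x k + D * mu (clamp M (x k)) + (W (D * k.+1%:R) - W (D * k%:R)) by [].
  move: ek muk; set a := x k - X (D * k%:R); set b := mu (clamp M (x k)) - c => ek muk hI.
  have -> : x k.+1 - X (D * k.+1%:R) = a + D * b - (I1 - I2 - D * c).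
    by rewrite xS XkS /a /b Xk; ring.
  have z0 : 0 <= L * w by rewrite mulr_ge0// ltW.
  apply: (le_trans (ler_normB _ _)); apply: (le_trans (lerD (ler_normD _ _) hI)).
  rewrite normrM (ger0_norm D_ge0).
  apply: (@le_trans _ _ ((1 + L * D) * (q * (D * k%:R) * (L * w)) + D * (L * w))).
    rewrite lerD2r; apply: (@le_trans _ _ ((1 + L * D) * `|a|)).
      have := ler_wpM2l D_ge0 muk; move: (`|a|) (`|b|) => u v; lra.
    by rewrite ler_wpM2l// addr_ge0.
  rewrite DkE; move: (L * w) z0 => z z0.
  have : D * z <= (1 + L * D) * q * (D * z).
    rewrite ler_peMl ?mulr_ge0//; apply: mulr_ege1 => //; by rewrite lerDl.
  move: (1 + L * D) => t; lra.
move=> k kN; have [_ h] := claim k kN; apply: le_trans e'e; apply: le_trans (powle k kN); exact: h.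
Qed.

(** * Passing to the limit in comparisons of probabilities *)

(** A uniform comparison of [E n] with [F n] passes to the limit in this
direction: [P A] is at most the limit of the measures of the decreasing tails
[forall k >= n, E k], and [P Z] is at least the measure of [limsup F]. *)
Lemma le_measure_liminf_limsup d (T : measurableType d) (R : realType) (P : probability T R)
  (C : R) (A Z N0 : set T) (E F : (set T)^nat) : 0 <= C ->
  measurable A -> measurable Z -> measurable N0 -> P N0 = 0%E ->
  (forall n, measurable (E n)) -> (forall n, measurable (F n)) ->
  (forall n, (P (E n) <= C%:E * P (F n))%E) ->
  (forall x, A x -> ~ N0 x -> exists n0, forall n, (n0 <= n)%N -> E n x) ->
  (forall x, ~ N0 x -> (forall n0, exists2 n, (n0 <= n)%N & F n x) -> Z x) ->
  (P A <= C%:E * P Z)%E.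
Proof.
move=> C0 mA mZ mN0 PN0 mE mF EF AE FZ.
pose E' n := \bigcap_(k in [set k | (n <= k)%N]) E k.
pose F' n := \bigcup_(k in [set k | (n <= k)%N]) F k.
have mE' n : measurable (E' n) by apply: bigcap_measurableType => k _.
have mF' n : measurable (F' n) by apply: bigcup_measurable => k _.
have E'F' n : (P (E' n) <= C%:E * P (F' n))%E.
  apply: (@le_trans _ _ (P (E n))).
    by apply: le_measure; rewrite ?inE// => x; apply => /=.
  apply: (le_trans (EF n)); rewrite lee_wpmul2l ?lee_fin//.
  by apply: le_measure; rewrite ?inE// => x Fx; exists n => /=.
have ndE' : nondecreasing_seq E'.
  move=> m n mn; apply/subsetPset => x Ex k /= nk; apply: Ex => /=; exact: leq_trans nk.
have niF' : nonincreasing_seq F'.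
  move=> m n mn; apply/subsetPset => x [k /= nk Fx]; exists k => //=; exact: leq_trans nk.
have mUE' : measurable (\bigcup_n E' n) by exact: bigcup_measurable.
have mIF' : measurable (\bigcap_n F' n) by exact: bigcap_measurableType.
have cE := nondecreasing_cvg_mu (mu := P) mE' mUE' ndE'.
have cF : P (F' n) @[n --> \oo] --> P (\bigcap_n F' n).
  apply: nonincreasing_cvg_mu => //; rewrite (le_lt_trans (probability_le1 _ _)) ?ltry//.
have step : (P (\bigcup_n E' n) <= C%:E * P (\bigcap_n F' n))%E.
  have cCF : (C%:E * P (F' n))%E @[n --> \oo] --> (C%:E * P (\bigcap_n F' n))%E.
    exact: cvgeZl.
  by apply: (lee_cvg_to cE cCF); exact: nearW.
have PN (S : set T) : measurable S -> (P (S `|` N0) <= P S)%E.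
  move=> mS; apply: (@le_trans _ _ (P S + P N0)%E); first exact: measureU2.
  by rewrite PN0 adde0.
apply: (@le_trans _ _ (P (\bigcup_n E' n `|` N0))).
  apply: le_measure; rewrite ?inE//; first exact: measurableU.
  move=> x Ax; have [xN|xN] := pselect (N0 x); [by right|left].
  by have [n0 n0P] := AE x Ax xN; exists n0 => // n /= /n0P.
apply: (le_trans (PN _ mUE')); apply: (le_trans step).
rewrite lee_wpmul2l ?lee_fin//.
apply: (@le_trans _ _ (P (Z `|` N0))); last exact: PN.
apply: le_measure; rewrite ?inE//; first exact: measurableU.
move=> x Fx; have [xN|xN] := pselect (N0 x); [by right|left].
by apply: FZ => // n0; have [n /= n0n Fn] := Fx n0 I; exists n.
Qed.

Lemma le_measure_bigcap (d : measure_display) (T : measurableType d) (R : realType)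
    (m : probability T R) (G : (set T)^nat) (a : \bar R) (C : R) :
  (forall n, measurable (G n)) -> (forall n, G n.+1 `<=` G n) ->
  (forall n, (a <= C%:E * m (G n))%E) -> (a <= C%:E * m (\bigcap_n G n))%E.
Proof.
move=> mG Gdec aG.
have cvgG : m (G n) @[n --> \oo] --> m (\bigcap_n G n).
  apply: nonincreasing_cvg_mu => //; last by apply/nonincreasing_seqP => n; exact/subsetPset.
    by apply: (@le_lt_trans _ _ 1%E); [exact: probability_le1|exact: ltry].
  exact: bigcap_measurableType.
have /cvge_to_ge : (C%:E * m (G n))%E @[n --> \oo] --> (C%:E * m (\bigcap_n G n))%E.
  exact: cvgeZl.
by apply; near=> n; exact: aG.
Unshelve. all: by end_near. Qed.

Lemma exists_law d d' (T : measurableType d) (T' : measurableType d') (R : realType)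
  (P : probability T R) (f : T -> T') : measurable_fun setT f ->
  exists Q : probability T' R, forall E, measurable E -> Q E = P (f @^-1` E).
Proof.
move=> mf; pose X := mfun_Sub (mem_set mf : f \in mfun).
by exists (distribution P X).
Qed.

Section Grid.
Context (R : realType) (d : measure_display) (Omega : measurableType d)
  (P : probability Omega R) (W : R -> Omega -> R).
Hypothesis W_bm : standard_brownian_motion P W.

Lemma measurable_grid_increments (D : R) (N : nat) : 0 <= D ->
  measurable_fun setT (fun om => grid_increments D (W ^~ om) : increments R N).
Proof.
move=> D0; apply: measurable_incrementsP => k _; rewrite /grid_increments.
by apply: measurable_funB; apply: (bm_measurable W_bm); rewrite mulr_ge0.
Qed.

Lemma grid_law (D : R) (N : nat) : 0 < D ->
  exists2 Q : probability (increments R N) R, white_noise (Num.sqrt D) Q &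
    forall E : set (increments R N), measurable E ->
      measurable [set om | E (grid_increments D (W ^~ om))] /\
      Q E = P [set om | E (grid_increments D (W ^~ om))].
Proof.
move=> D0; have mf := @measurable_grid_increments D N (ltW D0).
have [Q QE] := exists_law P mf; exists Q; last first.
  move=> E mE; split; last exact: QE.
  by rewrite -[X in measurable X]setTI; exact: mf.
move=> B mB; rewrite (QE _ (@measurable_box R N B mB)).
have := @bm_increments _ _ _ _ _ W_bm N (fun i => D * i%:R) B.
rewrite mulr0 => /(_ (lexx _)) H; transitivity (P [set om | forall i, (i < N)%N ->
    B i (W (D * i.+1%:R) om - W (D * i%:R) om)]); first by [].
rewrite H; last 2 first.
- by move=> i _; rewrite ltr_pM2l// ltr_nat.
- by move=> i _; exact: mB.
have DE (i : nat) : D * i.+1%:R - D * i%:R = D by rewrite -natr1 mulrDr mulr1 addrAC subrr add0r.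
by apply: eq_bigr => i _; cbv beta; rewrite DE; reflexivity.
Qed.

End Grid.

(** * Comparison of events for the diffusion *)

Definition mesh (R : realType) (q n : nat) : R := (q * 2 ^ n)%:R^-1.

(** The times [k / (q 2^n)] in [[0, 1]].  Conditions on a path are imposed at
these countably many times, which makes them measurable; the windows have length
[2 / q], so that their ends belong to every refinement of the grid. *)
Definition grid_times (R : realType) (q : nat) : set R :=
  [set u | exists n k, (k <= q * 2 ^ n)%N /\ u = mesh R q n * k%:R].

Arguments grid_times R : clear implicits.

Lemma mesh_gt0 (R : realType) q n : (0 < q)%N -> 0 < mesh R q n.
Proof. by move=> q0; rewrite invr_gt0 ltr0n muln_gt0 q0 expn_gt0. Qed.

Lemma meshN (R : realType) q n : (0 < q)%N -> mesh R q n * (q * 2 ^ n)%:R = 1.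
Proof. by move=> q0; rewrite mulVf// pnatr_eq0 -lt0n muln_gt0 q0 expn_gt0. Qed.

Lemma mesh_block (R : realType) q n : (0 < q)%N -> mesh R q n * (2 ^ n)%:R = q%:R^-1.
Proof.
by move=> q0; rewrite /mesh natrM invfM divfK// pnatr_eq0 -lt0n expn_gt0.
Qed.

Lemma mesh_small (R : realType) q (r : R) : (0 < q)%N -> 0 < r ->
  exists n0, forall n, (n0 <= n)%N -> mesh R q n <= r.
Proof.
move=> q0 r0; exists (Num.truncn r^-1) => n n0n.
rewrite /mesh invf_ple ?posrE ?ltr0n ?muln_gt0 ?q0 ?expn_gt0//.
have := truncnS_gt r^-1 => /ltW /le_trans; apply; rewrite ler_nat.
have n2 : (n < 2 ^ n)%N by exact: ltn_expl.
by apply: (leq_trans _ (leq_pmull _ q0)); exact: leq_ltn_trans n2.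
Qed.

Lemma mesh_refine (R : realType) q m n k : (0 < q)%N -> (m <= n)%N ->
  mesh R q m * k%:R = mesh R q n * (k * 2 ^ (n - m))%:R.
Proof.
move=> q0 mn; have e : (2 ^ n = 2 ^ m * 2 ^ (n - m))%N by rewrite -expnD subnKC.
rewrite /mesh !natrM e natrM.
have h j : (2 ^ j)%:R != 0 :> R by rewrite pnatr_eq0 -lt0n expn_gt0.
by field; rewrite !h pnatr_eq0 -lt0n q0.
Qed.

Lemma grid_times01 (R : realType) q u : (0 < q)%N -> grid_times R q u -> 0 <= u <= 1.
Proof.
move=> q0 [n [k [kN ->]]]; have D0 := @mesh_gt0 R q n q0.
rewrite mulr_ge0 ?(ltW D0)//=; apply: (@le_trans _ _ (mesh R q n * (q * 2 ^ n)%:R)).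
  by rewrite ler_wpM2l ?(ltW D0)// ler_nat.
by rewrite meshN.
Qed.

Lemma grid_times_end (R : realType) q : (0 < q)%N -> grid_times R q 1.
Proof.
move=> q0; exists 0%N, q; rewrite expn0 muln1 leqnn; split=> //.
by have := @meshN R q 0 q0; rewrite expn0 muln1 => ->.
Qed.

Section Diffusion.
Context (R : realType) (mu : R -> R) (d : measure_display) (Omega : measurableType d)
  (P : probability Omega R) (W X : R -> Omega -> R).
Hypothesis muC1 : C1_line mu.
Hypothesis W_bm : standard_brownian_motion P W.
Hypothesis X_diff : diffusion mu P W X.

(** The analogue of [corridor] for [X] observed at the times of [D]. *)
Definition diffusion_in (D : set R) (lo hi p : R -> R) (J : set R) : set Omega :=
  [set om | (forall u, D u -> lo u <= X u om <= hi u) /\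
            exists u, [/\ D u, J u & X u om < p u]].

Lemma good_paths : exists N0 : set Omega, [/\ measurable N0, P N0 = 0%E &
  forall om, ~ N0 om -> X 0 om = 0 /\ forall t : R, 0 <= t ->
     X t om = \int[lebesgue_measure]_(s in `[0, t]) mu (X s om) + W t om].
Proof.
have : {ae P, forall om, X 0 om = 0 /\ forall t : R, 0 <= t ->
     X t om = \int[lebesgue_measure]_(s in `[0, t]) mu (X s om) + W t om}.
  by apply: filterS2 (sde_start X_diff) (sde_equation X_diff) => om.
move=> [N0 [mN0 PN0 N0P]]; exists N0; split=> // om omN.
by apply: contrapT => H; apply: omN; apply: N0P.
Qed.

Lemma measurable_diffusion_in q lo hi p J : (0 < q)%N ->
  measurable (diffusion_in (grid_times R q) lo hi p J).
Proof.
move=> q0; have D0 n : 0 < mesh R q n by exact: mesh_gt0.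
pose t n k : R := mesh R q n * k%:R.
have t0 n k : 0 <= t n k by rewrite mulr_ge0// ltW.
have mX n k (A : set R) : measurable A -> measurable [set om | A (X (t n k) om)].
  move=> mA; rewrite -[X in measurable X]setTI.
  exact: (sde_measurable X_diff (t0 n k)).
rewrite (_ : diffusion_in _ _ _ _ _ =
  (\bigcap_n \bigcap_(k in [set k | (k <= q * 2 ^ n)%N])
      [set om | `[lo (t n k), hi (t n k)]%classic (X (t n k) om)])
  `&` (\bigcup_n \bigcup_(k in [set k | (k <= q * 2 ^ n)%N /\ J (t n k)])
      [set om | `]-oo, p (t n k)[%classic (X (t n k) om)])).
  apply: measurableI.
    by apply: bigcap_measurableType => n _; apply: bigcap_measurableType => k _; exact: mX.
  by apply: bigcup_measurable => n _; apply: bigcup_measurable => k _; exact: mX.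
apply/seteqP; split=> om.
  move=> [lh [u [[n [k [kN uE]]] Ju Xu]]]; split.
    by move=> m _ j /= jN; rewrite in_itv /=; apply: lh; exists m, j.
  exists n => //; exists k; first by rewrite /= /t -uE.
  by rewrite /= in_itv /= /t -uE.
move=> [lh [n _ [k /= [kN Jk] Xk]]]; split.
  move=> u [m [j [jN ->]]]; have := lh m I j jN.
  by rewrite /= in_itv.
exists (t n k); split=> //; first by exists n, k.
Qed.

Section Truncated.
Context (M L B : R) (q : nat).
Hypothesis M1 : 1 <= M.
Hypothesis L0 : 0 <= L.
Hypothesis muL : forall x y : R, `|mu (clamp M x) - mu (clamp M y)| <= L * `|x - y|.
Hypothesis muB : forall x : R, `|mu (clamp M x)| <= B.
Hypothesis q0 : (0 < q)%N.
Hypothesis Lq : 4 * L <= q%:R.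

Local Notation N n := (q * 2 ^ n)%N.
Local Notation x_ n om := (euler (mu \o clamp M) (mesh R q n) (grid_increments (mesh R q n) (W ^~ om))).

Let cmu : continuous mu.
Proof.
by move=> x; apply: differentiable_continuous; apply/derivable1_diffP; case: muC1.
Qed.

(** The alternative lets the estimate be used both when a property of [X] is
transferred to the scheme and conversely. *)
Lemma scheme_close om e : X 0 om = 0 ->
  (forall t : R, 0 <= t -> X t om = \int[lebesgue_measure]_(s in `[0, t]) mu (X s om) + W t om) ->
  0 < e -> exists n0, forall n, (n0 <= n)%N ->
    ((forall k, (k <= N n)%N -> `|X (mesh R q n * k%:R) om| <= M - 1) \/
     (forall k, (k <= N n)%N -> `|x_ n om k| <= M - 1)) ->
    forall k, (k <= N n)%N -> `|x_ n om k - X (mesh R q n * k%:R) om| <= e.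
Proof.
move=> X0 eqX e0.
have cX : {within `[0, +oo[, continuous (X ^~ om)} by move: om {X0 eqX}; case: X_diff.
have [r r0 rP] := euler_error cmu M1 L0 muL cX X0 eqX e0.
have [n0 n0P] := mesh_small q0 r0; exists n0 => n n0n stay.
by have := rP (mesh R q n) (N n) (@mesh_gt0 R q n q0) (n0P n n0n) (@meshN R q n q0) stay.
Qed.

Let blockL n : 4 * (L * mesh R q n * (2 ^ n)%:R) <= 1.
Proof.
rewrite -mulrA mesh_block// mulrA ler_pdivrMr ?ltr0n// mul1r.
exact: Lq.
Qed.

(** The limit of [corridor_rise] along the refinements of the grid.  The levels
are loosened by [e] because the scheme is close to the path without being equal to
it: half of the loss occurs in passing from [X] to the scheme and half in coming
back. *)
Lemma diffusion_rise (j : nat) (eta e : R) (lo hi p lo' hi' p' : R -> R) (J : set R) :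
  (j + 2 <= q)%N -> 0 < eta -> eta <= 1 -> 0 < e -> e <= 1 ->
  (forall u : R, 0 <= u <= 1 -> - M + 2 <= lo u /\ hi u <= M - 2) ->
  (forall u : R, 0 <= u <= 1 -> - M + 2 <= lo' u /\ hi' u <= M - 2) ->
  (forall u, lo' u <= lo u \/
     (2 * j%:R + 1) / 2 <= q%:R * u <= (2 * j%:R + 3) / 2 /\ lo' u <= lo u + eta / (32 * q%:R)) ->
  (forall u, hi u <= hi' u) ->
  (forall u, j%:R <= q%:R * u <= j%:R + 2 -> hi u + 4 * eta / q%:R <= hi' u) ->
  (forall u, J u -> p u + 4 * eta / q%:R <= p' u) ->
  (P (diffusion_in (grid_times R q) lo hi p J) <= (36 * expR (18 * (2 * M + B + 18)) ^+ 2)%:E *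
   P (diffusion_in (grid_times R q) (fun u => lo' u - e)%R (fun u => hi' u + e)%R (fun u => p' u + e)%R J))%E.
Proof.
move=> jq eta0 eta1 e0 e1 lohiM lohiM' lo'P hi'P hi'J p'P.
have [N0 [mN0 PN0 good]] := good_paths.
pose s := e / 2; have s0 : 0 < s by rewrite divr_gt0.
have s1 : s <= 1/2 by rewrite /s; lra.
have es : e = 2 * s by rewrite /s mulrC divfK.
pose D n := mesh R q n.
have D0 n : 0 < D n by exact: mesh_gt0.
pose EvX n lo1 hi1 p1 : set Omega := [set om | corridor (N n) (fun k => lo1 (D n * k%:R))
   (fun k => hi1 (D n * k%:R)) (fun k => p1 (D n * k%:R)) [set k | J (D n * k%:R)] (x_ n om)].
pose E n := EvX n (fun u => lo u - s) (fun u => hi u + s) (fun u => p u + s).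
pose F n := EvX n (fun u => lo' u - s) (fun u => hi' u + s) (fun u => p' u + s).
have mmu := lip_measurable muL.
have mEv n lo1 hi1 p1 : measurable (EvX n lo1 hi1 p1).
  have [Q _ QP] := grid_law W_bm (N n) (D0 n).
  exact: (QP _ (@measurable_corridor R _ (D n) (N n) mmu _ _ _ _)).1.
have Dk01 n k : (k <= N n)%N -> 0 <= D n * k%:R <= 1.
  by move=> kN; apply: (grid_times01 q0); exists n, k.
apply: (@le_measure_liminf_limsup _ _ _ P _ _ _ N0 E F) => //.
- exact: measurable_diffusion_in.
- exact: measurable_diffusion_in.
- by move=> n; exact: mEv.
- by move=> n; exact: mEv.
- move=> n; have [Q noise QP] := grid_law W_bm (N n) (D0 n).
  pose i := (j * 2 ^ n)%N; pose l := (2 ^ n)%N.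
  have l0 : (0 < l)%N by rewrite expn_gt0.
  have iE : i = (j * l)%N by [].
  have ilN : (i + l + l <= N n)%N.
    by rewrite iE -mulSnr -mulSnr leq_mul2r -addn2 jq orbT.
  have Dl : D n * l%:R = q%:R^-1 by exact: mesh_block.
  have Dl1 : D n * l%:R <= 1 by rewrite Dl invf_le1 ?ler1n ?ltr0n.
  have M0 : 0 <= M by exact: le_trans ler01 M1.
  have qD k : q%:R * (D n * k%:R) = k%:R / l%:R.
    rewrite mulrA (_ : q%:R * D n = l%:R^-1) ?(mulrC l%:R^-1)//.
    apply: (mulIf (_ : l%:R != 0 :> R)); first by rewrite pnatr_eq0 -lt0n.
    by rewrite mulVf ?pnatr_eq0 -?lt0n// -mulrA Dl mulfV// pnatr_eq0 -lt0n.
  have lR : 0 < l%:R :> R by rewrite ltr0n.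
  have half a k : (a%:R / 2 <= q%:R * (D n * k%:R)) = (a * l <= 2 * k)%N.
    by rewrite qD ler_pdivlMr// mulrAC ler_pdivrMr// -!natrM ler_nat (mulnC 2).
  have half' a k : (q%:R * (D n * k%:R) <= a%:R / 2) = (2 * k <= a * l)%N.
    by rewrite qD ler_pdivrMr// mulrAC ler_pdivlMr// -!natrM ler_nat (mulnC 2).
  have inner k : (2 * j%:R + 1) / 2 <= q%:R * (D n * k%:R) <= (2 * j%:R + 3) / 2 ->
      (2 * i + l <= 2 * k)%N /\ (2 * k <= 2 * i + 3 * l)%N.
    have -> : 2 * j%:R + 1 = (2 * j + 1)%:R :> R by rewrite natrD natrM.
    have -> : 2 * j%:R + 3 = (2 * j + 3)%:R :> R by rewrite natrD natrM.
    rewrite half half' => /andP[h1 h2]; rewrite iE mulnA.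
    by split; [move: h1|move: h2]; rewrite mulnDl ?mul1n.
  have outer k : (i <= k)%N -> (k <= i + l + l)%N -> j%:R <= q%:R * (D n * k%:R) <= j%:R + 2.
    move=> ik kil; rewrite qD ler_pdivlMr// ler_pdivrMr//.
    have -> : j%:R + 2 = (j + 2)%:R :> R by rewrite natrD.
    by rewrite -!natrM !ler_nat -iE ik mulnDl -iE mul2n -addnn addnA.
  have [mE1 QE] := QP _ (@measurable_corridor R _ (D n) (N n) mmu
    (fun k => lo (D n * k%:R) - s) (fun k => hi (D n * k%:R) + s) (fun k => p (D n * k%:R) + s)
    [set k | J (D n * k%:R)]).
  have [mF1 QF] := QP _ (@measurable_corridor R _ (D n) (N n) mmu
    (fun k => lo' (D n * k%:R) - s) (fun k => hi' (D n * k%:R) + s) (fun k => p' (D n * k%:R) + s)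
    [set k | J (D n * k%:R)]).
  rewrite /E /F /EvX -QE -QF.
  apply: (corridor_rise muL muB (D0 n) M0 L0 l0 (blockL n) Dl1 ilN noise eta0 eta1).
  + by move=> k kN; have := lohiM _ (Dk01 n k kN); lra.
  + by move=> k kN; have := lohiM' _ (Dk01 n k kN); lra.
  move=> x y [xlh [k [kN Jk xk]]] out_eq le_k in_rise; split.
    move=> {kN Jk xk}k kN; have /andP[x1 x2] := xlh k kN; have /andP[y1 y2] := le_k k.
    rewrite Dl in y2 in_rise; apply/andP; split.
      have [h|[/inner[h1 h2] h]] := lo'P (D n * k%:R); first by lra.
      have := in_rise k h1 h2; rewrite (_ : eta / (32 * q%:R) = eta / q%:R / 32) in h; first by lra.
      by field; rewrite pnatr_eq0 -lt0n.
    have [/out_eq ->|] := boolP ((k <= i) || (i + l + l <= k))%N.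
      by have := hi'P (D n * k%:R); lra.
    rewrite negb_or -!ltnNge => /andP[/ltnW ik /ltnW kil].
    by have := hi'J _ (outer k ik kil); lra.
  exists k; split=> //; have := p'P _ Jk; have /andP[_ y2] := le_k k; rewrite Dl in y2; lra.
- move=> om [lh [u [[m [k [kN uE]]] Ju Xu]]] omN.
  have [X0 eqX] := good om omN; have [n0 close] := scheme_close X0 eqX s0.
  exists (maxn n0 m) => n; rewrite geq_max => /andP[n0n mn].
  have XM i : (i <= N n)%N -> `|X (D n * i%:R) om| <= M - 1.
    move=> iN; have [h1 h2] := lohiM _ (Dk01 n i iN).
    have /andP[h3 h4] : lo (D n * i%:R) <= X (D n * i%:R) om <= hi (D n * i%:R).
      by apply: lh; exists n, i.
    by rewrite ler_norml; apply/andP; split; lra.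
  have cl := close n n0n (or_introl XM).
  split=> [i iN|].
    have /andP[h3 h4] : lo (D n * i%:R) <= X (D n * i%:R) om <= hi (D n * i%:R).
      by apply: lh; exists n, i.
    have := cl i iN; rewrite ler_norml => /andP[h5 h6].
    by rewrite -/(D n) in h5 h6 *; apply/andP; split; lra.
  have kN' : (k * 2 ^ (n - m) <= N n)%N.
    have -> : (N n = N m * 2 ^ (n - m))%N by rewrite -mulnA -expnD subnKC.
    by rewrite leq_mul2r kN orbT.
  have uE' : u = D n * (k * 2 ^ (n - m))%:R by rewrite uE (mesh_refine _ _ q0 mn).
  exists (k * 2 ^ (n - m))%N; split=> //=; rewrite -uE'//.
  have := cl _ kN'; rewrite -/(D n) -uE' ler_norml => /andP[h5 h6]; lra.
- move=> om omN FZ.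
  have [X0 eqX] := good om omN; have [n0 close] := scheme_close X0 eqX s0.
  have cl n : (n0 <= n)%N -> F n om -> forall k, (k <= N n)%N -> `|x_ n om k - X (D n * k%:R) om| <= s.
    move=> n0n [Flh _]; apply: close => //; right=> k kN.
    have [h1 h2] := lohiM' _ (Dk01 n k kN).
    have /andP[h3 h4] := Flh k kN.
    by rewrite ler_norml; apply/andP; split; lra.
  split.
    move=> u [m [k [kN uE]]]; have [n] := FZ (maxn n0 m).
    rewrite geq_max => /andP[n0n mn] Fn.
    have kN' : (k * 2 ^ (n - m) <= N n)%N.
      have -> : (N n = N m * 2 ^ (n - m))%N by rewrite -mulnA -expnD subnKC.
      by rewrite leq_mul2r kN orbT.
    have uE' : u = D n * (k * 2 ^ (n - m))%:R by rewrite uE (mesh_refine _ _ q0 mn).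
    have := cl n n0n Fn _ kN'; rewrite -uE' ler_norml => /andP[h5 h6].
    have [Flh _] := Fn; have := Flh _ kN'; rewrite -uE' => /andP[h3 h4].
    by apply/andP; split; lra.
  have [n n0n Fn] := FZ n0; have [_ [k [kN Jk xk]]] := Fn.
  exists (D n * k%:R); split=> //; first by exists n, k.
  have := cl n n0n Fn _ kN; rewrite ler_norml => /andP[h5 h6]; lra.
Qed.

End Truncated.

End Diffusion.

(** * The end point of the diffusion has full support *)

Lemma grid_times_pow2 (R : realType) m : grid_times R (2 ^ m) `<=` grid_times R 1.
Proof.
move=> u [n [k [kN ->]]]; exists (m + n)%N, k; rewrite mul1n expnD; split=> //.
by rewrite /mesh mul1n expnD.
Qed.

Section Hit.
Context (R : realType) (mu : R -> R) (d : measure_display) (Omega : measurableType d)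
  (P : probability Omega R) (W X : R -> Omega -> R).
Hypothesis muC1 : C1_line mu.
Hypothesis W_bm : standard_brownian_motion P W.
Hypothesis X_diff : diffusion mu P W X.

Let G (K : nat) : set Omega :=
  diffusion_in X (grid_times R 1) (fun=> - K%:R) (fun=> K%:R) (fun=> K%:R + 1) setT.

Let G_pos : exists K, (0 < P (G K))%E.
Proof.
apply: contrapT => noK.
have mG K : measurable (G K) by exact: (measurable_diffusion_in X_diff).
have G0 K : P (G K) = 0%E.
  apply/eqP; rewrite eq_le measure_ge0 andbT leNgt; apply/negP => PG.
  by apply: noK; exists K.
have cover : \bigcup_K G K = setT.
  apply/seteqP; split=> // om _.
  have cX : {within `[0, +oo[, continuous (X ^~ om)} by move: om; case: X_diff.
  have cX01 : {within `[0, 1], continuous (fun u => `|X u om|)}.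
    apply: within_continuous_norm; apply: continuous_subspaceW cX => s /=.
    by rewrite !in_itv /= => /andP[-> _].
  have [c _ cmax] := EVT_max ler01 cX01.
  exists (Num.truncn `|X c om|).+1 => //.
  have XK u : grid_times R 1 u -> `|X u om| <= (Num.truncn `|X c om|).+1%:R.
    move=> /(grid_times01 (ltn0Sn 0)) u01; apply: le_trans (ltW (truncnS_gt _)).
    by apply: cmax; rewrite in_itv.
  split; first by move=> u Du; rewrite -ler_norml XK.
  exists 0; have D0 : grid_times R 1 0 by exists 0%N, 0%N; rewrite mulr0.
  split=> //; apply: (le_lt_trans (ler_norm _)); apply: (le_lt_trans (XK 0 D0)).
  by rewrite ltrDl.
have : (P (\bigcup_K G K) <= 0)%E.
  rewrite (_ : 0%E = \sum_(n <oo) P (G n))%E; last by rewrite eseries0.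
  by apply: measure_sigma_subadditive => //; exact: bigcup_measurable.
by rewrite cover probability_setT lee_fin ler10.
Qed.

(** The limit of [corridor_hit]: by continuity, [X] stays in some tube with
positive probability, and every tube can be steered to [y]. *)
Lemma diffusion_hit (y rho : R) : 0 < rho -> (0 < P [set om | (`|X 1%R om - y| <= rho)%R])%E.
Proof.
move=> rho0; have [K PK] := G_pos.
pose r := Num.min 1 (rho / 2).
have r0 : 0 < r by rewrite lt_min ltr01 divr_gt0.
have r1 : r <= 1 by rewrite ge_min lexx.
have rr : r + r <= rho.
  have : r <= rho / 2 by rewrite ge_min lexx orbT.
  by lra.
pose K1 : R := K%:R + 1; have K10 : 0 <= K1 by rewrite addr_ge0.
pose M := K1 + 4 * (`|y| + K1) + 2.
have y0 := normr_ge0 y.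
have M1 : 1 <= M by rewrite /M; lra.
have M0 : 0 <= M by lra.
have [L [B [L0 muL muB]]] := truncated_drift muC1 M0.
pose m := (Num.truncn (4 * L)).+1; pose q := (2 ^ m)%N.
have q0 : (0 < q)%N by rewrite expn_gt0.
have mq : (m <= q)%N by rewrite ltnW// ltn_expl.
have q2 : (2 <= q)%N by rewrite /q /m expnS leq_pmulr// expn_gt0.
have Lq : 4 * L <= q%:R.
  by apply: (le_trans (ltW (truncnS_gt _))); rewrite ler_nat.
have tau0 : 0 < q%:R^-1 :> R by rewrite invr_gt0 ltr0n.
have tau1 : q%:R^-1 <= 1 :> R by rewrite invf_le1 ?ler1n ?ltr0n.
have Ltau : 4 * (L * q%:R^-1) <= 1 by rewrite mulrA ler_pdivrMr ?ltr0n// mul1r.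
have MK1 : K1 + 4 * (`|y| + K1) + 1 <= M - 1 by rewrite /M; lra.
have [C C0 hit] := corridor_hit muL muB L0 tau0 tau1 Ltau K10 r0 r1 MK1.
pose D n := mesh R q n; have D0 n : 0 < D n by exact: mesh_gt0.
pose N n := (q * 2 ^ n)%N.
pose x n om := euler (mu \o clamp M) (D n) (grid_increments (D n) (W ^~ om)).
pose E n : set Omega := [set om | tube_seq (N n) K1 (x n om)].
pose F n : set Omega := [set om | tube_seq (N n) (M - 1) (x n om) /\ `|x n om (N n) - y| <= r].
pose S : set Omega := [set om | `|X 1 om - y| <= rho].
have [N0 [mN0 PN0 good]] := good_paths X_diff.
have DN n : D n * (N n)%:R = 1 by exact: meshN.
have mmu := lip_measurable muL.
suff : (P (G K) <= C%:E * P S)%E.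
  move=> h; rewrite lt0e measure_ge0 andbT; apply/eqP => S0.
  by move: (lt_le_trans PK h); rewrite /S S0 mule0 ltxx.
apply: (@le_measure_liminf_limsup _ _ _ P _ _ _ N0 E F) => //.
- exact: (measurable_diffusion_in X_diff).
- rewrite (_ : S = (X 1) @^-1` `[y - rho, y + rho]); last first.
    by apply/seteqP; split=> om; rewrite /S /= in_itv /= ler_norml => /andP[h1 h2]; apply/andP; split; lra.
  by rewrite -[X in measurable X]setTI; apply: (sde_measurable X_diff).
- move=> n; have [Q _ QP] := grid_law W_bm (N n) (D0 n).
  exact: (QP _ (@measurable_tube_seq R _ (D n) (N n) mmu _)).1.
- move=> n; have [Q _ QP] := grid_law W_bm (N n) (D0 n).
  exact: (QP _ (@measurable_tube_seq_end R _ (D n) (N n) mmu _ _ _)).1.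
- move=> n; have [Q noise QP] := grid_law W_bm (N n) (D0 n).
  have [_ QE] := QP _ (@measurable_tube_seq R _ (D n) (N n) mmu K1).
  have [_ QF] := QP _ (@measurable_tube_seq_end R _ (D n) (N n) mmu (M - 1) y r).
  rewrite /E /F -QE -QF; apply: (hit (D n) (N n) ((q - 2) * 2 ^ n)%N (2 ^ n)%N Q) => //.
  + exact: mesh_block.
  + by rewrite expn_gt0.
  + by rewrite -!mulSnr /N -[in RHS](subnK q2) addn2.
- move=> om [lh _] omN; have [X0 eqX] := good om omN.
  have [n0 close] := scheme_close muC1 X_diff M1 L0 muL q0 X0 eqX r0.
  exists n0 => n n0n k kN.
  have XK i : (i <= N n)%N -> `|X (D n * i%:R) om| <= K%:R.
    move=> iN; rewrite ler_norml; apply: lh; apply: (@grid_times_pow2 _ m).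
    by exists n, i.
  have := close n n0n (or_introl _) k kN; rewrite -/(D n) -/(x n om k) => cl.
  have : `|x n om k - X (D n * k%:R) om| <= r.
    by apply: cl => i iN; apply: le_trans (XK i iN) _; have K0 : 0 <= K%:R :> R by []; rewrite /M /K1; lra.
  have := XK k kN; rewrite /K1; move: (x n om k) (X _ om) => u v.
  by rewrite !ler_norml => /andP[h1 h2] /andP[h3 h4]; apply/andP; split; lra.
- move=> om omN FS; have [X0 eqX] := good om omN.
  have [n0 close] := scheme_close muC1 X_diff M1 L0 muL q0 X0 eqX r0.
  have [n n0n [Ftube Fend]] := FS n0.
  have := close n n0n (or_intror Ftube) (N n) (leqnn _).
  rewrite -/(D n) DN; move: Fend; rewrite /S /= -/(x n om (N n)).
  move: (x n om (N n)) (X 1 om) => u v; rewrite !ler_norml => /andP[h1 h2] /andP[h3 h4].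
  by apply/andP; split; lra.
Qed.
End Hit.

(** * Paths and test functions *)

Section PathSpace.
Context (R : realType).
Implicit Types (w v : C01 R).

(** The closed balls of the sup metric, in a form that does not mention the
uniform structure of the space of paths. *)
Definition within_dist (e : R) w v := forall u : unit_interval R, `|w u - v u| <= e.

Lemma near_path w (e : R) : 0 < e -> \forall v \near w, within_dist e w v.
Proof.
move=> e0; apply/(@nbhs_ballP R (C01 R)); exists e => // v wv u.
exact: ltW (wv u).
Qed.

Lemma lipschitz_path_continuous (F : C01 R -> R) (K : R) : 0 <= K ->
  (forall w v e, 0 <= e -> within_dist e w v -> F v <= F w + K * e) -> continuous F.
Proof.
move=> K0 FK w; apply/(@cvgrPdist_le _ _ (C01 R) (nbhs w) (nbhs_filter w)) => e e0.
have K1 : 0 < K + 1 by rewrite ltr_wpDl.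
have d0 : 0 < e / (K + 1) by rewrite divr_gt0.
apply: (@filterS (C01 R) (nbhs w) (nbhs_filter w) _ _ _ (near_path w d0)) => v wv.
have vw : within_dist (e / (K + 1)) v w by move=> u; rewrite distrC.
have h1 := FK _ _ _ (ltW d0) wv; have h2 := FK _ _ _ (ltW d0) vw.
have : K * (e / (K + 1)) <= e.
  by rewrite mulrA ler_pdivrMr// mulrC ler_wpM2l ?(ltW e0)// lerDl.
by rewrite ler_norml => h3; apply/andP; split; lra.
Qed.

Let dist_set (S : set (C01 R)) (c : R) w : set R :=
  [set e | e = c \/ (0 <= e /\ exists2 v, S v & within_dist e w v)].

(** A continuous function between the indicators of [S] and of its
[c]-neighbourhood: the truncated distance to [S], suitably scaled. *)
Lemma bump (S : set (C01 R)) (c : R) : 0 < c -> exists F : C01 R -> R,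
  [/\ continuous F, bounded_fun F, forall w, 0 <= F w <= 1, forall w, S w -> F w = 1 &
    forall w, 0 < F w -> exists2 v, S v & within_dist c w v].
Proof.
move=> c0; pose T w := inf (dist_set S c w).
have lb w : lbound (dist_set S c w) 0 by move=> e [->|[e0 _]] //; exact: ltW.
have Sc w : dist_set S c w c by left.
have T_ge0 w : 0 <= T w by apply: lb_le_inf; [exists c|exact: lb].
have T_le w e : dist_set S c w e -> T w <= e by move=> we; apply: ge_inf => //; exists 0.
have T_le_c w : T w <= c by exact: T_le.
have F01 w : 0 <= 1 - T w / c <= 1.
  by rewrite subr_ge0 ler_pdivrMr// mul1r T_le_c /= gerBl divr_ge0// ltW.
exists (fun w => 1 - T w / c); split=> //.
- apply: (@lipschitz_path_continuous _ c^-1); first by rewrite invr_ge0 ltW.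
  move=> w v r r0 wv.
  suff : T w <= T v + r.
    have ci : 0 < c^-1 by rewrite invr_gt0.
    by move=> h; have := ler_wpM2r (ltW ci) h; rewrite mulrDl (mulrC r); lra.
  rewrite -lerBlDr; apply: lb_le_inf; first by exists c.
  move=> e [->|[e0 [z Sz vz]]]; rewrite lerBlDr.
    by rewrite (le_trans (T_le_c w))// lerDl.
  apply: T_le; right; split; first exact: addr_ge0.
  exists z => // u; apply: le_trans (ler_distD (v u) _ _) _.
  by rewrite addrC lerD.
- exists 1; split=> // M M1 w _; have /andP[h0 h1] := F01 w.
  by rewrite /= ger0_norm// (le_trans h1)// ltW.
- move=> w Sw; have -> : T w = 0.
    apply/eqP; rewrite eq_le T_ge0 andbT; apply: T_le; right; split=> //.
    by exists w => // u; rewrite subrr normr0.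
  by rewrite mul0r subr0.
- move=> w; rewrite subr_gt0 ltr_pdivrMr// mul1r => Tc.
  have [e [eE|[e0 [v Sv wv]]] ec] : exists2 e, dist_set S c w e & e < c.
    have hi : has_inf (dist_set S c w) by split; [exists c|exists 0; exact: lb].
    have cT : 0 < c - T w by rewrite subr_gt0.
    have [e Se eT] := inf_adherent cT hi; exists e => //.
    by rewrite -/(T w) subrKC in eT.
  + by move: ec; rewrite eE ltxx.
  + by exists v => // u; rewrite (le_trans (wv u))// ltW.
Qed.

Lemma continuous_path_measurable (F : C01 R -> R) : continuous F ->
  measurable_fun [set: borelC01 R] (F : borelC01 R -> R).
Proof.
move=> /continuousP cF; apply: (measurability _ (RGenOpens.measurableE R)).
move=> _ [_ [a [b ->]] <-]; rewrite setTI; apply: sub_sigma_algebra.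
by apply: cF; exact: interval_open.
Qed.

(** The value of a path at a real time, extended by [0] outside [[0, 1]]; it
avoids membership proofs for the times at which a path is observed. *)
Definition ev w (u : R) : R := xget 0 [set y | exists2 t : unit_interval R, \val t = u & y = w t].

Lemma ev_val w (t : unit_interval R) : ev w (\val t) = w t.
Proof.
rewrite /ev; case: xgetP => [y _ [t' /val_inj -> ->] //|].
by move=> /(_ (w t)) /=; case; exists t.
Qed.

Lemma evP (u : R) : 0 <= u <= 1 -> exists t : unit_interval R, \val t = u /\ forall w, ev w u = w t.
Proof.
move=> u01; have uI : u \in unit_interval R by rewrite inE /unit_interval /= in_itv.
exists (exist _ u uI); split=> // w.
by rewrite -[in LHS](_ : \val (exist _ u uI : unit_interval R) = u)// ev_val.
Qed.

Lemma ev_dist e w v (u : R) : within_dist e w v -> 0 <= u <= 1 -> `|ev w u - ev v u| <= e.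
Proof. by move=> wv /evP[t [_ evt]]; rewrite !evt. Qed.

Lemma continuous_ev (u : R) : 0 <= u <= 1 -> continuous (fun w => ev w u).
Proof.
move=> u01; apply: (@lipschitz_path_continuous _ 1) => // w v e e0 wv.
by have := ev_dist wv u01; rewrite ler_norml => /andP[h1 h2]; lra.
Qed.

Lemma ev_continuous w : {within unit_interval R, continuous (ev w)}.
Proof.
apply/subspace_sigL_continuousP; rewrite (_ : sigL _ _ = (w : unit_interval R -> R)).
  exact: cts_fun.
by apply/funext => t; rewrite /sigL /= ev_val.
Qed.

Lemma path01E (f : R -> R) : {within unit_interval R, continuous f} ->
  forall u : R, 0 <= u <= 1 -> ev (path01 f : C01 R) u = f u.
Proof.
move=> cf u /evP[t [<- ->]]; rewrite /path01; case: xgetP => [w _ wf|]; first exact: wf.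
move=> /subspace_sigL_continuousP in cf.
by move=> /(_ (mkcts cf : C01 R)) /=; case.
Qed.

(** The analogue of [diffusion_in] for elements of the space of paths. *)
Definition paths_in (D : set R) (lo hi p : R -> R) (J : set R) : set (borelC01 R) :=
  [set w | (forall u, D u -> lo u <= ev w u <= hi u) /\
           exists u, [/\ D u, J u & ev w u < p u]].

Lemma paths_in_near D lo hi p J (c : R) w v : (forall u, D u -> 0 <= u <= 1) ->
  paths_in D lo hi p J w -> within_dist c w v ->
  paths_in D (fun u => lo u - c) (fun u => hi u + c) (fun u => p u + c) J v.
Proof.
move=> D01 [wlh [u [Du Ju wu]]] wv; split.
  move=> t Dt; have := wlh t Dt; have := ev_dist wv (D01 t Dt).
  by rewrite ler_norml => /andP[h1 h2] /andP[h3 h4]; apply/andP; split; lra.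
exists u; split=> //; have := ev_dist wv (D01 u Du).
by rewrite ler_norml => /andP[h1 h2]; lra.
Qed.

Lemma paths_inS D lo hi p J lo' hi' p' J' : (forall u, D u -> lo' u <= lo u) ->
  (forall u, D u -> hi u <= hi' u) -> (forall u, D u -> J u -> J' u /\ p u <= p' u) ->
  paths_in D lo hi p J `<=` paths_in D lo' hi' p' J'.
Proof.
move=> hlo hhi hp w [wlh [u [Du Ju wu]]]; split.
  move=> t Dt; have /andP[h1 h2] := wlh t Dt.
  by rewrite (le_trans (hlo t Dt))// (le_trans h2)// hhi.
by have [J'u pp] := hp u Du Ju; exists u; split=> //; exact: lt_le_trans pp.
Qed.

Lemma measurable_paths_in q lo hi p J : (0 < q)%N -> measurable (paths_in (grid_times R q) lo hi p J).
Proof.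
move=> q0.
have t01 n k : (k <= q * 2 ^ n)%N -> 0 <= mesh R q n * k%:R <= 1.
  by move=> kN; apply: (grid_times01 q0); exists n, k.
pose t n k : R := mesh R q n * k%:R.
have mX n k (A : set R) : (k <= q * 2 ^ n)%N -> measurable A ->
    measurable [set w : borelC01 R | A (ev w (t n k))].
  move=> kN mA; rewrite -[X in measurable X]setTI.
  by apply: (continuous_path_measurable (continuous_ev (t01 n k kN))).
rewrite (_ : paths_in _ _ _ _ _ =
  (\bigcap_n \bigcap_(k in [set k | (k <= q * 2 ^ n)%N])
      [set w : borelC01 R | `[lo (t n k), hi (t n k)]%classic (ev w (t n k))])
  `&` (\bigcup_n \bigcup_(k in [set k | (k <= q * 2 ^ n)%N /\ J (t n k)])
      [set w : borelC01 R | `]-oo, p (t n k)[%classic (ev w (t n k))])).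
  apply: measurableI.
    by apply: bigcap_measurableType => n _; apply: bigcap_measurableType => k kN; exact: mX.
  by apply: bigcup_measurable => n _; apply: bigcup_measurable => k [kN _]; exact: mX.
apply/seteqP; split=> w.
  move=> [lh [u [[n [k [kN uE]]] Ju Xu]]]; split.
    by move=> m _ j /= jN; rewrite in_itv /=; apply: lh; exists m, j.
  exists n => //; exists k; first by rewrite /= /t -uE.
  by rewrite /= in_itv /= /t -uE.
move=> [lh [n _ [k /= [kN Jk] Xk]]]; split.
  move=> u [m [j [jN ->]]]; have := lh m I j jN.
  by rewrite /= in_itv.
exists (t n k); split=> //; first by exists n, k.
Qed.

End PathSpace.

Lemma path01_in (R : realType) (f : R -> R) (D : set R) (lo hi p : R -> R) (J : set R) :
  {within `[0, +oo[, continuous f} -> (forall u, D u -> 0 <= u <= 1) ->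
  paths_in D lo hi p J (path01 f) <->
  (forall u, D u -> lo u <= f u <= hi u) /\ exists u, [/\ D u, J u & f u < p u].
Proof.
move=> cf D01.
have cf1 : {within unit_interval R, continuous f}.
  apply: continuous_subspaceW cf => s; rewrite /unit_interval /=.
  by rewrite !in_itv /= => /andP[-> _].
have E u : D u -> ev (path01 f : C01 R) u = f u by move=> /D01; exact: path01E.
split=> -[lh [u [Du Ju up]]]; split.
- by move=> v Dv; rewrite -(E v Dv); exact: lh.
- by exists u; rewrite -(E u Du).
- by move=> v Dv; rewrite (E v Dv); exact: lh.
- by exists u; rewrite (E u Du).
Qed.

(** * From the diffusion to its bridge *)

Section TestFunctions.
Context (R : realType) (nu : {measure set (borelC01 R) -> \bar R}).
Context (F : C01 R -> R) (S L : set (borelC01 R)).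
Hypothesis nu1 : nu setT = 1%E.
Hypothesis cF : continuous F.
Hypothesis F01 : forall w, 0 <= F w <= 1.
Hypothesis mS : measurable S.
Hypothesis mL : measurable L.

Let F0 w : 0 <= F w. Proof. by have /andP[] := F01 w. Qed.

Let mF : measurable_fun L (fun w : borelC01 R => (F w)%:E).
Proof.
apply/measurable_EFinP/measurable_funTS; exact: continuous_path_measurable.
Qed.

Let int_indic : (\int[nu]_(w in L) (\1_S w)%:E = nu (S `&` L))%E.
Proof. by rewrite integral_indic. Qed.

Let fin (A : set (borelC01 R)) : measurable A -> nu A \is a fin_num.
Proof.
move=> mA; rewrite ge0_fin_numE//; apply: (@le_lt_trans _ _ 1%E); last exact: ltry.
by rewrite -nu1; apply: le_measure; rewrite ?inE.
Qed.

Let finF : (\int[nu]_(w in L) (F w)%:E)%E \is a fin_num.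
Proof.
rewrite ge0_fin_numE; last by apply: integral_ge0 => w _; rewrite lee_fin.
apply: (@le_lt_trans _ _ (\int[nu]_(w in L) 1)%E).
  apply: ge0_le_integral => //; first by move=> w _; rewrite lee_fin.
  by move=> w _; rewrite lee_fin; have /andP[] := F01 w.
by rewrite integral_cst// mul1e -ge0_fin_numE// fin.
Qed.

Lemma path_integral_ge : (forall w, S w -> F w = 1) ->
  fine (nu (S `&` L)) <= \int[nu]_(w in L) F w.
Proof.
move=> SF; rewrite /Rintegral; apply: fine_le => //; first exact/fin/measurableI.
rewrite -int_indic; apply: ge0_le_integral => //.
- by apply/measurable_EFinP; apply: measurable_indic.
- move=> w _; rewrite lee_fin indicE.
  by have [/set_mem/SF ->|_] := boolP (w \in S).
Qed.

Lemma path_integral_le : (forall w, 0 < F w -> S w) ->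
  \int[nu]_(w in L) F w <= fine (nu (S `&` L)).
Proof.
move=> FS; rewrite /Rintegral; apply: fine_le => //; first exact/fin/measurableI.
rewrite -int_indic; apply: ge0_le_integral => //.
- by move=> w _; rewrite lee_fin.
- by apply/measurable_EFinP; apply: measurable_indic.
- move=> w _; rewrite lee_fin indicE.
  have [_|/negP wS] := boolP (w \in S); first by have /andP[] := F01 w.
  by rewrite leNgt; apply/negP => /FS/mem_set.
Qed.

End TestFunctions.

(** Let [f] be a bump between [K] and [SA], and [g] a bump between [SZ] and [K'].
On the event [|X 1 - b| <= rho] the conditional expectations of [f] and of [g] given
[X 1] are close to their values under the bridge, by weak continuity of the regular
conditional law at [b]; integrating over this event, whose probability is positive,
turns the hypothesis into a comparison for the bridge. *)
Lemma bridge_le (R : realType) (d : measure_display) (Omega : measurableType d)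
    (P : probability Omega R) (X : R -> Omega -> R) (b : R) (nu : probability (borelC01 R) R)
    (SA SZ K K' : set (borelC01 R)) (C c rho0 : R) :
  bridge_law P X b nu -> measurable_fun setT (X 1) ->
  (forall rho : R, 0 < rho -> (0 < P [set om | (`|X 1%R om - b| <= rho)%R])%E) ->
  measurable SA -> measurable SZ -> measurable K -> measurable K' ->
  0 <= C -> 0 < c -> 0 < rho0 ->
  (forall w v, K w -> within_dist c w v -> SA v) ->
  (forall w v, SZ w -> within_dist c w v -> K' v) ->
  (forall rho : R, 0 < rho -> rho <= rho0 ->
    (P [set om | SA (path01 (X ^~ om)) /\ (`|X 1%R om - b| <= rho)%R] <=
     C%:E * P [set om | SZ (path01 (X ^~ om)) /\ (`|X 1%R om - b| <= rho)%R])%E) ->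
  (nu K <= C%:E * nu K')%E.
Proof.
move=> [kappa [disint wcont nuE]] mX1 Ppos mSA mSZ mK mK' C0 c0 rho00 KSA SZK' hyp.
rewrite !nuE//.
have k1 y : kappa y setT = 1%E by exact: prob_kernel.
have [f [cf bf f01 fK fSA]] := bump K c0.
have [g [cg bg g01 gSZ gK']] := bump SZ c0.
have kfin y (A : set (borelC01 R)) : measurable A -> kappa y A = (fine (kappa y A))%:E.
  move=> mA; rewrite fineK// ge0_fin_numE//; apply: (@le_lt_trans _ _ 1%E); last exact: ltry.
  by rewrite -(k1 y); apply: le_measure; rewrite ?inE.
have fSA' w : 0 < f w -> SA w by move=> /fSA[v Kv wv]; apply: (KSA v) => // u; rewrite distrC.
have gK'' w : 0 < g w -> K' w by move=> /gK'[v Kv wv]; apply: (SZK' v) => // u; rewrite distrC.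
have fK_le : fine (kappa b K) <= \int[kappa b]_w f w.
  by have := @path_integral_ge R (kappa b) f K setT (k1 b) cf f01 mK measurableT fK; rewrite setIT.
have gK_le : \int[kappa b]_w g w <= fine (kappa b K').
  by have := @path_integral_le R (kappa b) g K' setT (k1 b) cg g01 mK' measurableT gK''; rewrite setIT.
have f_le y : \int[kappa y]_w f w <= fine (kappa y SA).
  by have := @path_integral_le R (kappa y) f SA setT (k1 y) cf f01 mSA measurableT fSA'; rewrite setIT.
have g_ge y : fine (kappa y SZ) <= \int[kappa y]_w g w.
  by have := @path_integral_ge R (kappa y) g SZ setT (k1 y) cg g01 mSZ measurableT gSZ; rewrite setIT.
have key e : 0 < e -> \int[kappa b]_w f w - e <= C * (\int[kappa b]_w g w + e).
  move=> e0.
  have /cvgrPdist_lt/(_ e e0) := wcont f cf bf.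
  have /cvgrPdist_lt/(_ e e0) := wcont g cg bg.
  move=> /nbhs_ballP[r1 /= r10 near_g] /nbhs_ballP[r2 /= r20 near_f].
  pose rho := Num.min rho0 (Num.min (r1 / 2) (r2 / 2)).
  have rho_gt0 : 0 < rho by rewrite !lt_min rho00 !divr_gt0.
  have rho1 : rho < r1.
    have : rho <= r1 / 2 by rewrite !ge_min lexx orbT.
    by lra.
  have rho2 : rho < r2.
    have : rho <= r2 / 2 by rewrite !ge_min lexx !orbT.
    by lra.
  pose B : set R := `[b - rho, b + rho]%classic.
  have BP y : B y <-> `|y - b| <= rho.
    by rewrite /B /= in_itv /= ler_norml; split=> /andP[h1 h2]; apply/andP; split; lra.
  have mB : measurable B by exact: measurable_itv.
  have mXB : measurable (X 1 @^-1` B).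
    by rewrite -[X in measurable X]setTI; exact: mX1.
  have setE (A : set (borelC01 R)) :
      [set om | A (path01 (X ^~ om)) /\ `|X 1 om - b| <= rho] = [set om | A (path01 (X ^~ om)) /\ B (X 1 om)].
    by apply/seteqP; split=> om /= [h1 h2]; split=> //; apply/BP.
  have PB : P (X 1 @^-1` B) = (fine (P (X 1 @^-1` B)))%:E by rewrite fineK// fin_num_measure.
  have PB0 : 0 < fine (P (X 1 @^-1` B)).
    rewrite -lte_fin -PB (_ : X 1 @^-1` B = [set om | `|X 1 om - b| <= rho]); first exact: Ppos.
    by apply/seteqP; split=> om /BP.
  have := hyp rho rho_gt0 (_ : rho <= rho0); rewrite ge_min lexx => /(_ isT).
  rewrite !setE !disint//.
  have mk (A : set (borelC01 R)) : measurable A -> measurable_fun setT (fun om => kappa (X 1 om) A).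
    by move=> mA; apply: (measurableT_comp (measurable_kernel kappa A mA)).
  have lo : (((\int[kappa b]_w f w - e) * fine (P (X 1%R @^-1` B)))%:E <=
      \int[P]_(om in X 1%R @^-1` B) kappa (X 1%R om) SA)%E.
    have [neg|pos] := leP (\int[kappa b]_w f w - e) 0.
      apply: (@le_trans _ _ 0%E); last exact: integral_ge0.
      by rewrite lee_fin mulr_le0_ge0// ltW.
    rewrite EFinM -PB -integral_cst//; apply: ge0_le_integral => //.
    - by move=> om _; rewrite lee_fin ltW.
    - exact/measurable_funTS/mk.
    move=> om /BP XB; rewrite (kfin _ _ mSA) lee_fin; apply: le_trans (f_le _).
    have := near_f (X 1 om) (_ : ball b r2 (X 1 om)).
    rewrite /ball /= distrC => /(_ (le_lt_trans XB rho2)).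
    by rewrite ltr_norml => /andP[_]; lra.
  have hi : (\int[P]_(om in X 1%R @^-1` B) kappa (X 1%R om) SZ <=
      ((\int[kappa b]_w g w + e) * fine (P (X 1%R @^-1` B)))%:E)%E.
    have g0 : 0 <= \int[kappa b]_w g w by apply: Rintegral_ge0 => w _; have /andP[] := g01 w.
    rewrite EFinM -PB -integral_cst//; apply: ge0_le_integral => //.
    - exact/measurable_funTS/mk.
    move=> om /BP XB; rewrite (kfin _ _ mSZ) lee_fin; apply: (le_trans (g_ge _)).
    have := near_g (X 1 om) (_ : ball b r1 (X 1 om)).
    rewrite /ball /= distrC => /(_ (le_lt_trans XB rho1)).
    by rewrite ltr_norml => /andP[+ _]; lra.
  move=> h; have := le_trans lo (le_trans h (lee_wpmul2l _ hi)).
  rewrite lee_fin => /(_ C0); rewrite -EFinM lee_fin mulrA ler_pM2r//.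
rewrite (kfin _ _ mK) (kfin _ _ mK') -EFinM lee_fin.
apply: (le_trans fK_le); apply: (@le_trans _ _ (C * \int[kappa b]_w g w)); last by rewrite ler_wpM2l.
apply/ler_addgt0Pr => e e0.
have C1 : 0 < 1 + C by rewrite ltr_pwDl.
have := key _ (divr_gt0 e0 C1); rewrite -lerBlDr.
have : e / (1 + C) * (1 + C) = e by rewrite divfK// gt_eqF.
by lra.
Qed.

Section BridgeRise.
Context (R : realType) (mu : R -> R) (d : measure_display) (Omega : measurableType d)
  (P : probability Omega R) (W X : R -> Omega -> R).
Hypothesis muC1 : C1_line mu.
Hypothesis W_bm : standard_brownian_motion P W.
Hypothesis X_diff : diffusion mu P W X.
Context (M L B : R) (q j : nat) (eta : R).
Hypothesis M1 : 1 <= M.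
Hypothesis L0 : 0 <= L.
Hypothesis muL : forall x y : R, `|mu (clamp M x) - mu (clamp M y)| <= L * `|x - y|.
Hypothesis muB : forall x : R, `|mu (clamp M x)| <= B.
Hypothesis q0 : (0 < q)%N.
Hypothesis Lq : 4 * L <= q%:R.
Hypothesis jq : (j + 3 <= q)%N.
Hypothesis eta0 : 0 < eta.
Hypothesis eta1 : eta <= 1.

Local Notation C := (36 * expR (18 * (2 * M + B + 18)) ^+ 2).
Local Notation grid := (grid_times R q).
Local Notation endpoint b rho := [set om | (`|X 1%R om - b| <= rho)%R].

Let measurable_endpoint (b rho : R) : measurable (endpoint b rho).
Proof.
rewrite (_ : endpoint b rho = (X 1) @^-1` `[b - rho, b + rho]); last first.
  by apply/seteqP; split=> om; rewrite /= in_itv /= ler_norml => /andP[h1 h2]; apply/andP; split; lra.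
by rewrite -[X in measurable X]setTI; apply: (sde_measurable X_diff).
Qed.

(** The end point can be required to be the same on both sides, because the
bump vanishes after the window: the constraint is a corridor condition at
time [1].  It suffers the loss in the levels of [diffusion_rise] too, and this loss
is sent to zero separately from [e]. *)
Lemma diffusion_rise_end (b rho e : R) (lo hi p lo' hi' p' : R -> R) (J : set R) :
  0 < e -> e <= 1 ->
  (forall u : R, 0 <= u <= 1 -> - M + 2 <= lo u /\ hi u <= M - 2) ->
  (forall u : R, 0 <= u <= 1 -> - M + 2 <= lo' u /\ hi' u <= M - 2) ->
  (forall u, lo' u <= lo u \/
     (2 * j%:R + 1) / 2 <= q%:R * u <= (2 * j%:R + 3) / 2 /\ lo' u <= lo u + eta / (32 * q%:R)) ->
  (forall u, hi u <= hi' u) ->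
  (forall u, j%:R <= q%:R * u <= j%:R + 2 -> hi u + 4 * eta / q%:R <= hi' u) ->
  (forall u, J u -> p u + 4 * eta / q%:R <= p' u) ->
  (P (diffusion_in X grid lo hi p J `&` endpoint b rho) <= C%:E *
   P (diffusion_in X grid (fun u => lo' u - e)%R (fun u => hi' u + e)%R (fun u => p' u + e)%R J
      `&` endpoint b rho))%E.
Proof.
move=> e0 e1 lohiM lohiM' lo'P hi'P hi'J p'P.
have G1 := @grid_times_end R q q0.
have jqR : j%:R + 3 <= q%:R :> R by rewrite -natrD ler_nat.
pose r n : R := e / n.+1%:R.
have r0 n : 0 < r n by rewrite divr_gt0.
have re n : r n <= e by rewrite ler_pdivrMr// ler_peMr ?ler1n// ltW.
have rdec n : r n.+1 <= r n by rewrite ler_pM2l// lef_pV2 ?posrE// ler_nat.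
pose Z : set Omega := diffusion_in X grid (fun u => lo' u - e)%R (fun u => hi' u + e)%R (fun u => p' u + e)%R J.
have mZ : measurable Z by exact: (measurable_diffusion_in X_diff).
pose G n := Z `&` endpoint b (rho + r n).
have GE : \bigcap_n G n = Z `&` endpoint b rho.
  apply/seteqP; split=> om; last first.
    move=> [ZX /= h] n _; split=> //=; apply: (le_trans h).
    by rewrite lerDl ltW.
  move=> h; split; first by have [] := h 0%N I.
  apply/ler_addgt0Pr => s s0.
  have [n n1] : exists n, r n <= s.
    exists (Num.truncn (e / s)); rewrite /r ler_pdivrMr// mulrC -ler_pdivrMr//.
    by rewrite ltW// truncnS_gt.
  by have [_ /= h1] := h n I; apply: (le_trans h1); rewrite lerD2l.
rewrite -GE; apply: le_measure_bigcap.
- by move=> n; apply: measurableI.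
- by move=> n om [ZX /= h]; split=> //=; apply: (le_trans h); rewrite lerD2l.
move=> n.
(* The lower and upper bounds at time 1 are not moved by the bump, since
   j + 3 <= q. *)
pose lo1 u := if u == 1 then Num.max (lo u) (b - rho) else lo u.
pose hi1 u := if u == 1 then Num.min (hi u) (b + rho) else hi u.
pose lo2 u := if u == 1 then Num.max (lo' u) (b - rho) else lo' u.
pose hi2 u := if u == 1 then Num.min (hi' u) (b + rho) else hi' u.
have mX := @measurable_diffusion_in R mu d Omega P W X X_diff q.
apply: (@le_trans _ _ (P (diffusion_in X grid lo1 hi1 p J))).
  apply: le_measure; rewrite ?inE; [by apply: measurableI; [exact: mX|]|exact: mX|].
  move=> om [[lh ex] /= h]; split=> // u Du; rewrite /lo1 /hi1; have := lh u Du.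
  case: eqP => [->|//]; move: h; rewrite ler_norml ge_max le_min => /andP[h1 h2] /andP[-> ->] /=.
  by apply/andP; split; lra.
have rn1 : r n <= 1 by exact: le_trans (re n) e1.
apply: (@le_trans _ _ (C%:E * P (diffusion_in X grid (fun u => lo2 u - r n)%R (fun u => hi2 u + r n)%R
                                 (fun u => p' u + r n)%R J))%E).
  apply: (@diffusion_rise R mu d Omega P W X muC1 W_bm X_diff M L B q M1 L0 muL muB q0 Lq j eta (r n)) => //.
  - by rewrite (leq_trans _ jq)// leq_add2l.
  - move=> u u01; have [h1 h2] := lohiM u u01; rewrite /lo1 /hi1.
    by case: ifP => _; rewrite ?le_max ?ge_min ?h1 ?h2.
  - move=> u u01; have [h1 h2] := lohiM' u u01; rewrite /lo2 /hi2.
    by case: ifP => _; rewrite ?le_max ?ge_min ?h1 ?h2.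
  - move=> u; rewrite /lo1 /lo2; case: eqP => [->|_]; last exact: lo'P.
    left; have [h|[+ _]] := lo'P 1; last by rewrite mulr1 => /andP[h1 h2]; lra.
    by rewrite ge_max !le_max lexx h orbT.
  - move=> u; rewrite /hi1 /hi2; case: eqP => [->|_ //].
    by rewrite le_min !ge_min lexx hi'P orbT.
  - move=> u uj; rewrite /hi1 /hi2; case: eqP => [uE|_]; last exact: hi'J.
    by move: uj; rewrite uE mulr1 => /andP[h1 h2]; lra.
apply: lee_wpmul2l; first by rewrite lee_fin mulr_ge0// exprn_ge0// expR_ge0.
apply: le_measure; rewrite ?inE; [exact: mX|by apply: measurableI|].
have ren := re n; have r0n := r0 n.
move=> om [lh [u [Du Ju up]]]; split; first split.
- move=> v Dv; have := lh v Dv; rewrite /lo2 /hi2; case: ifP => _ /andP[h1 h2].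
    have g1 : lo' v <= Num.max (lo' v) (b - rho) by rewrite le_max lexx.
    have g2 : Num.min (hi' v) (b + rho) <= hi' v by rewrite ge_min lexx.
    by apply/andP; split; lra.
  by apply/andP; split; lra.
- by exists u; split=> //; lra.
- have := lh 1 G1; rewrite /lo2 /hi2 eqxx /= => /andP[h1 h2].
  have g1 : b - rho <= Num.max (lo' 1) (b - rho) by rewrite le_max lexx orbT.
  have g2 : Num.min (hi' 1) (b + rho) <= b + rho by rewrite ge_min lexx orbT.
  by rewrite ler_norml; apply/andP; split; lra.
Qed.

(** The neighbourhoods in [bridge_le] have radius [r n], and all losses are
proportional to it, so they disappear as [n] grows, except that the strict
inequality with [p'] becomes a weak one; the slack [s] restores it. *)
Lemma bridge_rise (b : R) (nu : probability (borelC01 R) R) (s : R)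
    (lo hi p lo' hi' p' : R -> R) (J : set R) :
  bridge_law P X b nu -> 0 < s ->
  (forall u : R, 0 <= u <= 1 -> - M + 3 <= lo u /\ hi u <= M - 3) ->
  (forall u : R, 0 <= u <= 1 -> - M + 3 <= lo' u /\ hi' u <= M - 3) ->
  (forall u, lo' u <= lo u \/
     (2 * j%:R + 1) / 2 <= q%:R * u <= (2 * j%:R + 3) / 2 /\ lo' u <= lo u + eta / (32 * q%:R)) ->
  (forall u, hi u <= hi' u) ->
  (forall u, j%:R <= q%:R * u <= j%:R + 2 -> hi u + 4 * eta / q%:R <= hi' u) ->
  (forall u, J u -> p u + 4 * eta / q%:R + s <= p' u) ->
  (nu (paths_in grid lo hi p J) <= C%:E * nu (paths_in grid lo' hi' p' J))%E.
Proof.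
move=> nu_b s0 lohiM lohiM' lo'P hi'P hi'J p'P.
have D01 u : grid u -> 0 <= u <= 1 by exact: grid_times01.
have cX om : {within `[0, +oo[, continuous (X ^~ om)} by move: om; case: X_diff.
have C0 : 0 <= C by rewrite mulr_ge0// exprn_ge0// expR_ge0.
pose s1 := Num.min s 1.
have s10 : 0 < s1 by rewrite lt_min s0 ltr01.
have s1s : s1 <= s by rewrite ge_min lexx.
have s11 : s1 <= 1 by rewrite ge_min lexx orbT.
pose r n : R := s1 / (3 * n.+1%:R).
have r0 n : 0 < r n by rewrite divr_gt0// mulr_gt0.
have rE n : 3 * r n = s1 / n.+1%:R by rewrite /r invfM; field; rewrite addrC natr1 pnatr_eq0.
have rs n : 3 * r n <= s1 by rewrite rE ler_pdivrMr// ler_peMr ?ler1n// ltW.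
have rdec n : r n.+1 <= r n.
  by rewrite ler_pM2l// lef_pV2 ?posrE ?mulr_gt0// ler_pM2l// ler_nat.
pose p1 u := p' u - s1.
pose K n := paths_in grid (fun u => lo' u - 3 * r n) (fun u => hi' u + 3 * r n) (fun u => p1 u + 3 * r n) J.
apply: (@le_trans _ _ (C%:E * nu (\bigcap_n K n))%E); last first.
  apply: lee_wpmul2l => //; apply: le_measure; rewrite ?inE.
  - by apply: bigcap_measurableType => n _; exact: measurable_paths_in.
  - exact: measurable_paths_in.
  move=> w Kw; split.
    move=> u Du; apply/andP; split; apply/ler_addgt0Pr => e e0;
      have [n n1] : exists n, 3 * r n <= e;
      try (exists (Num.truncn (s1 / e)); rewrite rE;
           by rewrite ler_pdivrMr// mulrC -ler_pdivrMr// ltW// truncnS_gt);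
      have [lh _] := Kw n I; have /andP[h1 h2] := lh u Du; lra.
  have [_ [u [Du Ju up]]] := Kw 0%N I; exists u; split=> //.
  by have := rs 0%N; rewrite /p1 in up; lra.
apply: le_measure_bigcap.
- by move=> n; exact: measurable_paths_in.
- move=> n; have := rdec n => h; apply: paths_inS => u Du; [lra|lra|].
  by move=> Ju; split=> //; lra.
move=> n; have rn := rs n; have r0n := r0 n.
have XE lo1 hi1 p2 rho :
    [set om | paths_in grid lo1 hi1 p2 J (path01 (X ^~ om)) /\ `|X 1 om - b| <= rho] =
    diffusion_in X grid lo1 hi1 p2 J `&` endpoint b rho.
  apply/seteqP; split=> om [h1 h2]; split=> //.
    by move: h1; rewrite path01_in.
  by rewrite path01_in.
apply: (@bridge_le R d Omega P X b nu
  (paths_in grid (fun u => lo u - r n) (fun u => hi u + r n) (fun u => p u + r n) J)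
  (paths_in grid (fun u => lo' u - r n - r n) (fun u => hi' u + r n + r n) (fun u => p1 u + r n + r n) J)
  _ _ C (r n) 1 nu_b) => //; try exact: measurable_paths_in.
- exact: (sde_measurable X_diff).
- by move=> rho rho0; exact: (diffusion_hit muC1 W_bm X_diff).
- by move=> w v Kw wv; exact: paths_in_near wv.
- move=> w v Kw wv; have := paths_in_near D01 Kw wv; apply: paths_inS => u Du; [lra|lra|].
  by move=> Ju; split=> //; lra.
move=> rho rho0 _; rewrite !XE; apply: diffusion_rise_end => //.
- by lra.
- by move=> u u01; have [h1 h2] := lohiM u u01; split; lra.
- by move=> u u01; have [h1 h2] := lohiM' u u01; split; lra.
- by move=> u; have [h|[h1 h2]] := lo'P u; [left|right; split=> //]; lra.
- by move=> u; have := hi'P u; lra.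
- by move=> u uj; have := hi'J u uj; lra.
- by move=> u Ju; have := p'P u Ju; rewrite /p1; lra.
Qed.

End BridgeRise.

(** * From the bridge to the house-moving *)

Lemma grid_times_dense (R : realType) q (u r : R) : (0 < q)%N -> 0 <= u <= 1 -> 0 < r ->
  exists v, [/\ grid_times R q v, v <= u & u < v + r].
Proof.
move=> q0 /andP[u0 u1] r0; have r20 : 0 < r / 2 by rewrite divr_gt0.
have [n /(_ n (leqnn _)) Dr] := mesh_small q0 r20.
have D0 := @mesh_gt0 R q n q0; pose D := mesh R q n.
have uD : 0 <= u / D by rewrite divr_ge0// ltW.
have /andP[h1 h2] := truncn_itv uD.
exists (D * (Num.truncn (u / D))%:R); split.
- exists n, (Num.truncn (u / D)); split=> //.
  rewrite -(@ler_nat R); apply: (le_trans h1).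
  by rewrite ler_pdivrMr// mulrC meshN.
- by rewrite mulrC -ler_pdivlMr.
- move: h2; rewrite ltr_pdivrMr// -natr1 mulrDl mul1r mulrC => h2.
  by apply: (lt_le_trans h2); rewrite lerD2l; rewrite /D; lra.
Qed.

Lemma grid_times_right (R : realType) q (u r : R) : (0 < q)%N -> 0 <= u -> u < 1 -> 0 < r ->
  exists v, [/\ grid_times R q v, u < v & v < u + r].
Proof.
move=> q0 u0 u1 r0; pose s := Num.min (r / 2) (1 - u).
have s0 : 0 < s by rewrite lt_min divr_gt0//= subr_gt0.
have sr : s <= r / 2 by rewrite ge_min lexx.
have s1 : s <= 1 - u by rewrite ge_min lexx orbT.
have us01 : 0 <= u + s <= 1 by apply/andP; split; lra.
have [v [Gv vu uv]] := grid_times_dense q0 us01 s0.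
by exists v; split=> //; lra.
Qed.

Lemma le_of_grid (R : realType) q (f h : R -> R) (u : R) : (0 < q)%N ->
  {within unit_interval R, continuous f} -> {within unit_interval R, continuous h} ->
  (forall v, grid_times R q v -> f v <= h v) -> 0 <= u <= 1 -> f u <= h u.
Proof.
move=> q0 /within_continuous_eps cf /within_continuous_eps ch fh u01.
have uI : unit_interval R u by rewrite /unit_interval /= in_itv.
apply/ler_addgt0Pr => e e0; have e20 : 0 < e / 2 by rewrite divr_gt0.
have [r1 r10 r1P] := cf u uI _ e20; have [r2 r20 r2P] := ch u uI _ e20.
have r0 : 0 < Num.min r1 r2 by rewrite lt_min r10 r20.
have [v [Gv vu uv]] := grid_times_dense q0 u01 r0.
have vI : unit_interval R v by rewrite /unit_interval /= in_itv; exact: (grid_times01 q0).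
have uvr : `|u - v| < Num.min r1 r2 by rewrite ger0_norm ?subr_ge0//; lra.
move: uvr; rewrite lt_min => /andP[h1 h2].
have := r1P v vI h1; have := r2P v vI h2; have := fh v Gv.
by rewrite !ltr_norml => h3 /andP[h4 h5] /andP[h6 h7]; lra.
Qed.

(** A tube with continuous boundaries only has to be tested at the times of the
grid; hence it is measurable, and an event of the form to which [bridge_rise]
applies: a path of the tube passes below [h + 1] at every time. *)
Lemma tube_paths_in (R : realType) q (l h : R -> R) : (0 < q)%N ->
  {within unit_interval R, continuous l} -> {within unit_interval R, continuous h} ->
  tube l h = paths_in (grid_times R q) l h (fun u => h u + 1) setT.
Proof.
move=> q0 cl ch; have D01 u : grid_times R q u -> 0 <= u <= 1 by exact: grid_times01.
apply/seteqP; split=> w.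
  move=> wlh; have lh u : grid_times R q u -> l u <= ev w u <= h u.
    by move=> /D01/evP[t [<- ->]]; exact: wlh.
  split=> //; exists 1; have G1 := @grid_times_end R q q0; split=> //.
  by have /andP[_ h1] := lh 1 G1; rewrite (le_lt_trans h1)// ltrDl.
move=> [lh _] t; rewrite -ev_val.
have t01 : 0 <= \val t <= 1.
  by have := set_mem (valP t); rewrite /unit_interval /= in_itv.
apply/andP; split.
  apply: (le_of_grid q0 cl (@ev_continuous R w)) => // v Gv.
  by have /andP[] := lh v Gv.
apply: (le_of_grid q0 (@ev_continuous R w) ch) => // v Gv.
by have /andP[] := lh v Gv.
Qed.

(** Conditioning on a tube divides both sides of the hypothesis by the same
number, the measure of the tube.  Bumps for [K1] and [Z] turn the resulting
inequality into one between expectations of continuous functionals, which passes to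
the weak limit. *)
Lemma house_moving_le (R : realType) (nu : probability (borelC01 R) R)
    (gm gp etam etap : R -> R) (d : measure_display) (Omega : measurableType d)
    (P : probability Omega R) (H : {RV P >-> borelC01 R})
    (K1 K Z Z1 : set (borelC01 R)) (C c : R) :
  house_moving nu gm gp etam etap H ->
  {within unit_interval R, continuous gm} -> {within unit_interval R, continuous gp} ->
  measurable K1 -> measurable K -> measurable Z -> measurable Z1 -> 0 <= C -> 0 < c ->
  (forall w v, K1 w -> within_dist c w v -> K v) ->
  (forall w v, Z w -> within_dist c w v -> Z1 v) ->
  (\forall eps \near 0^'+,
     let T := tube (fun u => gm u - etam eps)%R (fun u => gp u + etap eps)%R in
     (nu (K `&` T) <= C%:E * nu (Z `&` T))%E) ->
  (P (H @^-1` K1) <= C%:E * P (H @^-1` Z1))%E.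
Proof.
move=> hm cgm cgp mK1 mK mZ mZ1 C0 c0 K1K ZZ1 hyp.
have [f [cf bf f01 fK1 f_K1]] := bump K1 c0.
have [g [cg bg g01 gZ g_Z]] := bump Z c0.
have fK w : 0 < f w -> K w by move=> /f_K1[v Kv wv]; apply: (K1K v) => // u; rewrite distrC.
have gZ1 w : 0 < g w -> Z1 w by move=> /g_Z[v Kv wv]; apply: (ZZ1 v) => // u; rewrite distrC.
have nu1 : nu setT = 1%E by exact: probability_setT.
have P1 : distribution P H setT = 1%E by exact: probability_setT.
have transfer (F : C01 R -> R) : continuous F -> (forall w, 0 <= F w <= 1) ->
    \int[P]_om F (H om) = \int[distribution P H]_w F w.
  move=> cF F01; rewrite /Rintegral ge0_integral_distribution//.
    by apply/measurable_EFinP; exact: continuous_path_measurable.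
  by move=> w; rewrite lee_fin; have /andP[] := F01 w.
have mT eps : measurable (tube (fun u => gm u - etam eps) (fun u => gp u + etap eps)).
  rewrite (@tube_paths_in R 1)//; first exact: measurable_paths_in.
    by move=> x; apply: continuousB; [exact: cgm|exact: cst_continuous].
  by move=> x; apply: continuousD; [exact: cgp|exact: cst_continuous].
have fin (A : set (borelC01 R)) : measurable A -> nu A \is a fin_num.
  by move=> mA; rewrite fin_num_measure.
have main : \int[P]_om f (H om) <= C * \int[P]_om g (H om).
  have cvg1 := hm f cf bf; have cvg2 := hm g cg bg.
  have cvg3 : C * cond_expectation nu (tube (fun u => gm u - etam eps) (fun u => gp u + etap eps)) g
      @[eps --> 0^'+] --> C * \int[P]_om g (H om) by apply: cvgMl_tmp; exact: cvg2.
  apply: (@ler_cvg_to _ _ _ R _ _ _ _ cvg1 cvg3); move: hyp; apply: filterS => eps /=.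
  move: (mT eps); set T := tube _ _ => mTe h.
  rewrite /cond_expectation mulrA ler_wpM2r ?invr_ge0 ?fine_ge0//.
  apply: (le_trans (@path_integral_le R nu f K T nu1 cf f01 mK mTe fK)).
  apply: (@le_trans _ _ (C * fine (nu (Z `&` T)))); last first.
    by rewrite ler_wpM2l//; exact: (@path_integral_ge R nu g Z T nu1 cg g01 mZ mTe gZ).
  have mI (A : set (borelC01 R)) : measurable A -> nu (A `&` T) = (fine (nu (A `&` T)))%:E.
    by move=> mA; rewrite fineK// fin// ; apply: measurableI.
  by move: h; rewrite (mI K mK) (mI Z mZ) -EFinM lee_fin.
rewrite (transfer f) ?(transfer g)// in main.
have := @path_integral_ge R (distribution P H) f K1 setT P1 cf f01 mK1 measurableT fK1.
have := @path_integral_le R (distribution P H) g Z1 setT P1 cg g01 mZ1 measurableT gZ1.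
rewrite !setIT => h1 h2.
have finP A : measurable A -> P (H @^-1` A) = (fine (distribution P H A))%:E.
  by move=> mA; rewrite fineK// fin_num_measure.
rewrite !finP// -EFinM lee_fin; apply: (le_trans h2); apply: (le_trans main).
by rewrite ler_wpM2l.
Qed.

(** * Contact with the curve in a window of time *)

Lemma Ck01_continuous (R : realType) k (f : R -> R) : Ck01 k f ->
  {within unit_interval R, continuous f}.
Proof.
case: k => [//|k] [f' [f'P _]]; apply/within_continuous_eps => x Ix e e0.
have := f'P x Ix; move: (f' x) => l /cvgrPdist_lt/(_ 1 ltr01).
rewrite /prop_near1 /nbhs /= /within /= => /nbhs_ballP[r /= r0 rP].
have l0 : 0 < `|l| + 1 by rewrite ltr_wpDl.
exists (Num.min r (e / (`|l| + 1))); first by rewrite lt_min r0 divr_gt0.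
move=> y Iy; rewrite lt_min => /andP[xyr xye].
have [->|yx] := eqVneq y x; first by rewrite subrr normr0.
have := rP y xyr yx Iy => h.
have yx0 : y - x != 0 by rewrite subr_eq0.
have hq : `|(f y - f x) / (y - x)| <= `|l| + 1.
  have := ler_normB l (l - (f y - f x) / (y - x)); rewrite opprB addrC subrK => /le_trans; apply.
  by rewrite lerD2l ltW.
rewrite distrC -(divfK yx0 (f y - f x)) normrM.
apply: (@le_lt_trans _ _ ((`|l| + 1) * `|y - x|)); first by rewrite ler_wpM2r.
by rewrite mulrC -ltr_pdivlMr// distrC.
Qed.

Section Contact.
Context (R : realType) (gm gp g etam etap : R -> R).
Hypothesis cgm : {within unit_interval R, continuous gm}.
Hypothesis cgp : {within unit_interval R, continuous gp}.
Hypothesis etam_gt0 : forall eps : R, 0 < eps -> 0 < etam eps.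
Hypothesis etap_gt0 : forall eps : R, 0 < eps -> 0 < etap eps.
Hypothesis etam_to0 : etam eps @[eps --> 0^'+] --> 0.
Hypothesis etap_to0 : etap eps @[eps --> 0^'+] --> 0.
Context (mu : R -> R) (d : measure_display) (Omega : measurableType d)
  (P : probability Omega R) (W X : R -> Omega -> R).
Hypothesis muC1 : C1_line mu.
Hypothesis W_bm : standard_brownian_motion P W.
Hypothesis X_diff : diffusion mu P W X.
Context (nu : probability (borelC01 R) R) (b : R).
Hypothesis nu_bridge : bridge_law P X b nu.
Context (d' : measure_display) (Omega' : measurableType d') (P' : probability Omega' R)
  (H : {RV P' >-> borelC01 R}).
Hypothesis H_hm : house_moving nu gm gp etam etap H.

Let measurable_ev1 (B : set R) : measurable B -> measurable [set w : borelC01 R | B (ev w 1)].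
Proof.
move=> mB; rewrite -[X in measurable X]setTI.
have h1 : 0 <= (1 : R) <= 1 by rewrite ler01 lexx.
exact: (continuous_path_measurable (continuous_ev h1)).
Qed.

(** The bridge ends at [b], so the neighbourhood of the event has measure [0]
under [nu], and a comparison with the empty event applies. *)
Lemma house_moving_end (y : R) : y < b -> P' (H @^-1` [set w | ev w 1 <= y]) = 0%E.
Proof.
move=> yb; pose r := (b - y) / 4.
have r0 : 0 < r by rewrite divr_gt0// subr_gt0.
have yr : y + 4 * r = b by rewrite /r mulrC divfK// addrC subrK.
pose S z : set (borelC01 R) := [set w | ev w 1 <= z].
have mS z : measurable (S z).
  by have := measurable_ev1 (measurable_itv `]-oo, z]); rewrite /S /=; under eq_set do rewrite in_itv.
have h1 : 0 <= (1 : R) <= 1 by rewrite ler01 lexx.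
have Snear (z : R) (w v : C01 R) : S z w -> within_dist r w v -> S (z + r) v.
  by rewrite /S /= => wz wv; have := ev_dist wv h1; rewrite ler_norml => /andP[h2 h3]; lra.
have nu0 : (nu (S (y + r)%R) <= 0%:E * nu set0)%E.
  apply: (@bridge_le R d Omega P X b nu (S (y + r + r)%R) set0 _ _ 0 r r nu_bridge) => //.
  - exact: (sde_measurable X_diff).
  - by move=> rho rho0; exact: (diffusion_hit muC1 W_bm X_diff).
  - by move=> w v; exact: Snear.
  move=> rho rho0 rhor; rewrite [X in (P X <= _)%E](_ : _ = set0) ?measure0 ?mul0e//.
  apply/seteqP; split=> // om [+ /= hX].
  have cX : {within unit_interval R, continuous (X ^~ om)}.
    have cX : {within `[0, +oo[, continuous (X ^~ om)} by move: om {hX}; case: X_diff.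
    apply: continuous_subspaceW cX => s; rewrite /unit_interval /=.
    by rewrite !in_itv /= => /andP[-> _].
  by rewrite /S /= path01E//; move: hX; rewrite ler_norml => /andP[h2 h3]; lra.
apply/eqP; rewrite eq_le measure_ge0 andbT.
have := @house_moving_le R nu gm gp etam etap d' Omega' P' H (S y) (S (y + r)%R) set0 set0 0 r
  H_hm cgm cgp (mS y) (mS _) measurable0 measurable0 (lexx 0) r0.
rewrite mul0e; apply; [by move=> w v; exact: Snear|by []|].
near=> eps => /=; rewrite mul0e; apply: le_trans _ (_ : (nu (S (y + r)%R) <= 0)%E); last first.
  by move: nu0; rewrite mul0e.
have mT : measurable (tube (fun u => gm u - etam eps) (fun u => gp u + etap eps)).
  rewrite (@tube_paths_in R 1)//; first exact: measurable_paths_in.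
    by move=> x; apply: continuousB; [exact: cgm|exact: cst_continuous].
  by move=> x; apply: continuousD; [exact: cgp|exact: cst_continuous].
by apply: le_measure; rewrite ?inE; [apply: measurableI|exact: mS|].
Unshelve. all: by end_near. Qed.

Context (M0 L B : R).
Hypothesis M00 : 0 <= M0.
Hypothesis gM0 : forall u, 0 <= u <= 1 -> [/\ `|gm u| <= M0, `|gp u| <= M0 & `|g u| <= M0].
Hypothesis L0 : 0 <= L.
Hypothesis muL : forall x y : R, `|mu (clamp (M0 + 4) x) - mu (clamp (M0 + 4) y)| <= L * `|x - y|.
Hypothesis muB : forall x : R, `|mu (clamp (M0 + 4) x)| <= B.

(** The window is [[j / q, (j + 2) / q]], and [J] is a part of its middle half,
where the bump of [bend_lift] has a definite height. *)
Section Window.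
Context (q j : nat) (kappa a : R) (J : set R).
Hypothesis q0 : (0 < q)%N.
Hypothesis Lq : 4 * L <= q%:R.
Hypothesis jq : (j + 3 <= q)%N.
Hypothesis kappa0 : 0 < kappa.
Hypothesis kappa1 : kappa <= 1.
Hypothesis aM0 : M0 <= a.
Hypothesis Jin : forall u, J u -> (2 * j%:R + 1) / 2 <= q%:R * u <= (2 * j%:R + 3) / 2.

Local Notation grid := (grid_times R q).
Local Notation C := (36 * expR (18 * (2 * (M0 + 4) + B + 18)) ^+ 2).

Let lower (e z u : R) := if u \in J then g u + e else - z.
Let upper (e z u : R) := if j%:R <= q%:R * u <= j%:R + 2 then gp u - e else z.

(** The bounds [- a] and [a] outside [J] and outside the window only make the
event one of the form [paths_in]. *)
Definition touching (e : R) : set (borelC01 R) :=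
  paths_in grid (fun u => if u \in J then g u - e else - a)
    (fun u => if j%:R <= q%:R * u <= j%:R + 2 then gp u - 2 * kappa else a)
    (fun u => g u + e) J.

(** The constants come from [eta = 128 * q * e] in [bridge_rise]: the bump is at
least [4 e] and at most [512 e] high on [J], and the remaining units are lost in the
passages to the limit. *)
Definition near_miss (e : R) : set (borelC01 R) :=
  paths_in grid (fun u => if u \in J then g u + e else - (a + 2)) (fun=> a + 2)
    (fun u => g u + 516 * e) J.

Let e0 : R := kappa / (512 * q%:R).

Let qR : 1 <= q%:R :> R. Proof. by rewrite ler1n. Qed.

Let q512 : 0 < 512 * q%:R :> R.
Proof. by rewrite mulr_gt0 ?ltr0n. Qed.

Let e0_gt0 : 0 < e0.
Proof. exact: divr_gt0. Qed.

Let C0 : 0 <= C.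
Proof. by apply: mulr_ge0; [rewrite ler0n|rewrite exprn_ge0 ?expR_ge0]. Qed.

(** Inside the tubes the constraint of touching is a corridor bounded by the tube
itself, to which [bridge_rise] applies; the margin [kappa] leaves room for the bump
below the upper boundary. *)
Lemma touching_le e : 0 < e -> e <= e0 ->
  (P' (H @^-1` touching e) <= C%:E * P' (H @^-1` near_miss e))%E.
Proof.
move=> egt0 ee0.
have D01 u : grid u -> 0 <= u <= 1 by exact: grid_times01.
have qgt0 : 0 < q%:R :> R by rewrite ltr0n.
have eq1 : 512 * q%:R * e <= kappa.
  by rewrite mulrC -(ler_pdivlMr _ _ q512).
have kap := kappa1; have kap0 := kappa0; have aM := aM0; have MM := M00.
have e512 : 512 * e <= kappa.
  have q1 := qR; have q5 : 512 <= 512 * q%:R :> R by lra.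
  exact: le_trans (ler_wpM2r (ltW egt0) q5) eq1.
(* K contains the e-neighbourhood of the touching paths, and the e-neighbourhood
   of Z is made of near misses. *)
pose K := paths_in grid (lower (- (2 * e)) (a + 1)) (upper (2 * kappa - e) (a + 1)) (fun u => g u + 2 * e) J.
pose Z := paths_in grid (lower (2 * e) (a + 1)) (fun=> a + 1) (fun u => g u + 515 * e) J.
pose eta := 128 * q%:R * e.
have eta0 : 0 < eta by rewrite !mulr_gt0 ?ltr0n.
have eta1 : eta <= 1 by rewrite /eta; lra.
have eta4 : 4 * eta / q%:R = 512 * e by rewrite /eta; field; rewrite gt_eqF.
have eta32 : eta / (32 * q%:R) = 4 * e by rewrite /eta; field; rewrite gt_eqF.
have M1 : 1 <= M0 + 4 by lra.
have mA : measurable (touching e) by exact: measurable_paths_in.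
have mK : measurable K by exact: measurable_paths_in.
have mZ : measurable Z by exact: measurable_paths_in.
have mB : measurable (near_miss e) by exact: measurable_paths_in.
apply: (@house_moving_le R nu gm gp etam etap d' Omega' P' H _ K Z _ C e H_hm cgm cgp
  mA mK mZ mB C0 egt0).
- move=> w v Aw wv; have := paths_in_near D01 Aw wv; apply: paths_inS => u Du.
  + by rewrite /lower; case: ifP => _; lra.
  + by rewrite /upper; case: ifP => _; lra.
  + by move=> Ju; split; [exact: Ju|lra].
- move=> w v Aw wv; have := paths_in_near D01 Aw wv; apply: paths_inS => u Du.
  + by rewrite /lower; case: ifP => _; lra.
  + by lra.
  + by move=> Ju; split; [exact: Ju|lra].
have /cvgrPdist_lt/(_ 1 ltr01) em := etam_to0.
have /cvgrPdist_lt/(_ 1 ltr01) ep := etap_to0.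
near=> eps => /=.
have eps0 : 0 < eps by near: eps; exact: nbhs_right_gt.
have em0 := etam_gt0 eps0; have ep0 := etap_gt0 eps0.
have em1 : etam eps < 1.
  have h : `|0 - etam eps| < 1 by near: eps.
  by rewrite sub0r normrN gtr0_norm in h.
have ep1 : etap eps < 1.
  have h : `|0 - etap eps| < 1 by near: eps.
  by rewrite sub0r normrN gtr0_norm in h.
pose lT u := gm u - etam eps; pose hT u := gp u + etap eps.
have clT : {within unit_interval R, continuous lT}.
  by move=> x; apply: continuousB; [exact: cgm|exact: cst_continuous].
have chT : {within unit_interval R, continuous hT}.
  by move=> x; apply: continuousD; [exact: cgp|exact: cst_continuous].
have lTM u : 0 <= u <= 1 -> - M0 - 1 <= lT u.
  by move=> /gM0[+ _ _]; rewrite /lT ler_norml => /andP[h1 h2]; lra.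
have hTM u : 0 <= u <= 1 -> hT u <= M0 + 1.
  by move=> /gM0[_ + _]; rewrite /hT ler_norml => /andP[h1 h2]; lra.
rewrite -/lT -/hT (tube_paths_in q0 clT chT).
(* Inside the tube the upper bound on the raised path is that of the tube alone. *)
pose lo u := Num.max (lower (- (2 * e)) (a + 1) u) (lT u).
pose hi u := Num.min (upper (2 * kappa - e) (a + 1) u) (hT u).
pose lo' u := Num.max (lower (2 * e) (a + 1) u) (lT u).
pose p u := g u + 2 * e; pose p' u := g u + 515 * e.
apply: (@le_trans _ _ (nu (paths_in grid lo hi p J))).
  apply: le_measure; rewrite ?inE; [by apply: measurableI; exact: measurable_paths_in|exact: measurable_paths_in|].
  move=> w [[Kw Ke] [Tw _]]; split=> // u Du; rewrite /lo /hi ge_max le_min.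
  by have /andP[-> ->] := Kw u Du; have /andP[-> ->] := Tw u Du.
apply: (@le_trans _ _ (C%:E * nu (paths_in grid lo' hT p' J))%E).
  apply: (@bridge_rise R mu d Omega P W X muC1 W_bm X_diff (M0 + 4) L B q j eta M1 L0 muL muB
    q0 Lq jq eta0 eta1 b nu e) => //.
  - move=> u u01; rewrite /lo /hi; have h1 := lTM u u01; have h2 := hTM u u01.
    have g1 : lT u <= Num.max (lower (- (2 * e)) (a + 1) u) (lT u) by rewrite le_max lexx orbT.
    have g2 : Num.min (upper (2 * kappa - e) (a + 1) u) (hT u) <= hT u by rewrite ge_min lexx orbT.
    by split; lra.
  - move=> u u01; rewrite /lo'; have h1 := lTM u u01; have h2 := hTM u u01.
    have g1 : lT u <= Num.max (lower (2 * e) (a + 1) u) (lT u) by rewrite le_max lexx orbT.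
    by split; lra.
  - move=> u; rewrite /lo /lo' /lower eta32; case: ifPn => [/set_mem/Jin Ju|_]; last by left.
    right; split=> //; rewrite ge_max.
    have g1 : lT u <= Num.max (g u + - (2 * e)) (lT u) by rewrite le_max lexx orbT.
    have g2 : g u + - (2 * e) <= Num.max (g u + - (2 * e)) (lT u) by rewrite le_max lexx.
    by apply/andP; split; lra.
  - by move=> u; rewrite /hi ge_min lexx orbT.
  - move=> u uj; rewrite /hi /upper uj eta4.
    have g2 : Num.min (gp u - (2 * kappa - e)) (hT u) <= gp u - (2 * kappa - e) by rewrite ge_min lexx.
    by rewrite /hT in g2 *; lra.
  - by move=> u Ju; rewrite /p /p' eta4; lra.
apply: lee_wpmul2l; first by rewrite lee_fin; exact: C0.
apply: le_measure; rewrite ?inE; [exact: measurable_paths_in|by apply: measurableI; exact: measurable_paths_in|].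
move=> w [lh [u [Du Ju up]]].
have lh' v : grid v -> [/\ lower (2 * e) (a + 1) v <= ev w v, lT v <= ev w v & ev w v <= hT v].
  by move=> Dv; have := lh v Dv; rewrite /lo' ge_max => /andP[/andP[h1 h2] h3].
split; split.
- move=> v Dv; have [-> _ h] := lh' v Dv; have := hTM v (D01 v Dv).
  by rewrite /=; lra.
- by exists u.
- by move=> v Dv; have [_ -> ->] := lh' v Dv.
- by exists u; split=> //; have [_ _ h] := lh' u Du; rewrite (le_lt_trans h)// ltrDl.
Unshelve. all: by end_near. Qed.

(** The near misses at distance [e] are contained in [U], where the path stays
away from [g] on [J], and in [V], where it comes within [516 e] of [g]; as [e] tends
to [0] the intersections decrease to the empty set. *)
Lemma touching_null :
  P' (\bigcap_n (H @^-1` touching (e0 / n.+1%:R))) = 0%E.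
Proof.
pose en n : R := e0 / n.+1%:R.
have en0 n : 0 < en n by rewrite divr_gt0.
have ene n : en n <= e0 by rewrite ler_pdivrMr// ler_peMr ?ler1n// ltW.
have endec n : en n.+1 <= en n by rewrite ler_pM2l// lef_pV2 ?posrE// ler_nat.
have D01 u : grid u -> 0 <= u <= 1 by exact: grid_times01.
have mH S : measurable S -> measurable (H @^-1` S).
  by move=> mS; rewrite -[X in measurable X]setTI; exact: measurable_funPT.
have mA e : measurable (touching e) by exact: measurable_paths_in.
pose U : set (borelC01 R) := \bigcup_m paths_in grid (fun u => if u \in J then g u + en m else - (a + 2))
  (fun=> a + 2) (fun=> a + 4) J.
pose V n : set (borelC01 R) := paths_in grid (fun=> - (a + 2)) (fun=> a + 2) (fun u => g u + 516 * en n) J.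
have mU : measurable U by apply: bigcup_measurable => m _; exact: measurable_paths_in.
have mV n : measurable (V n) by exact: measurable_paths_in.
have aM := aM0; have kap := kappa1.
have e01 : 516 * e0 <= 2.
  have h1 : e0 * (512 * q%:R) = kappa by rewrite /e0 divfK ?gt_eqF.
  have q1 := qR; have q5 : 512 <= 512 * q%:R :> R by lra.
  by have := ler_wpM2l (ltW e0_gt0) q5; rewrite h1; lra.
have missUV n : near_miss (en n) `<=` U `&` V n.
  move=> w mw; split; last first.
    apply: paths_inS mw => u Du //; case: ifP => _ //.
    have [_ _] := gM0 (D01 u Du); rewrite ler_norml => /andP[h1 h2].
    by have := en0 n; lra.
  exists n => //; apply: paths_inS mw => u Du // Ju; split=> //.
  have [_ _] := gM0 (D01 u Du); rewrite ler_norml => /andP[h1 h2].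
  by have := ene n; lra.
have UV0 : \bigcap_n (H @^-1` (U `&` V n)) = set0.
  apply/seteqP; split=> // om h.
  have [[m _ [Um _]] _] := h 0%N I.
  have [n n1] : exists n, 516 * en n <= en m.
    exists (Num.truncn (516 * e0 / en m)); rewrite {1}/en mulrA ler_pdivrMr ?ltr0Sn//.
    rewrite [X in _ <= X]mulrC -ler_pdivrMr ?en0//.
    by rewrite ltW// truncnS_gt.
  have [_ [_ [u [Du Ju up]]]] := h n I.
  by have := Um u Du; rewrite (mem_set Ju) => /andP[h1 _]; lra.
apply/eqP; rewrite eq_le measure_ge0 andbT.
rewrite -(mule0 C%:E) -(measure0 P') -UV0; apply: le_measure_bigcap.
- by move=> n; apply: mH; exact: measurableI.
- move=> n om [h1 h2]; split=> //; apply: paths_inS h2 => u Du // Ju; split=> //.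
  by have := endec n; lra.
move=> n; apply: (@le_trans _ _ (P' (H @^-1` touching (en n)))).
  apply: le_measure; rewrite ?inE; [by apply: bigcap_measurableType => m _; exact: mH|exact: mH|].
  by move=> om; apply.
apply: (le_trans (touching_le (en0 n) (ene n))).
apply: lee_wpmul2l; first by rewrite lee_fin; exact: C0.
apply: le_measure; rewrite ?inE; [by apply: mH; exact: measurable_paths_in|by apply: mH; exact: measurableI|].
by move=> om; exact: missUV.
Qed.

End Window.
End Contact.

(** * The minimum over [t, 1] *)

Lemma continuous01_bounded (R : realType) (f : R -> R) :
  {within unit_interval R, continuous f} ->
  exists2 M : R, 0 <= M & forall u : R, 0 <= u <= 1 -> `|f u| <= M.
Proof.
move=> /within_continuous_norm cf; have [c _ cmax] := EVT_max ler01 cf.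
by exists `|f c| => // u u01; apply: cmax; rewrite in_itv.
Qed.

Section Gap.
Context (R : realType) (g : R -> R) (t : R).
Hypothesis cg : {within unit_interval R, continuous g}.
Hypothesis t01 : 0 < t < 1.

Definition gap_min (w : C01 R) : R :=
  inf [set w u - g (\val u) | u in [set u : unit_interval R | t <= \val u]].

(** By compactness the infimum is attained; the time is given as a real number
because all estimates are in terms of [ev]. *)
Lemma gap_minP (w : C01 R) : exists u : R, [/\ t <= u <= 1, gap_min w = ev w u - g u &
  forall v, t <= v <= 1 -> gap_min w <= ev w v - g v].
Proof.
have /andP[t0 t1] := t01.
have ch : {within `[t, 1], continuous (fun u => ev w u - g u)}.
  have ch : {within unit_interval R, continuous (fun u => ev w u - g u)}.
    by move=> x; apply: continuousB; [exact: ev_continuous|exact: cg].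
  apply: continuous_subspaceW ch => s; rewrite /unit_interval /= !in_itv /=.
  by move=> /andP[h1 ->]; rewrite andbT (le_trans _ h1)// ltW.
have [u + umin] := EVT_min (ltW t1) ch; rewrite in_itv /= => ut.
have in01 v : t <= v <= 1 -> 0 <= v <= 1.
  by move=> /andP[h1 ->]; rewrite andbT (le_trans _ h1)// ltW.
have lb : lbound [set w u - g (\val u) | u in [set u : unit_interval R | t <= \val u]] (ev w u - g u).
  move=> _ [v /= tv <-]; rewrite -ev_val; apply: umin; rewrite in_itv /= tv /=.
  by have := set_mem (valP v); rewrite /unit_interval /= in_itv /= => /andP[].
have mem v : t <= v <= 1 ->
    [set w u - g (\val u) | u in [set u : unit_interval R | t <= \val u]] (ev w v - g v).
  move=> vt; have [s [sv evs]] := evP (in01 v vt); exists s; last by rewrite evs sv.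
  by rewrite /= sv; case/andP: vt.
have le_gap v : t <= v <= 1 -> gap_min w <= ev w v - g v.
  by move=> /mem; apply: ge_inf; exists (ev w u - g u).
exists u; split=> //; apply/eqP; rewrite eq_le le_gap//=.
by apply: lb_le_inf => //; exists (ev w u - g u); exact: mem.
Qed.

Lemma measurable_gap_min (B : set R) : measurable B -> measurable [set w : borelC01 R | B (gap_min w)].
Proof.
have c_gap : continuous gap_min.
  apply: (@lipschitz_path_continuous _ _ 1) => // w v e e0 wv; rewrite mul1r.
  have [u [ut -> _]] := gap_minP w; have [_ [_ _ /(_ u ut)]] := gap_minP v.
  have u01 : 0 <= u <= 1.
    have /andP[t0 t1] := t01; have /andP[h1 ->] := ut.
    by rewrite andbT (le_trans _ h1)// ltW.
  by have := ev_dist wv u01; rewrite ler_norml => /andP[h1 h2]; lra.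
move=> mB; rewrite -[X in measurable X]setTI.
exact: (continuous_path_measurable c_gap).
Qed.
End Gap.

(** Any [q] that is large compared with [1 / t], [1 / (1 - u)] and [1 / r] works;
[j] is then the integer part of [q u - 1 / 2], so that [u] is in the middle half of
the window. *)
Lemma window_choice (R : realType) (L t u r : R) : 0 <= L -> 0 < t -> t <= u -> u < 1 -> 0 < r ->
  exists q j, [/\ (0 < q)%N, 4 * L <= q%:R, (j + 3 <= q)%N,
    (2 * j%:R + 1) / 2 <= q%:R * u /\ q%:R * u < (2 * j%:R + 3) / 2 &
    forall v : R, j%:R <= q%:R * v <= j%:R + 2 -> `|u - v| < r].
Proof.
move=> L0 t0 tu u1 r0; have u0 : 0 < u by exact: lt_le_trans tu.
have u10 : 0 < 1 - u by rewrite subr_gt0.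
pose x := 4 * L + u^-1 + 3 / (1 - u) + 2 / r.
have ui : 0 < u^-1 by rewrite invr_gt0.
have h3 : 0 < 3 / (1 - u) by rewrite divr_gt0.
have h2 : 0 < 2 / r by rewrite divr_gt0.
pose q := (Num.truncn x).+1.
have xq : x < q%:R by exact: truncnS_gt.
have q0 : 0 < q%:R :> R by rewrite ltr0n.
have q4L : 4 * L <= q%:R by move: xq; rewrite /x => xq; lra.
have qu : 1 <= q%:R * u.
  by rewrite -ler_pdivrMr// mul1r; move: xq; rewrite /x => xq; lra.
have q3 : 3 <= q%:R * (1 - u).
  by rewrite -ler_pdivrMr//; move: xq; rewrite /x => xq; lra.
have qr : 2 <= q%:R * r.
  by rewrite -ler_pdivrMr//; move: xq; rewrite /x => xq; lra.
have y0 : 0 <= q%:R * u - 1 / 2 by lra.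
have /andP[] := truncn_itv y0; set j := Num.truncn _ => j1.
rewrite -(natr1 j) => j2.
exists q, j; split=> //.
- by rewrite -(@ler_nat R) natrD; lra.
- by split; lra.
move=> v /andP[v1 v2].
have qd : `|q%:R * (u - v)| < 2 by rewrite ltr_norml; apply/andP; split; lra.
rewrite -(ltr_pM2l q0); apply: lt_le_trans qr.
by move: qd; rewrite normrM (ger0_norm (ltW q0)).
Qed.

(* The infima below are over nonempty compact intervals, of continuous
   functions, hence are minima. *)
Theorem corollary2 (R : realType) (gm gp : R -> R)
  (gmC2 : Ck01 2 gm) (gpC2 : Ck01 2 gp)
  (gap : 0 < inf [set gp u - gm u | u in unit_interval R])
  (gm0 : gm 0 = 0)
  (etam etap : R -> R)
  (etam_gt0 : forall eps, 0 < eps -> 0 < etam eps)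
  (etap_gt0 : forall eps, 0 < eps -> 0 < etap eps)
  (etam_to0 : etam eps @[eps --> 0^'+] --> 0)
  (etap_to0 : etap eps @[eps --> 0^'+] --> 0)
  (mu : R -> R) (muC1 : C1_line mu)
  (d : measure_display) (Omega : measurableType d) (P : probability Omega R)
  (W X : R -> Omega -> R)
  (W_bm : standard_brownian_motion P W) (X_diff : diffusion mu P W X)
  (nu : probability (borelC01 R) R) (nu_bridge : bridge_law P X (gp 1) nu)
  (d' : measure_display) (Omega' : measurableType d') (P' : probability Omega' R)
  (H : {RV P' >-> borelC01 R})
  (H_hm : house_moving nu gm gp etam etap H)
  (g : R -> R) (gC1 : Ck01 1 g)
  (g_between : forall u, unit_interval R u -> gm u <= g u < gp u)
  (t : R) (t01 : 0 < t < 1) :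
  P' [set om | inf [set (H om : C01 R) u - g (\val u)
                   | u in [set u : unit_interval R | t <= \val u]] = 0] = 0%E.
Proof.
have cgm := Ck01_continuous gmC2; have cgp := Ck01_continuous gpC2.
have cg := Ck01_continuous gC1; have /andP[t0 t1] := t01.
have ggp u : 0 <= u <= 1 -> g u < gp u.
  move=> u01; have uI : unit_interval R u by rewrite /unit_interval /= in_itv.
  by have /andP[] := g_between u uI.
have [Mm Mm0 MmP] := continuous01_bounded cgm.
have [Mp Mp0 MpP] := continuous01_bounded cgp.
have [Mg Mg0 MgP] := continuous01_bounded cg.
pose M0 := Mm + Mp + Mg.
have M00 : 0 <= M0 by rewrite /M0; lra.
have gM0 u : 0 <= u <= 1 -> [/\ `|gm u| <= M0, `|gp u| <= M0 & `|g u| <= M0].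
  move=> u01; have := MmP u u01; have := MpP u u01; have := MgP u u01.
  by rewrite /M0 => h1 h2 h3; split; lra.
have M40 : 0 <= M0 + 4 by lra.
have [L [B [L0 muL muB]]] := truncated_drift muC1 M40.
have mH S : measurable S -> measurable (H @^-1` S).
  by move=> mS; rewrite -[X in measurable X]setTI; exact: measurable_funPT.
have h1 : 0 <= (1 : R) <= 1 by rewrite ler01 lexx.
have ggp1 := ggp 1 h1.
pose J q j : set R := [set u | t <= u /\ (2 * j%:R + 1) / 2 <= q%:R * u <= (2 * j%:R + 3) / 2].
pose ok q j k := [/\ (0 < q)%N, 4 * L <= q%:R, (j + 3 <= q)%N & M0 <= k%:R].
pose kap k : R := k.+1%:R^-1.
pose S q j k : set Omega' := \bigcap_n
  (H @^-1` touching gp g q j (kap k) k%:R (J q j) (kap k / (512 * q%:R) / n.+1%:R)).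
pose N q j k : set Omega' := [set om | ok q j k /\ S q j k om].
have N0 q j k : P'.-negligible (N q j k).
  have [[q0 Lq jq kM]|nok] := pselect (ok q j k); last first.
    have -> : N q j k = set0 by rewrite /N; apply/seteqP; split=> // om [].
    exact: negligible_set0.
  apply: (@negligibleS _ _ _ _ (S q j k)); first by move=> om [].
  apply/negligibleP.
    by apply: bigcap_measurableType => n _; apply: mH; exact: measurable_paths_in.
  apply: (@touching_null R gm gp g etam etap cgm cgp etam_gt0 etap_gt0 etam_to0 etap_to0
    mu d Omega P W X muC1 W_bm X_diff nu (gp 1) nu_bridge d' Omega' P' H H_hm M0 L B M00 gM0
    L0 muL muB q j (kap k) k%:R (J q j) q0 Lq jq _ _ kM).
  - by rewrite invr_gt0 ltr0Sn.
  - by rewrite invf_le1 ?ltr0Sn// ler1n.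
  - by move=> u [].
have end0 : P'.-negligible (H @^-1` [set w | ev w 1 <= g 1]).
  apply/negligibleP.
    apply: mH; rewrite -[X in measurable X]setTI.
    rewrite (_ : [set w : borelC01 R | _] = (fun w : borelC01 R => ev w 1) @^-1` `]-oo, g 1]%classic); last first.
      by apply/seteqP; split=> w; rewrite /= in_itv.
    exact: (continuous_path_measurable (continuous_ev h1)).
  exact: (@house_moving_end R gm gp etam etap cgm cgp mu d Omega P W X muC1 W_bm X_diff nu (gp 1)
    nu_bridge d' Omega' P' H H_hm).
have -> : [set om | inf [set (H om : C01 R) u - g (\val u)
                   | u in [set u : unit_interval R | t <= \val u]] = 0] =
  H @^-1` [set w | gap_min g t w = 0] by [].
have mE : measurable (H @^-1` [set w | gap_min g t w = 0]).
  apply: mH; exact: (measurable_gap_min cg t01 (measurable_set1 0)).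
apply/(negligibleP _ mE).
apply: (@negligibleS _ _ _ _ ((H @^-1` [set w | ev w 1 <= g 1]) `|`
  \bigcup_q \bigcup_j \bigcup_k N q j k)); last first.
  apply: negligibleU => //; do 3 apply: negligible_bigcup => ?; exact: N0.
move=> om; pose w : C01 R := H om => w0; have {}w0 : gap_min g t w = 0 by [].
have [u [ut wu above]] := gap_minP cg t01 w.
rewrite w0 in wu above; have /andP[tu u1] := ut.
have [uE|u_neq1] := eqVneq u 1.
  by left; change (ev w 1 <= g 1); rewrite -uE; lra.
right; have {}u1 : u < 1 by rewrite lt_neqAle u_neq1.
have u01 : 0 <= u <= 1 by rewrite (ltW u1) andbT (le_trans _ tu)// ltW.
have uI : unit_interval R u by rewrite /unit_interval /= in_itv.
pose kp := (gp u - g u) / 4.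
have kp0 : 0 < kp by rewrite divr_gt0// subr_gt0 ggp.
have kp4 : gp u = g u + 4 * kp by rewrite /kp mulrC divfK//; lra.
have ch : {within unit_interval R, continuous (fun v => gp v - ev w v)}.
  by move=> x; apply: continuousB; [exact: cgp|exact: ev_continuous].
have kp20 : 0 < 2 * kp by rewrite mulr_gt0.
have /within_continuous_eps/(_ u uI _ kp20)[r r0 rP] := ch.
have [q [j [q0 Lq jq uj near_u]]] := window_choice L0 t0 tu u1 r0.
have [Mw Mw0 MwP] := continuous01_bounded (@ev_continuous R w).
(* The integer k gives both the margin 1 / (k + 1) and a bound on the path. *)
pose k := (Num.truncn (M0 + Mw + kp^-1)).+1.
have kpi : 0 < kp^-1 by rewrite invr_gt0.
have kb : M0 + Mw + kp^-1 < k%:R by exact: truncnS_gt.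
have kapk : kap k <= kp.
  rewrite /kap invf_ple ?posrE ?ltr0Sn// (le_trans _ (_ : k%:R <= _)) ?ler_nat//; lra.
have in01 v : grid_times R q v -> 0 <= v <= 1 by exact: grid_times01.
exists q => //; exists j => //; exists k => //; split; first by split=> //; lra.
move=> n _ /=; pose e : R := kap k / (512 * q%:R) / n.+1%:R.
have e0 : 0 < e.
  have q512 : 0 < 512 * q%:R :> R by rewrite mulr_gt0 ?ltr0n.
  have kap0 : 0 < kap k by rewrite invr_gt0 ltr0Sn.
  by apply: divr_gt0; [exact: divr_gt0|exact: ltr0Sn].
change (touching gp g q j (kap k) k%:R (J q j) e w); split.
  move=> v Gv; have v01 := in01 v Gv; have /andP[v0 v1] := v01.
  have := MwP v v01; rewrite ler_norml => /andP[wv1 wv2].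
  apply/andP; split.
    case: ifPn => [/set_mem[tv _]|_]; last by lra.
    have := above v; rewrite tv v1 => /(_ isT); lra.
  case: ifPn => [vj|_]; last by lra.
  have vI : unit_interval R v by rewrite /unit_interval /= in_itv.
  have := rP v vI (near_u v vj); rewrite ltr_norml => /andP[h2 h3]; lra.
have cd : {within unit_interval R, continuous (fun v => ev w v - g v)}.
  by move=> x; apply: continuousB; [exact: ev_continuous|exact: cg].
have /within_continuous_eps/(_ u uI _ e0)[r1 r10 r1P] := cd.
have [uj1 uj2] := uj.
have qR : 0 < q%:R :> R by rewrite ltr0n.
(* The time u itself need not belong to the grid; a grid time slightly to the
   right of u does as well. *)
pose r2 := Num.min r1 (((2 * j%:R + 3) / 2 - q%:R * u) / q%:R).
have r20 : 0 < r2 by rewrite lt_min r10 divr_gt0 ?subr_gt0.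
have u0 : 0 <= u by have /andP[] := u01.
have [v [Gv uv vu]] := grid_times_right q0 u0 u1 r20.
have uvr1 : `|u - v| < r1.
  rewrite distrC gtr0_norm ?subr_gt0// ltrBlDl; apply: (lt_le_trans vu).
  by rewrite lerD2l ge_min lexx.
have v_le : q%:R * v <= (2 * j%:R + 3) / 2.
  rewrite mulrC -ler_pdivlMr//; apply/ltW/(lt_le_trans vu); rewrite addrC -lerBrDr.
  apply: (@le_trans _ _ (((2 * j%:R + 3) / 2 - q%:R * u) / q%:R)).
    by rewrite ge_min lexx orbT.
  by rewrite mulrBl (mulrC q%:R) mulfK ?gt_eqF.
have vI : unit_interval R v by rewrite /unit_interval /= in_itv; exact: in01.
exists v; split=> //.
  split; first exact: le_trans tu (ltW uv).
  by rewrite v_le andbT (le_trans uj1)// ler_pM2l// ltW.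
by have := r1P v vI uvr1; rewrite ltr_norml -/e => /andP[h2 h3]; lra.
Qed.
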